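(* Let $G$ be a non-cyclic simple dimension group. Then $G$ is stationary (as an ordered abelian group) if and only if, for some integer $r \ge 0$, it is order isomorphic to a subgroup of $\mathbb{R}\oplus\mathbb{Q}^{r}$, ordered by the first coordinate, that is generated by the following: \begin{enumerate} \item a non-cyclic subgroup $H\subset \mathbb{R}\oplus 0^r$ which, with the order inherited from $\mathbb{R}\oplus\mathbb{Q}^r$, is a stationary ordered abelian group; \item a rank-$r$ subgroup $K\subset\{(0,q_1,\ldots,q_r)\in\mathbb{R}\oplus\mathbb{Q}^r\}$ that is stationary in the category of unordered torsion-free abelian groups; and \item a finite set $\{z_1,\ldots,z_s\}\subset (H+K)\otimes\mathbb{Q}\subset\mathbb{R}\oplus\mathbb{Q}^r$. \end{enumerate} Moreover, when $G$ is stationary, the number $s$ of extra generators can be taken to be less than or equal to the minimum of the ranks of $H$ and $K$.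
   Context: All ordered abelian groups $G$, with positive cone $G^+=\{g\in G: g\ge 0\}$, are assumed directed: $G=G^+-G^+$. A homomorphism of ordered groups is positive if it maps the positive cone into the positive cone; an order isomorphism is a group isomorphism carrying one positive cone onto the other. A simplicial group is $\mathbb{Z}^k$ with positive cone the vectors with non-negative entries. A dimension group is an ordered abelian group isomorphic to the inductive limit, in the category of ordered abelian groups, of a sequence $G_1\to G_2\to\cdots$ of simplicial groups and positive homomorphisms $A_i$. (Elements of the limit are classes $[g,i]$ with $g\in G_i$, where two pairs are identified if they have the same image at some later stage; $[g,i]$ is positive iff $A_{j-1}\cdots A_i g\in G_j^+$ for some $j\ge i$.) A dimension group $G$ is simple if it is non-zero and for all $g,h\in G^+$ with $g\ne0$ there is $n\in\mathbb{N}$ with $0\le h\le ng$. An ordered abelian group is stationary if it is order isomorphic to the inductive limit (in ordered abelian groups) of a sequence $\mathbb{Z}^k\xrightarrow{A}\mathbb{Z}^k\xrightarrow{A}\mathbb{Z}^k\xrightarrow{A}\cdots$ with the same positive homomorphism $A$ (a non-negative integer matrix) at each stage. An (unordered) torsion-free abelian group is stationary if it is isomorphic to the inductive limit, in the category of torsion-free abelian groups, of a sequence $\mathbb{Z}^k\xrightarrow{A}\mathbb{Z}^k\xrightarrow{A}\cdots$ with the same homomorphism $A$ (an integer matrix) at each stage. A subgroup $G\subset\mathbb{R}\oplus\mathbb{Q}^r$ is ordered by the first coordinate if $G^+=(G\cap\{(x,q_1,\dots,q_r): x>0\})\cup\{0\}$. The rank of a torsion-free abelian group $G$ is $\dim_{\mathbb{Q}}(G\otimes\mathbb{Q})$.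 Here $(H+K)\otimes\mathbb{Q}$ is identified with the $\mathbb{Q}$-linear span of $H+K$ in $\mathbb{R}\oplus\mathbb{Q}^r$. *)

(* Defs.v *)
From HB Require Import structures.
From mathcomp Require Import all_boot all_order all_algebra.
From mathcomp Require Import generic_quotient.
From mathcomp Require Import boolp classical_sets reals.
Set Implicit Arguments.
Unset Strict Implicit.
Unset Printing Implicit Defensive.
Import Order.TTheory GRing.Theory Num.Theory.
Local Open Scope classical_set_scope.
Local Open Scope ring_scope.
Local Open Scope quotient_scope.

(* A group is given as a subset D of an ambient abelian group V, and an ordered
   group as D together with its positive cone P. *)
Section Groups.
Variable V : zmodType.
Implicit Types D P X : set V.

Definition subgroup D : Prop :=
  D 0 /\ (forall x y, D x -> D y -> D (x - y)).

Definition generated X : set V := smallest subgroup X.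

Definition cyclic_group D : Prop :=
  exists g : V, D = [set x | exists m : int, x = g *~ m].

Record ordered_group D P : Prop := OrderedGroup {
  ordered_subgroup : subgroup D;
  cone_sub : P `<=` D;
  cone_zero : P 0;
  cone_add : forall x y, P x -> P y -> P (x + y);
  cone_antisym : forall x, P x -> P (- x) -> x = 0;
  cone_directed : forall x, D x -> exists y z, [/\ P y, P z & x = y - z]
}.

Definition simple_ordered D P : Prop :=
  (exists2 x, D x & x <> 0) /\
  (forall g h, P g -> P h -> g <> 0 -> exists n : nat, P (g *+ n - h)).

End Groups.

Section Isomorphisms.
Variables V W : zmodType.

Definition is_group_iso (D : set V) (E : set W) (f : V -> W) : Prop :=
  [/\ {in D &, forall x y, f (x + y) = f x + f y},
      {in D &, injective f} & f @` D = E].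

Definition group_iso (D : set V) (E : set W) : Prop :=
  exists f : V -> W, is_group_iso D E f.

Definition order_iso (D P : set V) (E Q : set W) : Prop :=
  exists2 f : V -> W, is_group_iso D E f & f @` P = Q.

End Isomorphisms.

(* The inductive limit of Z^(k 0) -> Z^(k 1) -> ... along integer matrices A i
   acting on column vectors. *)
Section InductiveLimit.
Variables (k : nat -> nat) (A : forall i, 'M[int]_(k i.+1, k i)).

Definition stage_elt : Type := {i : nat & 'cV[int]_(k i)}.

Implicit Types u v w : stage_elt.

(* [image_at j (Tagged _ x)], for x in Z^(k i), is A_(j-1) ... A_i x when
   i <= j, and the dummy value 0 otherwise. *)
Fixpoint image_at (j : nat) u : 'cV[int]_(k j) :=
  match j with
  | 0 => tagged_as (Tagged (fun n => 'cV[int]_(k n)) (0 : 'cV_(k 0))) u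
  | j'.+1 =>
    if (tag u <= j')%N then A j' *m image_at j' u
    else tagged_as (Tagged (fun n => 'cV[int]_(k n)) (0 : 'cV_(k j'.+1))) u
  end.

Definition limit_rel u v : bool :=
  `[< exists j, [/\ (tag u <= j)%N, (tag v <= j)%N &
                    image_at j u = image_at j v] >].

Notation elt i x := (existT (fun n => 'cV[int]_(k n)) i x).

Lemma image_at_id i (x : 'cV_(k i)) : image_at i (elt i x) = x.
Proof. by case: i x => [|i] x /=; rewrite ?ltnn tagged_asE. Qed.

Lemma image_at_step j u :
  (tag u <= j)%N -> image_at j.+1 u = A j *m image_at j u.
Proof. by move=> /= ->. Qed.

Lemma image_at_trans u j l : (tag u <= j <= l)%N ->
  image_at l (elt j (image_at j u)) = image_at l u.
Proof.
move=> /andP[uj]; elim: l => [|l IHl].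
  by rewrite leqn0 => /eqP j0; subst j; rewrite image_at_id.
rewrite leq_eqVlt => /orP[/eqP jl|]; first by subst j; rewrite image_at_id.
rewrite ltnS => jl; rewrite !image_at_step ?IHl //.
exact: leq_trans jl.
Qed.

Lemma image_atD i j (x y : 'cV_(k i)) : (i <= j)%N ->
  image_at j (elt i (x + y)) = image_at j (elt i x) + image_at j (elt i y).
Proof.
elim: j => [|j IHj]; first by case: i x y => // x y _; rewrite !image_at_id.
rewrite leq_eqVlt => /orP[/eqP ij|]; first by subst i; rewrite !image_at_id.
by rewrite ltnS => ij; rewrite !image_at_step // IHj // mulmxDr.
Qed.

Lemma image_at0 i j : (i <= j)%N -> image_at j (elt i 0) = 0.
Proof.
by move=> ij; apply: (addrI (image_at j (elt i 0))); rewrite -image_atD // !addr0.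
Qed.

Lemma image_atN i j (x : 'cV_(k i)) : (i <= j)%N ->
  image_at j (elt i (- x)) = - image_at j (elt i x).
Proof.
by move=> ij; apply/eqP; rewrite -addr_eq0 -image_atD // addNr image_at0.
Qed.

Lemma image_at_later u v j l : (tag u <= j)%N -> (tag v <= j)%N -> (j <= l)%N ->
  image_at j u = image_at j v -> image_at l u = image_at l v.
Proof.
by move=> uj vj jl e; rewrite -(@image_at_trans u j) ?uj // e image_at_trans ?vj.
Qed.

Lemma limit_rel_refl : reflexive limit_rel.
Proof. by move=> u; apply/asboolP; exists (tag u). Qed.

Lemma limit_rel_sym : symmetric limit_rel.
Proof.
by move=> u v; apply/asboolP/asboolP => -[j [? ? ?]]; exists j; split.
Qed.

Lemma limit_rel_trans : transitive limit_rel.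
Proof.
move=> v u w /asboolP[j [uj vj e]] /asboolP[l [vl wl e']]; apply/asboolP.
have [jm lm] := (leq_maxl j l, leq_maxr j l).
exists (maxn j l); split; rewrite ?(leq_trans uj) ?(leq_trans wl) //.
by rewrite (image_at_later uj vj jm e) (image_at_later vl wl lm e').
Qed.

Canonical limit_equiv :=
  EquivRel limit_rel limit_rel_refl limit_rel_sym limit_rel_trans.

Definition limit : Type := {eq_quot limit_equiv}.
HB.instance Definition _ := Choice.on limit.

(* The class [x, i]. *)
Definition class_of u : limit := \pi_{eq_quot limit_equiv} u.
Definition rep (a : limit) : stage_elt := @repr _ {eq_quot limit_equiv} a.

Lemma repK : cancel rep class_of.
Proof. by move=> a; exact: (@reprK _ {eq_quot limit_equiv}). Qed.

Lemma class_eqP u v :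
  class_of u = class_of v <->
  exists j, [/\ (tag u <= j)%N, (tag v <= j)%N & image_at j u = image_at j v].
Proof.
rewrite /class_of; split=> [/eqmodP/asboolP //|h].
by apply/eqmodP/asboolP.
Qed.

Lemma rep_class u : exists j,
  [/\ (tag (rep (class_of u)) <= j)%N, (tag u <= j)%N &
      image_at j (rep (class_of u)) = image_at j u].
Proof. by apply/class_eqP; rewrite repK. Qed.

Definition stage_add u v : stage_elt :=
  let j := maxn (tag u) (tag v) in elt j (image_at j u + image_at j v).
Definition stage_opp u : stage_elt := elt (tag u) (- tagged u).

Definition limit_add (a b : limit) : limit := class_of (stage_add (rep a) (rep b)).
Definition limit_opp (a : limit) : limit := class_of (stage_opp (rep a)).
Definition limit_zero : limit := class_of (elt 0 0).

Lemma image_at_add u v l : (tag u <= l)%N -> (tag v <= l)%N ->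
  image_at l (stage_add u v) = image_at l u + image_at l v.
Proof.
move=> ul vl; have ml : (maxn (tag u) (tag v) <= l)%N by rewrite geq_max ul.
by rewrite image_atD // !image_at_trans // ?leq_maxl ?leq_maxr.
Qed.

Lemma image_at_opp u l : (tag u <= l)%N ->
  image_at l (stage_opp u) = - image_at l u.
Proof. by case: u => i x /= il; rewrite image_atN. Qed.

Lemma limit_addE u v :
  limit_add (class_of u) (class_of v) = class_of (stage_add u v).
Proof.
have [j [uj' uj ej]] := rep_class u; have [l [vl' vl el]] := rep_class v.
have [jm lm] := (leq_maxl j l, leq_maxr j l).
apply/class_eqP; exists (maxn j l).
split; rewrite ?geq_max ?(leq_trans uj') ?(leq_trans uj)
  ?(leq_trans vl') ?(leq_trans vl) //.
rewrite !image_at_add ?(leq_trans uj') ?(leq_trans uj)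
  ?(leq_trans vl') ?(leq_trans vl) //.
by rewrite (image_at_later uj' uj jm ej) (image_at_later vl' vl lm el).
Qed.

Lemma limit_oppE u : limit_opp (class_of u) = class_of (stage_opp u).
Proof.
have [j [uj' uj ej]] := rep_class u.
by apply/class_eqP; exists j; split=> //; rewrite !image_at_opp // ej.
Qed.

Lemma limit_addA : associative limit_add.
Proof.
move=> a b c; rewrite -[a]repK -[b]repK -[c]repK !limit_addE.
move: (rep a) (rep b) (rep c) => u v w; apply/class_eqP.
set l := maxn (tag u) (maxn (tag v) (tag w)).
have ul : (tag u <= l)%N by rewrite leq_maxl.
have vl : (tag v <= l)%N by rewrite leq_max leq_maxl orbT.
have wl : (tag w <= l)%N by rewrite leq_max leq_maxr orbT.
have uvl : (tag (stage_add u v) <= l)%N by rewrite geq_max ul.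
have vwl : (tag (stage_add v w) <= l)%N by rewrite geq_max vl.
exists l; split; rewrite ?geq_max ?ul ?vl ?wl //.
by rewrite !image_at_add // addrA.
Qed.

Lemma limit_addC : commutative limit_add.
Proof.
move=> a b; rewrite -[a]repK -[b]repK !limit_addE.
move: (rep a) (rep b) => u v; apply/class_eqP.
have [ul vl] := (leq_maxl (tag u) (tag v), leq_maxr (tag u) (tag v)).
exists (maxn (tag u) (tag v)); split; rewrite ?geq_max ?ul ?vl //.
by rewrite !image_at_add // addrC.
Qed.

Lemma limit_add0 : left_id limit_zero limit_add.
Proof.
move=> a; rewrite -[a]repK limit_addE; move: (rep a) => u; apply/class_eqP.
exists (tag u); split; rewrite ?geq_max ?leqnn //.
by rewrite image_at_add // image_at0 // add0r.
Qed.

Lemma limit_addN : left_inverse limit_zero limit_opp limit_add.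
Proof.
move=> a; rewrite -[a]repK limit_oppE limit_addE.
move: (rep a) => u; apply/class_eqP.
exists (tag u); split; rewrite ?geq_max ?leqnn //.
by rewrite image_at_add // image_at_opp // addNr image_at0.
Qed.

HB.instance Definition _ :=
  GRing.isZmodule.Build limit limit_addA limit_addC limit_add0 limit_addN.

Definition limit_cone : set limit :=
  [set a | exists2 u : stage_elt, a = class_of u &
     exists2 j, (tag u <= j)%N & forall s, 0 <= image_at j u s 0].

End InductiveLimit.

Arguments limit_cone {k} A _.

Definition nonneg_mx m n (A : 'M[int]_(m, n)) : Prop :=
  forall i j, 0 <= A i j.

Section DimensionGroups.
Variable V : zmodType.
Implicit Types D P : set V.

Definition dimension_group D P : Prop :=
  exists (k : nat -> nat) (A : forall i, 'M[int]_(k i.+1, k i)),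
    (forall i, nonneg_mx (A i)) /\
    order_iso D P [set: limit A] (limit_cone A).

Definition stationary_limit k (A : 'M[int]_k) : zmodType :=
  limit (k := fun=> k) (fun=> A).

Definition stationary_cone k (A : 'M[int]_k) : set (stationary_limit A) :=
  limit_cone (k := fun=> k) (fun=> A).
Arguments stationary_cone {k} A _.

Definition stationary_ordered_group D P : Prop :=
  exists (k : nat) (A : 'M[int]_k),
    nonneg_mx A /\ order_iso D P [set: stationary_limit A] (stationary_cone A).

Definition stationary_group D : Prop :=
  exists (k : nat) (A : 'M[int]_k), group_iso D [set: stationary_limit A].

End DimensionGroups.

(* The Q-vector space R (+) Q^r. *)
Definition realQ (R : realType) (r : nat) : Type := (R * 'rV[rat]_r)%type.

Section RealQ.
Variables (R : realType) (r : nat).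
HB.instance Definition _ := GRing.Zmodule.copy (realQ R r) (R * 'rV[rat]_r)%type.

Definition realQ_scale (q : rat) (v : realQ R r) : realQ R r :=
  (ratr q * v.1, q *: v.2).

Lemma realQ_scaleA a b v : realQ_scale a (realQ_scale b v) = realQ_scale (a * b) v.
Proof. by rewrite /realQ_scale /= mulrA scalerA rmorphM. Qed.
Lemma realQ_scale1 : left_id 1 realQ_scale.
Proof. by case=> x q; rewrite /realQ_scale /= rmorph1 mul1r scale1r. Qed.
Lemma realQ_scaleDr : right_distributive realQ_scale +%R.
Proof. by move=> a [x q] [y p]; rewrite /realQ_scale /= mulrDr scalerDr. Qed.
Lemma realQ_scaleDl v : {morph realQ_scale^~ v : a b / a + b}.
Proof. by move=> a b; rewrite /realQ_scale /= rmorphD /= mulrDl scalerDl. Qed.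

HB.instance Definition _ := GRing.Zmodule_isLmodule.Build rat (realQ R r)
  realQ_scaleA realQ_scale1 realQ_scaleDr realQ_scaleDl.
End RealQ.

Section Rank.
Variable V : lmodType rat.
Implicit Types X D : set V.

Definition Qspan X : set V :=
  [set v | exists (n : nat) (c : 'I_n -> rat) (x : 'I_n -> V),
     (forall i, X (x i)) /\ v = \sum_(i < n) c i *: x i].

Definition Qfree n (b : 'I_n -> V) : Prop :=
  forall c : 'I_n -> rat, \sum_(i < n) c i *: b i = 0 -> forall i, c i = 0.

(* For a subgroup D of a Q-vector space, D (x) Q is the Q-span of D. *)
Definition has_rank D (n : nat) : Prop :=
  exists b : 'I_n -> V, Qfree b /\ Qspan (range b) = Qspan D.

End Rank.

Section Generators.
Variables (R : realType) (r : nat).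
Implicit Types S H K : set (realQ R r).

Definition first_coord_cone S : set (realQ R r) :=
  (S `&` [set v | 0 < v.1]) `|` [set 0].

Record generating_data H K (z : seq (realQ R r)) : Prop := GeneratingData {
  H_subgroup : subgroup H;
  H_real : H `<=` [set v | v.2 = 0];
  H_noncyclic : ~ cyclic_group H;
  H_stationary : stationary_ordered_group H (first_coord_cone H);
  K_subgroup : subgroup K;
  K_rational : K `<=` [set v | v.1 = 0];
  K_rank : has_rank K r;
  K_stationary : stationary_group K;
  z_in_span : [set` z] `<=` Qspan [set h + l | h in H & l in K]
}.

Definition group_of_data H K (z : seq (realQ R r)) : set (realQ R r) :=
  generated (H `|` K `|` [set` z]).

End Generators.

(* Main.v *)
(* A stationary simple group G = lim (Z^k, A) carries the shift automorphism sigma.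
   Simplicity makes the columns of a power of A comparable, so A contracts the oscillation
   of the ratio of two vectors; this yields a state tau : G -> R with
   G^+ = {tau > 0} u {0}, an eigenvalue lam > 1 with tau sigma = lam tau, and the
   Perron-type convergence A^N / lam^N -> u (x) tau.  As lam is not an eigenvalue of sigma
   on K = ker tau, a Bezout identity for characteristic polynomials gives
   p1 + p2 = M in Z[sigma] with p1 = 0 on K and tau p2 = 0; then H = ker p2 and K span a
   subgroup containing M G, and H, K and finitely many elements generate G.

   For the converse, H and K are limits of (Z^a, B) and (Z^b, C).  Powers of the two shifts
   act trivially on (H + K)/M(H + K), hence preserve every group between H + K and
   (H + K)/M; taking a much higher power on H makes its eigenvalue dominate.  Such a group
   is a union of sigma^(-N) L for a lattice L on which sigma^N is lam^N times a rank one map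
   up to lower order, so sigma^N factors through a simplicial group: L -> Z^m -> L, where
   Z^m -> L is given by generators of L surrounding the Perron direction and L -> Z^m is
   positive on them.  The composite Z^m -> L -> Z^m is the required positive matrix. *)
Require Import Defs.
From HB Require Import structures.
From mathcomp Require Import all_boot all_order all_algebra.
From mathcomp Require Import boolp classical_sets reals topology normedtype sequences.
From mathcomp Require Import zify ring lra.
Set Implicit Arguments.
Unset Strict Implicit.
Unset Printing Implicit Defensive.
Import Order.TTheory GRing.Theory Num.Theory numFieldNormedType.Exports.
Local Open Scope classical_set_scope.
Local Open Scope ring_scope.

(** [A] may be singular, and basis vectors of Z^k may vanish in G, so the convergence is stated not
    for matrix entries but for all real functionals on the image L of the first stage, which is a
    lattice in G. In this form it passes to H by composition with a projection and to products
    factor by factor. On ker tau it says that iterates grow more slowly than lam^N, which is why lam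
    cannot be an eigenvalue there.

    For the positive matrix, no basis of a lattice of rank n is asked to make sigma^N non-negative.
    Instead 2n+1 redundant generators are used: they leave enough freedom to round the entries of
    the second factor to integers, keep them close to a positive rank one matrix, and still solve
    the factorisation exactly.

    Real numbers act on G only through comparisons, so inequalities between values of tau are
    reduced to integer multiples by inserting a rational number. *)

Definition mkadd (U V : zmodType) (f : U -> V)
    (fB : forall x y, f (x - y) = f x - f y) : {additive U -> V} :=
  HB.pack f (GRing.isZmodMorphism.Build U V f fB).

(** * Presentations of groups as stationary limits *)

Section Presentations.

(** The inductive limit seen from inside a given group: [phi i] is the canonical map from stage i,
    and [pres_ker] says that a vector vanishes in the limit only if it does so at a finite stage.
    Subgroups of any ambient group can then be recognised as limits without the quotient type. *)
Record presentation (V : zmodType) (D : set V) k (A : 'M[int]_k)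
    (phi : nat -> {additive 'cV[int]_k -> V}) : Prop := Presentation {
  pres_shift : forall i x, phi i.+1 (A *m x) = phi i x;
  pres_ker : forall i x, phi i x = 0 -> exists j, A ^+ j *m x = 0;
  pres_im : forall v, D v <-> exists i x, v = phi i x
}.

Definition pres_cone (V : zmodType) k (phi : nat -> 'cV[int]_k -> V) : set V :=
  [set v | exists i (x : 'cV[int]_k), (forall s, 0 <= x s 0) /\ v = phi i x].

Lemma exprS_mulmx k (A : 'M[int]_k) j m (x : 'M_(k, m)) :
  A ^+ j.+1 *m x = A *m (A ^+ j *m x).
Proof. by rewrite exprS -mulmxE mulmxA. Qed.

Lemma exprD_mulmx k (A : 'M[int]_k) i j m (x : 'M_(k, m)) :
  A ^+ (i + j) *m x = A ^+ i *m (A ^+ j *m x).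
Proof. by rewrite exprD -mulmxE mulmxA. Qed.

Lemma expr0_mulmx k (A : 'M[int]_k) m (x : 'M_(k, m)) : A ^+ 0 *m x = x.
Proof. by rewrite expr0 mul1mx. Qed.

Lemma nonneg_mul m n (A : 'M[int]_(m, n)) (x : 'cV_n) : nonneg_mx A ->
  (forall s, 0 <= x s 0) -> forall s, 0 <= (A *m x) s 0.
Proof. by move=> hA hx s; rewrite mxE sumr_ge0 // => l _; rewrite mulr_ge0. Qed.

Lemma nonneg_expr k (A : 'M[int]_k) j : nonneg_mx A -> nonneg_mx (A ^+ j).
Proof.
move=> hA; elim: j => [|j IH] s l; first by rewrite expr0 mxE; case: eqP.
by rewrite exprS -mulmxE mxE sumr_ge0 // => q _; rewrite mulr_ge0.
Qed.

Section One.
Variables (V : zmodType) (D : set V) (k : nat) (A : 'M[int]_k).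
Variable phi : nat -> {additive 'cV[int]_k -> V}.
Hypothesis pr : presentation D A phi.

Lemma pres_iter i j x : phi (j + i)%N (A ^+ j *m x) = phi i x.
Proof.
by elim: j => [|j IH]; rewrite ?expr0_mulmx // exprS_mulmx addSn (pres_shift pr).
Qed.

Lemma pres_iter_sub i j x : (i <= j)%N -> phi j (A ^+ (j - i) *m x) = phi i x.
Proof. by move=> ij; rewrite -{1}(subnK ij) pres_iter. Qed.

Lemma pres_mem i x : D (phi i x).
Proof. by apply/(pres_im pr); exists i, x. Qed.

Lemma pres_eq i x y : phi i x = phi i y -> exists j, A ^+ j *m x = A ^+ j *m y.
Proof.
move/eqP; rewrite -subr_eq0 -raddfB => /eqP/(pres_ker pr)[j hj].
by exists j; apply/eqP; rewrite -subr_eq0 -mulmxBr hj.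
Qed.

Lemma pres_common2 v w : D v -> D w ->
  exists i x y, v = phi i x /\ w = phi i y.
Proof.
move=> /(pres_im pr)[i [x ->]] /(pres_im pr)[j [y ->]].
exists (maxn i j), (A ^+ (maxn i j - i) *m x), (A ^+ (maxn i j - j) *m y).
by rewrite !pres_iter_sub ?leq_maxl ?leq_maxr.
Qed.

Lemma pres_subgroup : subgroup D.
Proof.
split; first by apply/(pres_im pr); exists 0%N, 0; rewrite raddf0.
move=> v w Dv Dw; have [i [x [y [-> ->]]]] := pres_common2 Dv Dw.
by rewrite -raddfB; apply: pres_mem.
Qed.

Lemma pres_cone_later i x j v : nonneg_mx A -> v = phi i x ->
  (forall s, 0 <= x s 0) -> (i <= j)%N ->
  exists2 y, v = phi j y & forall s, 0 <= y s 0.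
Proof.
move=> hA -> hx ij; exists (A ^+ (j - i) *m x); first by rewrite pres_iter_sub.
by apply: nonneg_mul => //; apply: nonneg_expr.
Qed.

(** Two representatives of one element agree after finitely many steps, and a non-negative matrix
    preserves positivity afterwards. Membership in the cone thus becomes an eventual coordinatewise
    statement. *)
Lemma pres_cone_stage i x : nonneg_mx A -> pres_cone phi (phi i x) ->
  exists j, forall l, (j <= l)%N -> forall s, 0 <= (A ^+ l *m x) s 0.
Proof.
move=> hA [m [y [hy e]]].
have [l hl] : exists l, A ^+ l *m (A ^+ m *m x) = A ^+ l *m (A ^+ i *m y).
  by apply: (@pres_eq (m + i)); rewrite pres_iter e addnC pres_iter.
exists (l + m)%N => j hj; rewrite -(subnK hj) exprD_mulmx exprD_mulmx hl.
by do 3![apply: nonneg_mul => //; try exact: nonneg_expr].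
Qed.

End One.

(** On both sides the vectors with image 0 are those killed by a power of [A], so the image of an
    element does not depend on the representative chosen for it. *)
Lemma pres_map (V W : zmodType) (D : set V) (E : set W) k (A : 'M[int]_k) phi psi :
  presentation D A phi -> presentation E A psi ->
  exists2 f : V -> W, is_group_iso D E f & forall i x, f (phi i x) = psi i x.
Proof.
move=> prD prE.
have [f hf] : {f : V -> W & forall v, D v -> exists i x, v = phi i x /\ f v = psi i x}.
  apply: (@choice _ _ (fun v w => D v -> exists i x, v = phi i x /\ w = psi i x)) => v.
  have [/(pres_im prD)[i [x vE]]|nDv] := pselect (D v); last by exists 0.
  by exists (psi i x) => _; exists i, x.
have fE i x : f (phi i x) = psi i x.
  have [j [y [e ->]]] := hf _ (pres_mem prD i x).
  have [l hl] : exists l, A ^+ l *m (A ^+ j *m x) = A ^+ l *m (A ^+ i *m y).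
    by apply: (pres_eq prD (i := (j + i)%N)); rewrite (pres_iter prD) e addnC (pres_iter prD).
  rewrite -(pres_iter prE j i) -(pres_iter prE i j) [(i + j)%N]addnC.
  by rewrite -[LHS](pres_iter prE _ l) -[RHS](pres_iter prE _ l) hl.
exists f => //; split.
- move=> v w /set_mem Dv /set_mem Dw.
  have [i [x [y [-> ->]]]] := pres_common2 prD Dv Dw.
  by rewrite -raddfD !fE raddfD.
- move=> v w /set_mem Dv /set_mem Dw.
  have [i [x [y [-> ->]]]] := pres_common2 prD Dv Dw.
  rewrite !fE => /(pres_eq prE)[j hj].
  by rewrite -(pres_iter prD i j) hj (pres_iter prD).
- apply/seteqP; split=> [w [v /(pres_im prD)[i [x ->]] <-]|w /(pres_im prE)[i [x ->]]].
    by rewrite fE; apply: pres_mem prE _ _.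
  by exists (phi i x) => //; apply: pres_mem prD _ _.
Qed.

Lemma pres_cone_map (V W : zmodType) (D : set V) (E : set W) k (A : 'M[int]_k) phi psi :
  presentation D A phi -> presentation E A psi ->
  order_iso D (pres_cone phi) E (pres_cone psi).
Proof.
move=> prD prE; have [f fiso fE] := pres_map prD prE; exists f => //.
apply/seteqP; split=> [w [v [i [x [hx ->]] <-]]|w [i [x [hx ->]]]].
  by exists i, x; rewrite fE.
by exists (phi i x); rewrite ?fE //; exists i, x.
Qed.

Lemma group_iso_pres (V W : zmodType) (D : set V) (E : set W) k (A : 'M[int]_k) psi
    (f : V -> W) : subgroup D ->
  is_group_iso D E f -> presentation E A psi ->
  exists2 phi, presentation D A phi & forall i x, f (phi i x) = psi i x.
Proof.
move=> [D0 DB] [fD finj fim] prE.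
have [g hg] : {g : W -> V & forall w, E w -> D (g w) /\ f (g w) = w}.
  apply: (@choice _ _ (fun w v => E w -> D v /\ f v = w)) => w.
  have [|nEw] := pselect (E w); last by exists 0.
  by rewrite -fim => -[v Dv <-]; exists v.
have mD v : D v -> v \in D by move=> ?; apply: mem_set.
have fB v w : D v -> D w -> f (v - w) = f v - f w.
  move=> Dv Dw; apply/eqP; rewrite eq_sym subr_eq -fD ?subrK //; apply: mD => //.
  exact: DB.
have gB i x y : g (psi i (x - y)) = g (psi i x) - g (psi i y).
  have [[Dx Dy] Dxy] := (hg _ (pres_mem prE i x), hg _ (pres_mem prE i y),
    hg _ (pres_mem prE i (x - y))).
  apply: finj; [by apply: mD; case: Dxy| |].
    by apply: mD; apply: DB; [case: Dx | case: Dy].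
  rewrite (fB _ _ (proj1 Dx) (proj1 Dy)).
  by case: Dx Dy Dxy => [_ ->] [_ ->] [_ ->]; rewrite raddfB.
exists (fun i => mkadd (gB i)) => [|i x] /=; last first.
  by case: (hg _ (pres_mem prE i x)).
have gK v : D v -> g (f v) = v.
  move=> Dv; have [|Dg gE] := hg (f v); first by rewrite -fim; exists v.
  by apply: finj => //; apply: mD.
split=> [i x|i x /= e|v] /=; first by rewrite (pres_shift prE).
  apply: (pres_ker prE (i := i)); have [_ <-] := hg _ (pres_mem prE i x).
  have := fB 0 0 D0 D0; rewrite !subrr => <-; rewrite e.
  by have := fB 0 0 D0 D0; rewrite !subrr => ->.
split=> [Dv|[i [x ->]]]; last by case: (hg _ (pres_mem prE i x)).
have /(pres_im prE)[i [x e]] : E (f v) by rewrite -fim; exists v.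
by exists i, x; rewrite -e gK.
Qed.

Section Limit.
Variables (k : nat) (A : 'M[int]_k).
Let kk := fun _ : nat => k.
Let AA := fun _ : nat => A.
Let elt i (x : 'cV[int]_k) : stage_elt kk := existT (fun n => 'cV[int]_(kk n)) i x.

Lemma image_at_expr i j (x : 'cV_k) :
  @image_at kk AA (j + i)%N (elt i x) = A ^+ j *m x.
Proof.
elim: j => [|j IH]; first by rewrite image_at_id expr0_mulmx.
by rewrite addSn image_at_step ?leq_addl // IH exprS_mulmx.
Qed.

Lemma class_elt_sub i (x y : 'cV_k) :
  class_of AA (elt i (x - y)) = class_of AA (elt i x) - class_of AA (elt i y).
Proof.
rewrite /GRing.add /= /GRing.opp /= limit_oppE limit_addE.
apply/class_eqP; exists i; split => //=; first by rewrite maxnn.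
by rewrite image_at_add //= image_at_opp // !image_at_id.
Qed.

Definition limit_phi i : {additive 'cV[int]_k -> stationary_limit A} :=
  mkadd (class_elt_sub i).

Lemma limit_pres : presentation [set: stationary_limit A] A limit_phi.
Proof.
split=> [i x|i x|v].
- apply/class_eqP; exists i.+1; split=> //=.
  have /esym := image_at_expr i 1 x; rewrite expr1 => e.
  by apply: eq_trans e; exact: (image_at_id AA (i := i.+1) (A *m x)).
- have -> : (0 : stationary_limit A) = limit_phi i 0 by rewrite raddf0.
  move=> /class_eqP [j [/= ij _]]; rewrite -(subnK ij).
  by rewrite !image_at_expr mulmx0; exists (j - i)%N.
- split=> // _; exists (tag (rep v)), (tagged (rep v)).
  by rewrite /= -[LHS]repK; congr class_of; case: (rep v).
Qed.

Lemma limit_coneE : @stationary_cone k A = pres_cone limit_phi.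
Proof.
apply/seteqP; split=> [a [u ->] [j uj hj]|a [i [x [hx ->]]]].
  exists j, (image_at AA j u); split=> //; apply/class_eqP; exists j; split=> //.
  exact/esym/(image_at_id AA).
exists (elt i x) => //; exists i => // s.
by rewrite (image_at_id AA).
Qed.
End Limit.

Lemma is_group_iso_comp (U V W : zmodType) (D : set U) (E : set V) (F : set W) f g :
  is_group_iso D E f -> is_group_iso E F g -> is_group_iso D F (g \o f).
Proof.
move=> [fD finj fE] [gD ginj gE].
have mE v : v \in D -> f v \in E.
  by move=> /set_mem Dv; apply: mem_set; rewrite -fE; exists v.
split.
- by move=> x y Dx Dy /=; rewrite fD // gD // mE.
- by move=> x y Dx Dy /= /ginj/finj; apply=> //; rewrite ?mE.
- by rewrite -image_comp fE gE.
Qed.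

Lemma order_iso_comp (U V W : zmodType) (D P : set U) (E Q : set V) (F S : set W) :
  order_iso D P E Q -> order_iso E Q F S -> order_iso D P F S.
Proof.
move=> [f fi fP] [g gi gQ]; exists (g \o f); first exact: is_group_iso_comp fi gi.
by rewrite -image_comp fP gQ.
Qed.

(** Trades an abstract isomorphism with the limit for maps from the stages into the group itself. *)
Lemma stationary_groupP (V : zmodType) (D : set V) : subgroup D ->
  stationary_group D <->
  exists k (A : 'M[int]_k) phi, presentation D A phi.
Proof.
move=> sD; split=> [[k [A [f fi]]]|[k [A [phi pr]]]].
  have [phi pr _] := group_iso_pres sD fi (limit_pres A).
  by exists k, A, phi.
exists k, A; have [f fi _] := pres_map pr (limit_pres A).
by exists f.
Qed.

Lemma stationary_orderedP (V : zmodType) (D P : set V) : subgroup D -> P `<=` D ->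
  stationary_ordered_group D P <->
  exists k (A : 'M[int]_k) phi,
    [/\ nonneg_mx A, presentation D A phi & P = pres_cone phi].
Proof.
move=> sD PD; split=> [[k [A [hA [f fi fP]]]]|[k [A [phi [hA pr ->]]]]].
  have [phi pr fphi] := group_iso_pres sD fi (limit_pres A).
  exists k, A, phi; split=> //; move: fP; rewrite limit_coneE => fP.
  have [_ finj _] := fi.
  apply/seteqP; split=> [v Pv|v [i [x [hx ->]]]].
    have : pres_cone (limit_phi A) (f v) by rewrite -fP; exists v.
    move=> [i [x [hx e]]]; exists i, x; split=> //.
    apply: finj; rewrite ?fphi //; apply: mem_set; first exact: PD.
    exact: pres_mem pr _ _.
  have : pres_cone (limit_phi A) (limit_phi A i x) by exists i, x.
  rewrite -fP => -[w Pw]; rewrite -fphi => /finj <- //; apply: mem_set; first exact: PD.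
  exact: pres_mem pr _ _.
exists k, A; split=> //; rewrite limit_coneE.
exact: pres_cone_map pr (limit_pres A).
Qed.

End Presentations.

Section Sym.

Lemma order_iso_sym (U V : zmodType) (D P : set U) (E Q : set V) :
  subgroup D -> P `<=` D -> order_iso D P E Q -> order_iso E Q D P.
Proof.
move=> [D0 DB] PD [f [fD finj fE] fP].
have [g hg] : {g : V -> U & forall w, E w -> D (g w) /\ f (g w) = w}.
  apply: (@choice _ _ (fun w v => E w -> D v /\ f v = w)) => w.
  have [|nEw] := pselect (E w); last by exists 0.
  by rewrite -fE => -[v Dv <-]; exists v.
have gf v : D v -> g (f v) = v.
  move=> Dv; have [|Dg gE] := hg (f v); first by rewrite -fE; exists v.
  by apply: finj => //; apply: mem_set.
have DD v w : D v -> D w -> D (v + w).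
  by move=> Dv Dw; rewrite -[w]opprK -[- w]sub0r; apply: (DB) => //; apply: DB.
exists g; first split.
- move=> x y /set_mem Ex /set_mem Ey.
  have [Dx ex] := hg x Ex; have [Dy ey] := hg y Ey.
  by rewrite -{1}ex -{1}ey -fD ?mem_set // gf //; apply: DD.
- move=> x y /set_mem Ex /set_mem Ey e.
  by have [[_ <-] [_ <-]] := (hg x Ex, hg y Ey); rewrite e.
- apply/seteqP; split=> [v [w Ew <-]|v Dv]; first by case: (hg w Ew).
  by exists (f v); rewrite ?gf // -fE; exists v.
- apply/seteqP; split=> [v [w Qw <-]|v Pv].
    by move: Qw; rewrite -fP => -[u Pu <-]; rewrite gf //; apply: PD.
  exists (f v); last by rewrite gf //; apply: PD.
  by rewrite -fP; exists v.
Qed.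

End Sym.

Section Iterates.
Variables (V : zmodType).
Implicit Types alpha beta : {additive V -> V}.

Lemma iterB alpha i x y : iter i alpha (x - y) = iter i alpha x - iter i alpha y.
Proof. by elim: i => //= i ->; rewrite raddfB. Qed.

Definition iter_additive alpha i := mkadd (iterB alpha i).

Lemma iter0 alpha i : iter i alpha 0 = 0.
Proof. exact: (raddf0 (iter_additive alpha i)). Qed.

Lemma iter_cancel alpha beta i : cancel alpha beta -> cancel (iter i alpha) (iter i beta).
Proof. by move=> ab; elim: i => // i IH x; rewrite iterSr /= ab IH. Qed.

End Iterates.

(** * Lattices *)

Section Lattices.

Definition torsion_free (V : zmodType) :=
  forall (x : V) (m : int), x *~ m = 0 -> m != 0 -> x = 0.

Lemma clear_denoms n (q : 'I_n -> rat) :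
  exists2 d : int, d != 0 & exists w : 'I_n -> int, forall i, q i * d%:~R = (w i)%:~R.
Proof.
exists (\prod_i denq (q i)); first by apply/prodf_neq0 => i _; rewrite denq_neq0.
exists (fun i => numq (q i) * \prod_(j | j != i) denq (q j)) => i.
rewrite (bigD1 i) //= !rmorphM /= mulrA; congr (_ * _).
by rewrite -{1}[q i]divq_num_den mulfVK // intr_eq0 denq_neq0.
Qed.

(** A rational vector in the kernel becomes an integral one once its denominators are cleared. *)
Lemma int_row_free m n (C : 'M[int]_(n, m)) : (forall x : 'cV_m, C *m x = 0 -> x = 0) ->
  row_free (map_mx intr C^T : 'M[rat]_(m, n)).
Proof.
move=> hC; apply: inj_row_free => v vC.
have [d d0 [w hw]] := clear_denoms (fun i => v 0 i).
have : (\col_i w i : 'cV_m) = 0.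
  apply: hC; apply: trmx_inj; rewrite trmx_mul trmx0.
  have inj : injective (map_mx (intr : int -> rat) : 'M_(1, n) -> 'M_(1, n)).
    move=> X Y /matrixP e; apply/matrixP => i j.
    by have := e i j; rewrite !mxE => /intr_inj.
  apply: inj; rewrite map_mxM map_mx0 /=.
  have -> : map_mx intr (\col_i w i)^T = d%:~R *: v :> 'rV[rat]_m.
    by apply/rowP => i; rewrite !mxE -hw mulrC.
  by rewrite -scalemxAl vC scaler0.
move=> w0; apply/rowP => i; rewrite mxE.
have /eqP : v 0 i * d%:~R = 0 by rewrite hw; move/colP/(_ i): w0; rewrite !mxE => ->.
by rewrite mulf_eq0 intr_eq0 (negPf d0) orbF => /eqP.
Qed.

Variable V : zmodType.
Implicit Types (L D : set V).

Definition comb n (b : 'I_n -> V) (x : 'cV[int]_n) : V := \sum_i b i *~ x i 0.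

Lemma combB n (b : 'I_n -> V) x y : comb b (x - y) = comb b x - comb b y.
Proof.
by rewrite /comb -sumrB; apply: eq_bigr => i _; rewrite !mxE mulrzBr.
Qed.

HB.instance Definition _ n b := GRing.isZmodMorphism.Build _ _ (@comb n b) (combB b).

Lemma additive_comb (W : zmodType) (f : {additive V -> W}) n (b : 'I_n -> V) x :
  f (comb b x) = \sum_i f (b i) *~ x i 0.
Proof. by rewrite raddf_sum; apply: eq_bigr => i _; rewrite raddfMz. Qed.

Lemma comb_delta n (b : 'I_n -> V) j : comb b (delta_mx j 0) = b j.
Proof.
rewrite /comb (bigD1 j) //= big1 ?addr0 => [|i ij]; first by rewrite mxE !eqxx.
by rewrite mxE (negPf ij).
Qed.

Lemma comb_mul n m (b : 'I_n -> V) (M : 'M[int]_(n, m)) x :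
  comb b (M *m x) = comb (fun j => comb b (col j M)) x.
Proof.
rewrite /comb; under [RHS]eq_bigr do rewrite mulrz_suml.
rewrite exchange_big; apply: eq_bigr => i _ /=.
by rewrite mxE mulrz_sumr; apply: eq_bigr => j _; rewrite mxE mulrzA.
Qed.

Definition basis L n (b : 'I_n -> V) : Prop :=
  (forall v, L v <-> exists x, v = comb b x) /\ (forall x, comb b x = 0 -> x = 0).

(** Lattices are subsets of an ambient group and not types, so additivity of a functional is
    relative to the subset. *)
Definition additive_on (W : zmodType) L (f : V -> W) :=
  forall v w, L v -> L w -> f (v - w) = f v - f w.

Lemma subgroupD L v w : subgroup L -> L v -> L w -> L (v + w).
Proof.
by move=> [L0 LB] Lv Lw; rewrite -[w]opprK -[- w]sub0r; apply: (LB) => //; apply: LB.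
Qed.

Lemma subgroupMz L v m : subgroup L -> L v -> L (v *~ m).
Proof.
move=> sL Lv; have [L0 LB] := sL.
have h (j : nat) : L (v *+ j).
  by elim: j => [|j IH]; rewrite ?mulr0n // mulrS; apply: subgroupD.
case: m => j; first by rewrite -pmulrn.
by rewrite NegzE mulrNz -pmulrn -[- _]sub0r; apply: LB.
Qed.

Lemma subgroup_sum L I (r : seq I) (P : pred I) (F : I -> V) : subgroup L ->
  (forall i, L (F i)) -> L (\sum_(i <- r | P i) F i).
Proof.
move=> sL LF; apply: big_ind => //; first by case: sL.
by move=> *; apply: subgroupD.
Qed.

Lemma additive_cV n (f : {additive 'cV[int]_n -> V}) x :
  f x = \sum_l f (delta_mx l 0) *~ x l 0.
Proof.
have {1}-> : x = \sum_l delta_mx l 0 *~ x l 0.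
  apply/colP => s; rewrite summxE (bigD1 s) //= big1 ?addr0 => [|l ls].
    by rewrite -scaler_int !mxE !eqxx mulr1 intz.
  by rewrite -scaler_int !mxE [s == l]eq_sym (negPf ls) mulr0.
by rewrite raddf_sum; apply: eq_bigr => l _; rewrite raddfMz.
Qed.

Lemma range_subgroup (U : zmodType) (f : {additive U -> V}) : subgroup (range f).
Proof.
split; first by exists 0 => //; rewrite raddf0.
by move=> _ _ [x _ <-] [y _ <-]; exists (x - y) => //; rewrite raddfB.
Qed.

Section On.
Variables (W : zmodType) (L : set V) (f : V -> W).
Hypotheses (sL : subgroup L) (fB : additive_on L f).

Lemma additive_on0 : f 0 = 0.
Proof. by have [L0 _] := sL; have := fB L0 L0; rewrite !subrr. Qed.

Lemma additive_onN v : L v -> f (- v) = - f v.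
Proof. by have [L0 _] := sL; move=> Lv; rewrite -sub0r fB // additive_on0 sub0r. Qed.

Lemma additive_onD v w : L v -> L w -> f (v + w) = f v + f w.
Proof.
move=> Lv Lw; have LNw : L (- w) by have [L0 LB] := sL; rewrite -sub0r; apply: LB.
by rewrite -{1}[w]opprK fB // additive_onN // opprK.
Qed.

Lemma additive_onMz v m : L v -> f (v *~ m) = f v *~ m.
Proof.
move=> Lv.
have h (j : nat) : f (v *+ j) = f v *+ j.
  elim: j => [|j IH]; first by rewrite !mulr0n additive_on0.
  by rewrite !mulrS additive_onD ?IH // pmulrn; apply: subgroupMz.
case: m => j; first by rewrite -!pmulrn.
by rewrite NegzE !mulrNz -!pmulrn additive_onN ?h // pmulrn; apply: subgroupMz.
Qed.

Lemma additive_on_sum I (r : seq I) (P : pred I) (F : I -> V) :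
  (forall i, L (F i)) -> f (\sum_(i <- r | P i) F i) = \sum_(i <- r | P i) f (F i).
Proof.
move=> LF; elim: r => [|i r IH]; first by rewrite !big_nil additive_on0.
rewrite !big_cons; case: (P i) => //.
by rewrite additive_onD ?IH //; apply: subgroup_sum.
Qed.

Lemma additive_on_comb n (b : 'I_n -> V) x : (forall i, L (b i)) ->
  f (comb b x) = \sum_i f (b i) *~ x i 0.
Proof.
move=> Lb; rewrite additive_on_sum => [|i]; last exact: subgroupMz.
by apply: eq_bigr => i _; rewrite additive_onMz.
Qed.
End On.

End Lattices.

Section Bases.
Variable V : zmodType.
Implicit Types (L D : set V).

Lemma basis_comb L n (b : 'I_n -> V) x : basis L b -> L (comb b x).
Proof. by move=> [hL _]; apply/hL; exists x. Qed.

Lemma basis_mem L n (b : 'I_n -> V) i : basis L b -> L (b i).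
Proof. by move=> hb; rewrite -(comb_delta b); apply: basis_comb. Qed.

Lemma basis_subgroup L n (b : 'I_n -> V) : basis L b -> subgroup L.
Proof.
move=> [hL _]; split; first by apply/hL; exists 0; rewrite raddf0.
by move=> v w /hL[x ->] /hL[y ->]; apply/hL; exists (x - y); rewrite raddfB.
Qed.

Lemma basis_inj L n (b : 'I_n -> V) : basis L b -> injective (comb b).
Proof.
move=> [_ h0] x y e; apply/eqP; rewrite -subr_eq0; apply/eqP/h0.
by rewrite raddfB /= e subrr.
Qed.

Lemma basis_coord L n (b : 'I_n -> V) : basis L b ->
  exists c : V -> 'cV[int]_n, [/\ additive_on L c, cancel (comb b) c &
    forall v, L v -> comb b (c v) = v].
Proof.
move=> hb; have [hL _] := hb.
have [c hc] : {c : V -> 'cV[int]_n & forall v, L v -> comb b (c v) = v}.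
  apply: (@choice _ _ (fun v x => L v -> comb b x = v)) => v.
  have [/hL[x ->]|nLv] := pselect (L v); first by exists x.
  by exists 0.
exists c; split=> // [v w Lv Lw|x]; apply: (basis_inj hb).
  have [_ LB] := basis_subgroup hb.
  by rewrite raddfB /= !hc //; apply: LB.
by rewrite hc //; apply: basis_comb.
Qed.

(* If some first coordinate is non-zero, an element where it is minimal and positive splits off. *)
Lemma sublattice_basis n L (f : V -> 'cV[int]_n) : subgroup L -> additive_on L f ->
  (forall v, L v -> f v = 0 -> v = 0) ->
  exists m (b : 'I_m -> V), (m <= n)%N /\ basis L b.
Proof.
elim: n L f => [|n IH] L f sL fB finj.
  exists 0%N, (fun _ => 0); split=> //; split=> [v|x _]; last by apply/colP => -[].
  split=> [Lv|[x ->]]; last by rewrite /comb big_ord0; case: sL.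
  exists 0; rewrite raddf0; apply: finj => //.
  by apply/colP => -[].
pose c v := f v 0 0.
have cB : additive_on L c by move=> v w Lv Lw; rewrite /c fB // !mxE.
pose L0 := [set v | L v /\ c v = 0]; pose f0 v : 'cV_n := \col_i f v (lift 0 i) 0.
have sL0 : subgroup L0.
  split; first by split; [case: sL | apply: additive_on0 sL cB].
  by move=> v w [Lv v0] [Lw w0]; split; [case: sL => _; apply | rewrite cB // v0 w0 subrr].
have [||m [b [mn hb]]] := IH L0 f0 sL0.
- by move=> v w [Lv _] [Lw _]; apply/colP => i; rewrite !mxE fB // !mxE.
- move=> v [Lv v0] e; apply: finj => //; apply/colP => i; rewrite mxE.
  have [i'|->//] := unliftP 0 i; first by move=> ->; move/colP/(_ i'): e; rewrite !mxE.
have [c0|] := pselect (forall v, L v -> c v = 0).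
  exists m, b; split; first exact: leqW.
  have -> // : L = L0.
  by apply/seteqP; split=> v; [move=> Lv; split=> //; apply: c0 | case].
move=> /existsNP[y0 /not_implyP[Ly0 /eqP cy0]].
pose P := [pred k : nat | (k > 0)%N && `[< exists2 v, L v & c v = k%:Z >]].
have exP : exists k, P k.
  exists `|c y0|%N; rewrite /= absz_gt0 cy0; apply/asboolP.
  have [ge0|lt0] := leP 0 (c y0); first by exists y0 => //; rewrite gez0_abs.
  exists (- y0); last by rewrite (additive_onN sL cB) // ltz0_abs.
  by have [L00 LB] := sL; rewrite -sub0r; apply: LB.
have [k /andP[k0 /asboolP[y Ly cy]] kmin] := ex_minnP exP.
(* The remainder modulo k is again a value of [c] on [L]; being smaller than the least positive
   value, it is 0. *)
have dv v : L v -> c (v - y *~ (c v %/ k)%Z) = 0.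
  move=> Lv; have Lr : L (v - y *~ (c v %/ k)%Z).
    by have [_ LB] := sL; apply: LB => //; apply: subgroupMz.
  have e : c (v - y *~ (c v %/ k)%Z) = (c v %% k)%Z.
    rewrite cB //; last exact: subgroupMz.
    by rewrite (additive_onMz sL cB) // cy /modz mulrzz mulrC.
  have k0' : k%:Z != 0 by rewrite eqz_nat -lt0n.
  have := modz_ge0 (c v) k0'; rewrite le_eqVlt => /orP[/eqP h|lt0]; first by rewrite e -h.
  have := ltz_pmod (c v) (d := k%:Z); rewrite ltz_nat k0 => /(_ isT) ltk.
  have : P `|(c v %% k)%Z|%N.
    rewrite /= absz_gt0 gt_eqF //; apply/asboolP; exists (v - y *~ (c v %/ k)%Z) => //.
    by rewrite e gtz0_abs.
  move/kmin; lia.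
pose b' (i : 'I_m.+1) := if unlift 0 i is Some j then b j else y.
have combE x : comb b' x = y *~ x 0 0 + comb b (\col_j x (lift 0 j) 0).
  rewrite /comb big_ord_recl /b' unlift_none; congr (_ + _).
  by apply: eq_bigr => i _; rewrite liftK mxE.
have bL0 x : L0 (comb b x) by apply: basis_comb hb.
exists m.+1, b'; split=> //; split=> [v|x].
  split=> [Lv|[x ->]]; last first.
    rewrite combE; apply: (subgroupD sL); first exact: subgroupMz.
    by case: (bL0 (\col_j x (lift 0 j) 0)).
  have /hb.1[x e] : L0 (v - y *~ (c v %/ k)%Z).
    by split; [have [_ LB] := sL; apply: LB => //; apply: subgroupMz | apply: dv].
  exists (\col_i if unlift 0 i is Some j then x j 0 else (c v %/ k)%Z).
  rewrite combE mxE unlift_none.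
  have -> : (\col_j (\col_i if unlift 0 i is Some j then x j 0 else (c v %/ k)%Z) (lift 0 j) 0) = x.
    by apply/colP => j; rewrite !mxE liftK.
  by rewrite -e addrC subrK.
rewrite combE => e.
have x0 : x 0 0 = 0.
  have /(congr1 c) := e; rewrite (additive_onD sL cB); first last.
  - by case: (bL0 (\col_j x (lift 0 j) 0)).
  - exact: subgroupMz.
  have [_ ->] := bL0 (\col_j x (lift 0 j) 0).
  rewrite addr0 (additive_onMz sL cB) // (additive_on0 sL cB) cy => /eqP.
  by rewrite mulrzz mulf_eq0 eqz_nat (gtn_eqF k0) /= => /eqP.
move: e; rewrite x0 mulr0z add0r => /hb.2 /colP e.
apply/colP => i; rewrite mxE; have [j ->|->//] := unliftP 0 i.
by have := e j; rewrite !mxE.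
Qed.

Lemma sublattice_basis_of L L' n (b : 'I_n -> V) : basis L b -> subgroup L' -> L' `<=` L ->
  exists m (b' : 'I_m -> V), (m <= n)%N /\ basis L' b'.
Proof.
move=> hb sL' sub; have [c [cB _ cK]] := basis_coord hb.
apply: (@sublattice_basis n L' c) => //; first by move=> v w /sub Lv /sub Lw; apply: cB.
by move=> v /sub Lv e; rewrite -(cK v Lv) e raddf0.
Qed.

(** The coordinate matrix of [b'] has a rational left inverse, whose rows are the functionals.
    Integral values cannot be expected, since [b'] may span a subgroup that is not a direct
    summand. *)
Lemma basis_dual L n (b : 'I_n -> V) m (b' : 'I_m -> V) : basis L b ->
  (forall i, L (b' i)) -> (forall x, comb b' x = 0 -> x = 0) ->
  exists l : 'I_m -> V -> rat,
    [/\ (m <= n)%N, forall s, additive_on L (l s) & forall s i, l s (b' i) = (s == i)%:R].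
Proof.
move=> hb Lb' h0; have [c [cB cK Kc]] := basis_coord hb.
pose C : 'M[int]_(n, m) := \matrix_(i, j) c (b' j) i 0.
have b'E x : comb b' x = comb b (C *m x).
  rewrite comb_mul; apply: eq_bigr => j _; congr (_ *~ _); rewrite -[LHS]Kc //.
  by congr comb; apply/colP => i; rewrite !mxE.
have /int_row_free fr : forall x : 'cV_m, C *m x = 0 -> x = 0.
  by move=> x e; apply: h0; rewrite b'E e raddf0.
have mn : (m <= n)%N by have := fr; rewrite -row_leq_rank => /leq_trans; apply; exact: rank_leq_col.
have /row_freeP[E CE] := fr.
exists (fun s v => \sum_i (c v i 0)%:~R * E i s); split=> // [s v w Lv Lw|s i].
  rewrite -sumrB; apply: eq_bigr => i _.
  by rewrite cB // !mxE rmorphB mulrBl.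
have /matrixP/(_ i s) := CE; rewrite !mxE eq_sym => <-.
by apply: eq_bigr => j _; rewrite !mxE.
Qed.

End Bases.

(** * Factoring a power through a simplicial group *)

Section RealLimits.
Variable R : realType.
Implicit Types (f g : nat -> R) (a b c lam : R).

Lemma cvg_sum_seq (I : Type) (r : seq I) (P : pred I) (f : I -> nat -> R) (a : I -> R) :
  (forall i, P i -> f i N @[N --> \oo] --> a i) ->
  \sum_(i <- r | P i) f i N @[N --> \oo] --> \sum_(i <- r | P i) a i.
Proof. by move=> h; apply: cvg_big => //; exact: add_continuous. Qed.

Lemma cvg_inv_exp lam : 1 < lam -> (lam ^+ N)^-1 @[N --> \oo] --> (0 : R).
Proof.
move=> l1; have l0 : 0 < lam by apply: lt_trans l1.
have : `|lam^-1| < 1 by rewrite ger0_norm ?invr_ge0 ?ltW // invf_lt1.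
move=> /cvg_expr; rewrite (_ : GRing.exp lam^-1 = fun N => (lam ^+ N)^-1) //.
by apply/funext => N /=; rewrite exprVn.
Qed.

Lemma cvg_floor lam c : 1 < lam ->
  (Num.floor (lam ^+ N * c))%:~R / lam ^+ N @[N --> \oo] --> c.
Proof.
move=> l1; have l0 N : 0 < lam ^+ N by apply: exprn_gt0; apply: lt_trans l1.
apply: (@squeeze_cvgr _ _ _ _ (fun N => c - (lam ^+ N)^-1) (fun=> c)).
- apply: nearW => N; have /andP[h1 h2] := floor_itv (lam ^+ N * c).
  rewrite ler_pdivlMr // ler_pdivrMr // [c * _]mulrC h1 andbT.
  rewrite mulrBl mulVf ?gt_eqF // lerBlDr mulrC.
  by move: h2; rewrite intrD => /ltW.
- by rewrite -[X in _ --> X]subr0; apply: cvgB; [exact: cvg_cst | exact: cvg_inv_exp].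
- exact: cvg_cst.
Qed.

Lemma cvg_dominate f c lam : 0 < lam -> 0 < c -> f N / lam ^+ N @[N --> \oo] --> c ->
  \forall N \near \oo, 0 < f N.
Proof.
move=> l0 c0 /cvgr_gt/(_ _ c0); apply: filterS => N.
by rewrite pmulr_lgt0 // invr_gt0 exprn_gt0.
Qed.

End RealLimits.

Section PerronFactor.
Variables (R : realType) (n : nat) (A : 'M[int]_n) (u v : 'I_n -> R) (lam : R).
Hypothesis lam1 : 1 < lam.
Hypothesis Acvg : forall i j, ((A ^+ N) i j)%:~R / lam ^+ N @[N --> \oo] --> u i * v j.
Hypothesis uv : \sum_i u i * v i = 1.

(** The constants solve u = c0 p + sum c1 (p + e_i) + sum c2_i (p + D e_i) with total weight 1/t.
    The columns p + e_i make the family generate Z^n, while the long columns p + D e_i carry the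
    offset [eps] at a cost divided by D, so that c0 stays positive: each c2_i is at most 2 c1 and 3
    n < D. The [- 1] in [p] forces eps >= 1 > 1/D, whence c2_i > 0. Finally t outweighs the errors 2
    sum |v_i| and D sum |v_i|, so every column has positive product with v. *)
Let D : int := (4 * n.+1)%:Z.
Let DR : R := D%:~R.
Let t : R := (2 + DR) * (\sum_i `|v i|) + 1.
Let p (i : 'I_n) : int := Num.floor (t * u i) - 1.
Let eps (i : 'I_n) : R := t * u i - (p i)%:~R.
Let c1 : R := (DR * t)^-1.
Let c2 (i : 'I_n) : R := (eps i - DR^-1) / (DR * t).
Let c0 : R := t^-1 - \sum_(i < n) c1 - \sum_i c2 i.

(* The columns of [gens] are p, p + e_i, p + D e_i, where p is an integral point near t u.
   They generate Z^n, and u is a combination of them with positive coefficients [weight]. *)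
Let gens : 'M[int]_(n, 1 + (n + n)) :=
  let P := \col_i p i in
  row_mx P (row_mx (P *m const_mx 1 + 1%:M) (P *m const_mx 1 + D%:M)).
Let weight : 'I_(1 + (n + n)) -> R := fun k =>
  match split k with inl _ => c0 | inr k' => match split k' with inl i => c1 | inr i => c2 i end end.

(** [S] is the sum of all rows of the desired matrix and [M2] its last block; both are rounded. [M1]
    and [M0] are then defined by solving [gens *m M N = A ^+ N] exactly, so they absorb the rounding
    errors, which are bounded and vanish after division by lam^N. *)
Let S N : 'rV[int]_n := \row_j Num.floor (lam ^+ N * (t^-1 * v j)).
Let M2 N : 'M[int]_n := \matrix_(i, j) Num.floor (lam ^+ N * (c2 i * v j)).
Let M1 N : 'M[int]_n := A ^+ N - (\col_i p i) *m S N - D *: M2 N.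
Let M0 N : 'rV[int]_n := S N - const_mx 1 *m M1 N - const_mx 1 *m M2 N.
Let M N : 'M[int]_(1 + (n + n), n) := col_mx (M0 N) (col_mx (M1 N) (M2 N)).

Let DR_ge : 4 <= DR.
Proof. by rewrite /DR /D (ler_nat R 4) leq_pmulr. Qed.

Let DR_gt : 3 * n%:R < DR.
Proof. by rewrite /DR /D -natrM ltr_nat; lia. Qed.

Let DR0 : 0 < DR. Proof. exact: lt_le_trans DR_ge. Qed.

Let sum0 : 0 <= \sum_i `|v i|. Proof. exact: sumr_ge0. Qed.

Let t0 : 0 < t.
Proof. by rewrite /t ltr_wpDl // mulr_ge0 // addr_ge0 // ltW. Qed.

Let eps_itv i : 1 <= eps i < 2.
Proof.
have /andP[h1 h2] := floor_itv (t * u i).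
by rewrite /eps /p intrB; move: h2; rewrite intrD => h2; apply/andP; split; lra.
Qed.

Let DRinv : 0 < DR^-1 <= 4^-1.
Proof. by rewrite invr_gt0 DR0 lef_pV2 ?posrE. Qed.

Let c1_gt0 : 0 < c1. Proof. by rewrite /c1 invr_gt0 mulr_gt0. Qed.

Let c2_gt0 i : 0 < c2 i.
Proof.
rewrite /c2 divr_gt0 ?mulr_gt0 //.
have /andP[h1 h2] := eps_itv i; have /andP[h3 h4] := DRinv.
by move: (eps i) (DR^-1) h1 h2 h3 h4 => x y; lra.
Qed.

Let c2_le i : c2 i <= 2 * c1.
Proof.
rewrite /c2 /c1 ler_wpM2r ?invr_ge0 ?mulr_ge0 ?(ltW DR0) ?(ltW t0) //.
have /andP[h1 h2] := eps_itv i; have /andP[h3 h4] := DRinv.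
by move: (eps i) (DR^-1) h1 h2 h3 h4 => x y; lra.
Qed.

Let c0_gt0 : 0 < c0.
Proof.
have h : \sum_i c2 i <= n%:R * (2 * c1).
  apply: (@le_trans _ _ (\sum_(i < n) 2 * c1)); first exact: ler_sum.
  by rewrite sumr_const card_ord -[leLHS]mulr_natl.
have h1 : \sum_(i < n) c1 = n%:R * c1 by rewrite sumr_const card_ord mulr_natl.
have h2 : 3 * n%:R * c1 < t^-1.
  by rewrite /c1 invfM mulrA ltr_pdivrMr // mulVf ?gt_eqF // ltr_pdivrMr // mul1r.
rewrite -mulrA in h2; rewrite mulrCA in h.
rewrite /c0 h1; move: h h2; move: (\sum_i c2 i) (n%:R * c1) (t^-1) => x y z; lra.
Qed.

Let weight_gt0 k : 0 < weight k.
Proof. by rewrite /weight; case: split => [_|k'] //; case: split. Qed.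

Let c12 i : u i = (p i)%:~R / t + c1 + DR * c2 i.
Proof.
have e : t * u i = (p i)%:~R + eps i by rewrite /eps addrC subrK.
have tn : t != 0 by rewrite gt_eqF.
have Dn : DR != 0 by rewrite gt_eqF.
have -> : u i = ((p i)%:~R + eps i) / t by rewrite -e mulrC mulKf.
have key (a b T d : R) : T != 0 -> d != 0 ->
    (a + b) / T = a / T + (d * T)^-1 + d * ((b - d^-1) / (d * T)).
  by move=> T0 d0; field; rewrite ?T0 ?d0.
exact: key.
Qed.

Let sum_ord (W : nmodType) (F : 'I_(1 + (n + n)) -> W) : \sum_k F k =
  F (lshift _ 0) + (\sum_i F (rshift 1 (lshift n i)) + \sum_i F (rshift 1 (rshift n i))).
Proof. by rewrite !big_split_ord /= big_ord1. Qed.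

Let gens0 i : gens i (lshift _ 0) = p i.
Proof. by rewrite row_mxEl mxE. Qed.
Let gens1 i j : gens i (rshift 1 (lshift n j)) = p i + (i == j)%:R.
Proof. by rewrite row_mxEr row_mxEl !mxE big_ord1 !mxE mulr1. Qed.
Let gens2 i j : gens i (rshift 1 (rshift n j)) = p i + D *+ (i == j).
Proof. by rewrite row_mxEr row_mxEr !mxE big_ord1 !mxE mulr1. Qed.

Let split0 : split (lshift (n + n) (0 : 'I_1)) = inl 0.
Proof. by have := unsplitK (inl (0 : 'I_1) : 'I_1 + 'I_(n + n)). Qed.
Let splitr k : split (rshift 1 k : 'I_(1 + (n + n))) = inr k.
Proof. by have := unsplitK (inr k : 'I_1 + 'I_(n + n)). Qed.
Let split1 (i : 'I_n) : split (lshift n i) = inl i.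
Proof. by have := unsplitK (inl i : 'I_n + 'I_n). Qed.
Let split2 (i : 'I_n) : split (rshift n i) = inr i.
Proof. by have := unsplitK (inr i : 'I_n + 'I_n). Qed.

Let weight_gens i : \sum_k weight k * (gens i k)%:~R = u i.
Proof.
have pick (f : 'I_n -> R) (d : int) : \sum_j f j * (p i + d *+ (i == j))%:~R =
    (\sum_j f j) * (p i)%:~R + d%:~R * f i.
  rewrite mulr_suml (bigD1 i) //= eqxx mulr1n [in RHS](bigD1 i) //= intrD mulrDr.
  rewrite [d%:~R * _]mulrC addrAC; congr (_ + _ + _); apply: eq_bigr => j ij.
  by rewrite eq_sym (negPf ij) mulr0n addr0.
rewrite sum_ord gens0 /weight split0.
under eq_bigr do rewrite splitr split1 gens1.
under [X in _ + (_ + X)]eq_bigr do rewrite splitr split2 gens2.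
rewrite !pick mul1r [RHS]c12 /c0 -/DR.
by move: (\sum_(j < n) c1) (\sum_j c2 j) (t^-1) (c1) (c2 i) (DR) => x y T a b d; ring.
Qed.

Let tau_gens k : 0 < \sum_i v i * (gens i k)%:~R.
Proof.
have base : t - 2 * \sum_i `|v i| <= \sum_i v i * (p i)%:~R.
  have -> : \sum_i v i * (p i)%:~R = t - \sum_i v i * eps i.
    transitivity (\sum_i t * (u i * v i) - \sum_i v i * eps i).
      by rewrite -sumrB; apply: eq_bigr => i _; rewrite /eps; ring.
    by rewrite -mulr_sumr uv mulr1.
  rewrite lerB // mulr_sumr; apply: ler_sum => i _.
  apply: le_trans (ler_norm _) _; rewrite normrM mulrC ler_wpM2r //.
  by have /andP[h1 h2] := eps_itv i; rewrite ger0_norm ?(ltW h2) //; apply: le_trans h1.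
have vle j : `|v j| <= \sum_i `|v i|.
  by rewrite (bigD1 j) //= lerDl sumr_ge0.
have add j d : 0 <= d -> d <= DR -> 0 < \sum_i v i * (p i)%:~R + d * v j.
  move=> d0 dD; have dv : - (DR * \sum_i `|v i|) <= d * v j.
    rewrite lerNl -mulrN; apply: le_trans (ler_norm _) _; rewrite normrM normrN ger0_norm //.
    by apply: ler_pM.
  move: base dv; rewrite /t mulrDl.
  by move: (\sum_i v i * _) (2 * _) (DR * _) (d * _) => a b c d'; lra.
rewrite -(splitK k); case: (split k) => [i0|k'] /=.
  rewrite ord1; under eq_bigr do rewrite gens0.
  move: base; rewrite /t mulrDl; have := mulr_ge0 (ltW DR0) sum0.
  by move: (\sum_i v i * _) (2 * _) (DR * _) => a b c; lra.
have eqb (j : 'I_n) c : \sum_i v i * (c *+ (i == j)) = c * v j.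
  rewrite (bigD1 j) //= eqxx mulr1n big1 ?addr0 1?mulrC // => i ij.
  by rewrite (negPf ij) mulr0n mulr0.
rewrite -(splitK k'); case: (split k') => j /=.
  under eq_bigr do rewrite gens1 intrD mulrDr rmorphMn.
  rewrite big_split /= eqb; apply: add => //.
  by apply: le_trans DR_ge; rewrite (ler_nat R 1 4).
under eq_bigr do rewrite gens2 intrD mulrDr rmorphMn.
by rewrite big_split /= eqb; apply: add => //; exact: ltW.
Qed.

Let gens_M N : gens *m M N = A ^+ N.
Proof.
have key (P : 'cV[int]_n) s (X Y : 'M[int]_n) :
    P *m (s - const_mx 1 *m X - const_mx 1 *m Y) +
    ((P *m const_mx 1 + 1%:M) *m X + (P *m const_mx 1 + D%:M) *m Y) = P *m s + X + D *: Y.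
  rewrite !mulmxDl mul1mx mul_scalar_mx !mulmxBr -!mulmxA.
  move: (P *m s) (P *m (_ *m X)) (P *m (_ *m Y)) => a b c.
  by apply/matrixP => i j; rewrite !mxE; ring.
rewrite /gens /M !mul_row_col key /M1.
by apply/matrixP => i j; rewrite !mxE; ring.
Qed.

Let section : 'M[int]_(1 + (n + n), n) := col_mx (const_mx (-1)) (col_mx 1%:M 0).

Let gens_section : gens *m section = 1%:M.
Proof.
rewrite /gens /section !mul_row_col mulmx0 addr0 mulmx1.
have -> : const_mx (-1) = - const_mx 1 :> 'rV[int]_n by apply/rowP => j; rewrite !mxE.
by rewrite mulmxN addrA addNr add0r.
Qed.

Let cvg_M k j : (M N k j)%:~R / lam ^+ N @[N --> \oo] --> weight k * v j.
Proof.
have cS : forall j, (S N 0 j)%:~R / lam ^+ N @[N --> \oo] --> t^-1 * v j.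
  by move=> j'; under eq_fun do rewrite mxE; apply: cvg_floor.
have cM2 i j' : (M2 N i j')%:~R / lam ^+ N @[N --> \oo] --> c2 i * v j'.
  by under eq_fun do rewrite mxE; apply: cvg_floor.
have cM1 i j' : (M1 N i j')%:~R / lam ^+ N @[N --> \oo] --> c1 * v j'.
  have -> : c1 * v j' = u i * v j' - (p i)%:~R * (t^-1 * v j') - DR * (c2 i * v j').
    by rewrite [u i]c12; ring.
  have -> : (fun N => (M1 N i j')%:~R / lam ^+ N) = (fun N =>
    ((A ^+ N) i j')%:~R / lam ^+ N - (p i)%:~R * ((S N 0 j')%:~R / lam ^+ N)
      - DR * ((M2 N i j')%:~R / lam ^+ N)).
    apply/funext => N; rewrite !mxE big_ord1 !mxE intrB [X in (X - _) / _]intrB !intrM -/DR.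
    by move: (_%:~R) (_%:~R) (_%:~R) (_%:~R) ((lam ^+ N)^-1) (DR) => a b c d e f; ring.
  apply: cvgB; last by apply: cvgMl_tmp.
  by apply: cvgB; [exact: Acvg | apply: cvgMl_tmp].
rewrite -(splitK k); case: (split k) => [i0|k'] /=.
  rewrite ord1 /weight split0.
  have -> : c0 * v j = t^-1 * v j - \sum_(i < n) c1 * v j - \sum_i c2 i * v j.
    by rewrite /c0 !mulrBl !mulr_suml.
  have -> : (fun N => (M N (lshift _ 0) j)%:~R / lam ^+ N) = (fun N =>
     (S N 0 j)%:~R / lam ^+ N - \sum_i (M1 N i j)%:~R / lam ^+ N
      - \sum_i (M2 N i j)%:~R / lam ^+ N).
    apply/funext => N; rewrite /M col_mxEu /M0 !mxE -!mulr_suml -!mulrBl.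
    congr (_ / _); rewrite !intrB !rmorph_sum /=.
    by congr (_ - _ - _); apply: eq_bigr => i _; rewrite mxE mul1r.
  apply: cvgB; last exact: cvg_sum_seq.
  by apply: cvgB => //; exact: cvg_sum_seq.
rewrite /weight splitr -(splitK k'); case: (split k') => i /=.
  rewrite split1; under eq_fun do rewrite /M col_mxEd col_mxEu; exact: cM1.
rewrite split2; under eq_fun do rewrite /M col_mxEd col_mxEd; exact: cM2.
Qed.

(** Divided by lam^N, the entry (i, j) of [M N *m gens] tends to [weight i] times the product of v
    with column j of [gens], and both factors are positive. Since u is a positive combination of the
    columns of [gens], positivity of this product gives positivity of C u as well. *)
Lemma perron_factor : exists k (B : 'M[int]_(n, k)) (C : 'M[int]_(k, n)) N (w : 'M[int]_(k, n)),
  [/\ (0 < N)%N, B *m C = A ^+ N /\ B *m w = 1%:M,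
      forall j, 0 < \sum_i v i * (B i j)%:~R,
      forall i j, 0 < (C *m B) i j &
      forall i, 0 < \sum_j (C i j)%:~R * u j].
Proof.
have ev : \forall N \near \oo, forall ij : 'I_(1 + (n + n)) * 'I_(1 + (n + n)),
    0 < (M N *m gens) ij.1 ij.2.
  apply: filter_forall => -[i j] /=.
  have : 0 < weight i * \sum_l v l * (gens l j)%:~R by rewrite mulr_gt0.
  have l0 : 0 < lam by apply: lt_trans lam1.
  move=> c0'; apply: filterS (@cvg_dominate R (fun N => ((M N *m gens) i j)%:~R) _ lam l0 c0' _).
    by move=> N; rewrite ltr0z.
  have -> : (fun N => ((M N *m gens) i j)%:~R / lam ^+ N) = (fun N =>
     \sum_l (M N i l)%:~R / lam ^+ N * (gens l j)%:~R).
    apply/funext => N; rewrite mxE rmorph_sum /= mulr_suml.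
    by apply: eq_bigr => l _; rewrite rmorphM /= mulrAC.
  rewrite mulr_sumr; apply: cvg_sum_seq => l _; rewrite mulrA.
  by apply: cvgMr_tmp.
have [N [N0 hN]] : exists N, (0 < N)%N /\ forall i j, 0 < (M N *m gens) i j.
  have [N [h1 h2]] := filter_ex (filterI (nbhs_infty_ge 1) ev).
  by exists N; split => // i j; apply: (h2 (i, j)).
exists (1 + (n + n))%N, gens, (M N), N, section; split=> // i.
under eq_bigr do rewrite -weight_gens mulr_sumr.
rewrite exchange_big /=.
apply: (@lt_le_trans _ _ (weight (lshift _ 0) * ((M N *m gens) i (lshift _ 0))%:~R)).
  by rewrite mulr_gt0 // ltr0z.
have -> : \sum_j \sum_(i0 < n) (M N i i0)%:~R * (weight j * (gens i0 j)%:~R) =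
  \sum_j weight j * ((M N *m gens) i j)%:~R.
  apply: eq_bigr => j _; rewrite mxE rmorph_sum /= mulr_sumr.
  by apply: eq_bigr => l _; rewrite rmorphM /=; ring.
rewrite (bigD1 (lshift (n + n) 0)) //= lerDl sumr_ge0 // => j _.
by rewrite mulr_ge0 ?ltW // ltr0z.
Qed.

End PerronFactor.

(** * Unions of backward images of a lattice under an automorphism *)

Section Dilation.
Variables (V : zmodType) (alpha beta : {additive V -> V}).
Hypotheses (alphaK : cancel alpha beta) (betaK : cancel beta alpha).
Variables (L D : set V) (n : nat) (b : 'I_n -> V).
Hypotheses (hb : basis L b) (alphaL : forall v, L v -> L (alpha v)).
Hypothesis LD : forall v, D v <-> exists j, L (iter j alpha v).

Lemma basis_endo_matrix : exists A : 'M[int]_n, forall x, alpha (comb b x) = comb b (A *m x).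
Proof.
have [c [_ _ cK]] := basis_coord hb.
exists (\matrix_(i, j) c (alpha (b j)) i 0) => x; rewrite comb_mul additive_comb.
apply: eq_bigr => j _; congr (_ *~ _); rewrite -[LHS]cK; last first.
  by apply: alphaL; apply: basis_mem hb.
by congr comb; apply/colP => i; rewrite !mxE.
Qed.

Lemma iter_alphaL j v : L v -> L (iter j alpha v).
Proof. by move=> Lv; elim: j => //= j; apply: alphaL. Qed.

Lemma dilation_later i j v : (i <= j)%N -> L (iter i alpha v) -> L (iter j alpha v).
Proof. by move=> ij Lv; rewrite -(subnK ij) iterD; apply: iter_alphaL. Qed.

Section Matrix.
Variable A : 'M[int]_n.
Hypothesis AE : forall x, alpha (comb b x) = comb b (A *m x).

Lemma iter_endo_matrix j x : iter j alpha (comb b x) = comb b (A ^+ j *m x).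
Proof. by elim: j => [|j IH]; rewrite ?expr0_mulmx //= IH AE exprS_mulmx. Qed.

Lemma endo_matrix_det : \det A != 0.
Proof.
rewrite -det_tr; apply/det0P => -[v v0 vA]; move/eqP: v0; apply.
apply: trmx_inj; rewrite trmx0; apply: (basis_inj hb); rewrite raddf0.
apply: (can_inj alphaK); rewrite raddf0 AE.
have -> : A *m v^T = 0 by apply: trmx_inj; rewrite trmx_mul trmxK vA trmx0.
by rewrite raddf0.
Qed.

(** The adjugate inverts [A] up to its determinant, so each step back through [alpha] costs one
    factor [\det A]. *)
Lemma dilation_torsion v : D v -> exists2 m : int, m != 0 & L (v *~ m).
Proof.
move=> /LD[j Lj]; exists (\det A ^+ j); first by rewrite expf_neq0 ?endo_matrix_det.
elim: j v Lj => [|j IH] v Lj; first by rewrite mulr1z.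
have Lw : L (alpha v *~ \det A ^+ j) by apply: IH; rewrite -iterSr.
have [x e] := (hb.1 _).1 Lw.
have sL := basis_subgroup hb.
have : L (comb b (\adj A *m x)) by apply: basis_comb hb.
congr L; apply: (can_inj alphaK); rewrite AE mulmxA mul_mx_adj mul_scalar_mx.
rewrite exprSr mulrzA raddfMz [in RHS]raddfMz /= e.
rewrite -[LHS]/(comb b _) /comb mulrz_suml; apply: eq_bigr => i _.
by rewrite mxE mulrC mulrzA.
Qed.

Variables (k N : nat) (B : 'M[int]_(n, k)) (C w : 'M[int]_(k, n)).
Hypotheses (N0 : (0 < N)%N) (BC : B *m C = A ^+ N) (Bw : B *m w = 1%:M).

Lemma factor_phiB i y z : iter (i * N) beta (comb b (B *m (y - z))) =
  iter (i * N) beta (comb b (B *m y)) - iter (i * N) beta (comb b (B *m z)).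
Proof. by rewrite mulmxBr raddfB iterB. Qed.

Definition factor_phi i : {additive 'cV[int]_k -> V} := mkadd (factor_phiB i).

(** [B *m C] and [C *m B] are shift equivalent and so have the same limit. The right inverse [w] of
    [B] lifts lattice elements to Z^k. *)
Lemma factor_pres : presentation D (C *m B) factor_phi.
Proof.
split=> [i y|i y /= e|v] /=.
- rewrite mulSn addnC iterD 2!mulmxA BC -mulmxA -iter_endo_matrix.
  by rewrite (iter_cancel _ alphaK).
- exists 1%N; rewrite expr1 -mulmxA.
  have -> : B *m y = 0; last by rewrite mulmx0.
  apply: (basis_inj hb); rewrite raddf0; apply: (can_inj (iter_cancel (i * N) betaK)).
  by rewrite e iter0.
split=> [/LD[j Lj]|[i [y ->]]]; last first.
  apply/LD; exists (i * N)%N; rewrite (iter_cancel _ betaK); exact: basis_comb hb.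
have [x e] := (hb.1 _).1 (dilation_later (leq_pmulr j N0) Lj).
exists j, (w *m x); rewrite mulmxA Bw mul1mx -e (iter_cancel _ alphaK) //.
Qed.

End Matrix.

Lemma dilation_stationary : stationary_group D.
Proof.
have [A AE] := basis_endo_matrix.
have e : 1%:M *m A = A ^+ 1 by rewrite mul1mx expr1.
have pr := factor_pres AE (ltn0Sn 0) e (mulmx1 _).
by apply/(stationary_groupP (pres_subgroup pr)); do 3!eexists; exact: pr.
Qed.

Variables (R : realType) (tau : {additive V -> R}) (lam : R).
Hypotheses (lam1 : 1 < lam) (tau_alpha : forall v, tau (alpha v) = lam * tau v).

(* Asymptotically alpha^N acts on L as lam^N times a rank one operator with kernel ker tau:
   every functional l sees only the component along a Perron eigenvector. *)
Definition perron_cvg (L : set V) := forall l : V -> R, additive_on L l ->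
  exists c, forall x, L x -> l (iter N alpha x) / lam ^+ N @[N --> \oo] --> c * tau x.

Hypotheses (Lcvg : perron_cvg L) (tau0 : exists2 x, L x & tau x != 0).

Lemma tau_iter j v : tau (iter j alpha v) = lam ^+ j * tau v.
Proof. by elim: j => [|j IH]; rewrite ?mul1r //= tau_alpha IH exprS mulrA. Qed.

Lemma dilation_stationary_ordered :
  stationary_ordered_group D ([set v | D v /\ 0 < tau v] `|` [set 0]).
Proof.
have l0 j : 0 < lam ^+ j by apply: exprn_gt0; apply: lt_trans lam1.
have [A AE] := basis_endo_matrix.
have [c [cB cK Kc]] := basis_coord hb.
have [u hu] : {u : 'I_n -> R & forall i x, L x ->
    (c (iter N alpha x) i 0)%:~R / lam ^+ N @[N --> \oo] --> u i * tau x}.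
  apply: (@choice _ _ (fun (i : 'I_n) (ui : R) => forall x, L x ->
    (c (iter N alpha x) i 0)%:~R / lam ^+ N @[N --> \oo] --> ui * tau x)) => i.
  apply: (Lcvg (l := fun v => (c v i 0)%:~R)) => v v' Lv Lv'.
  by rewrite cB // !mxE intrB.
have tauE x : tau (comb b x) = \sum_i tau (b i) * (x i 0)%:~R.
  by rewrite additive_comb; apply: eq_bigr => i _; rewrite mulrzr.
(* Apply tau to alpha^N x / lam^N: the value is tau x for every N, and through the coordinates it
   converges to (sum u_i tau (b_i)) tau x. *)
have uv : \sum_i u i * tau (b i) = 1.
  have [x Lx tx] := tau0; apply: (mulIf tx); rewrite mul1r mulr_suml.
  have h1 : \sum_i tau (b i) * ((c (iter N alpha x) i 0)%:~R / lam ^+ N) @[N --> \oo] -->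
     \sum_i u i * tau (b i) * tau x.
    apply: cvg_sum_seq => i _; rewrite -mulrA mulrCA; apply: cvgMl_tmp; exact: hu.
  have h2 : \sum_i tau (b i) * ((c (iter N alpha x) i 0)%:~R / lam ^+ N) @[N --> \oo] --> tau x.
    rewrite (_ : (fun N => _) = fun=> tau x); first exact: cvg_cst.
    apply/funext => N; under eq_bigr do rewrite mulrA.
    rewrite -mulr_suml -tauE Kc; last exact: iter_alphaL.
    by rewrite tau_iter mulrC mulrA mulVf ?mul1r // gt_eqF.
  exact: cvg_unique h1 h2.
have Acvg i j : ((A ^+ N) i j)%:~R / lam ^+ N @[N --> \oo] --> u i * tau (b j).
  have := hu i _ (basis_mem j hb); apply: cvg_trans; apply: near_eq_cvg; apply: nearW => N.
  by rewrite -(comb_delta b) (iter_endo_matrix AE) cK -colE mxE.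
have [k [B [C [N [w [N0 [BC Bw] Bpos CBpos Cu]]]]]] := perron_factor lam1 Acvg uv.
have pr := factor_pres AE N0 BC Bw.
have sD := pres_subgroup pr; have [D0 _] := sD.
apply/(stationary_orderedP sD); first by move=> v [[]|->].
exists k, (C *m B), (factor_phi N B); split=> //; first by move=> i j; apply: ltW.
have tauB y : tau (comb b (B *m y)) = \sum_j (\sum_i tau (b i) * (B i j)%:~R) * (y j 0)%:~R.
  rewrite tauE; under [RHS]eq_bigr do rewrite mulr_suml.
  rewrite exchange_big; apply: eq_bigr => i _; rewrite mxE rmorph_sum /= mulr_sumr.
  by apply: eq_bigr => j _; rewrite rmorphM /= mulrA.
apply/seteqP; split=> [v [[Dv tv]|->]|v [i [y [hy ->]]]]; last first.
- have [->|/eqP y0] := eqVneq y 0; first by right; rewrite raddf0.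
  left; split; first exact: pres_mem pr _ _.
  have : 0 < tau (comb b (B *m y)).
    rewrite tauB lt_neqAle sumr_ge0 ?andbT => [|j _]; last first.
      by rewrite mulr_ge0 ?ler0z // ltW.
    apply/eqP => /esym/eqP; rewrite psumr_eq0 => [/allP h|j _]; last first.
      by rewrite mulr_ge0 ?ler0z // ltW.
    apply: y0; apply/colP => j; have := h j (mem_index_enum _).
    by rewrite mulf_eq0 gt_eqF //= intr_eq0 mxE => /eqP.
  rewrite -[comb b (B *m y)](iter_cancel (i * N) betaK) tau_iter pmulr_rgt0 //.
- by exists 0%N, 0; rewrite raddf0; split=> // s; rewrite mxE.
have [j Lj] := (LD v).1 Dv.
have [x e] := (hb.1 _).1 (dilation_later (leq_pmulr j N0) Lj).
have tx : 0 < tau (comb b x) by rewrite -e tau_iter mulr_gt0.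
(* Scaled by lam^M this vector tends to tau(x) C u, which is positive; so x acquires a non-negative
   representative in Z^k. *)
have ev : \forall M \near \oo, forall i : 'I_k, 0 < (C *m (A ^+ M *m x)) i 0.
  apply: filter_forall => i.
  have c0 : 0 < \sum_j (C i j)%:~R * u j * tau (comb b x) by rewrite -mulr_suml mulr_gt0.
  apply: filterS (@cvg_dominate R (fun M => ((C *m (A ^+ M *m x)) i 0)%:~R) _ lam (l0 1%N) c0 _).
    by move=> M; rewrite ltr0z.
  have -> : (fun M => ((C *m (A ^+ M *m x)) i 0)%:~R / lam ^+ M) = (fun M =>
     \sum_j (C i j)%:~R * ((c (iter M alpha (comb b x)) j 0)%:~R / lam ^+ M)).
    apply/funext => M; rewrite mxE rmorph_sum /= mulr_suml; apply: eq_bigr => l _.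
    by rewrite rmorphM /= (iter_endo_matrix AE) cK mulrA.
  apply: cvg_sum_seq => l _; rewrite -mulrA; apply: cvgMl_tmp.
  by apply: hu; apply: basis_comb hb.
have [M0 _ hM] := ev.
(* The last stage accounts for the factor A^N that [B *m C] introduces. *)
exists (j + M0 + 1)%N, (C *m (A ^+ (M0 * N) *m x)); split.
  by move=> s; apply: ltW; apply: hM; rewrite /= leq_pmulr.
rewrite /= mulmxA BC !mulnDl mul1n -exprD_mulmx -(iter_endo_matrix AE) -e.
rewrite -iterD (_ : (N + M0 * N + j * N)%N = (j * N + M0 * N + N)%N); last by lia.
by rewrite (iter_cancel _ alphaK).
Qed.

End Dilation.

(** * Shift automorphisms and Perron eigenvalues *)

Lemma group_isoB (V W : zmodType) (E : set W) (f : V -> W) : is_group_iso [set: V] E f ->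
  forall x y, f (x - y) = f x - f y.
Proof.
move=> [fD _ _] x y; apply/eqP; rewrite eq_sym subr_eq -fD ?inE //.
by rewrite subrK.
Qed.

Section Stationary.
Variables (V : zmodType) (k : nat) (A : 'M[int]_k) (phi : nat -> {additive 'cV[int]_k -> V}).
Hypothesis pr : presentation [set: V] A phi.

Lemma stage_repr v : exists i x, v = phi i x.
Proof. exact/(pres_im pr). Qed.

Lemma torsion_free_pres : torsion_free V.
Proof.
move=> v m; have [i [x ->]] := stage_repr v.
rewrite -raddfMz => /(pres_ker pr)[j e] m0.
suff A0 : A ^+ j *m x = 0 by rewrite -(pres_iter pr i j) A0 raddf0.
move: e; rewrite -scaler_int -scalemxAr => /eqP; rewrite scalemx_eq0.
by rewrite intz (negPf m0) => /eqP.
Qed.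

(** Multiplying representatives by [A], or moving them one stage on, yields two more presentations
    of [V] by the same matrix; comparison with the original one gives mutually inverse
    automorphisms. *)
Lemma pres_shift_auto : exists alpha beta : {additive V -> V},
  [/\ cancel alpha beta, cancel beta alpha,
      forall i x, alpha (phi i x) = phi i (A *m x) &
      forall i x, beta (phi i x) = phi i.+1 x].
Proof.
have phi1B i x y : phi i (A *m (x - y)) = phi i (A *m x) - phi i (A *m y).
  by rewrite mulmxBr raddfB.
have pr1 : presentation [set: V] A (fun i => mkadd (phi1B i)).
  split=> [i x|i x /= /(pres_ker pr)[j e]|v] /=; first by rewrite (pres_shift pr).
    by exists j.+1; rewrite exprSr -mulmxE -mulmxA.
  split=> // _; have [i [x ->]] := stage_repr v.
  by exists i.+1, x; rewrite (pres_shift pr).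
have pr2 : presentation [set: V] A (fun i => phi i.+1).
  split=> [i x|i x /= /(pres_ker pr)[j e]|v]; first by rewrite (pres_shift pr).
    by exists j.
  split=> // _; have [i [x ->]] := stage_repr v.
  by exists i, (A *m x); rewrite (pres_shift pr).
have [f fi fE] := pres_map pr pr1; have [g gi gE] := pres_map pr pr2.
exists (mkadd (group_isoB fi)), (mkadd (group_isoB gi)); split=> //= v.
  have [i [x ->]] := stage_repr v.
  by rewrite fE gE /= (pres_shift pr).
have [i [x ->]] := stage_repr v.
by rewrite gE fE /= (pres_shift pr).
Qed.

(** The kernel of [phi 0] is finitely generated, so one power A^l kills all of it. Then A^l embeds
    the image of the first stage into Z^k, where subgroups have bases. *)
Lemma range_basis : exists m (b : 'I_m -> V), (m <= k)%N /\ basis (range (phi 0%N)) b.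
Proof.
have sK : subgroup [set x | phi 0%N x = 0].
  by split=> [|x y /= ex ey]; rewrite /= ?raddf0 ?raddfB //= ex ey subrr.
have [m [b [_ hb]]] := @sublattice_basis _ _ [set x | phi 0%N x = 0] id sK
  (fun _ _ _ _ => erefl) (fun _ _ => id).
have [j hj] : {j : 'I_m -> nat & forall i, A ^+ j i *m b i = 0}.
  apply: (@choice _ _ (fun i j => A ^+ j *m b i = 0)) => i.
  by have /(pres_ker pr) := basis_mem i hb.
pose l := \max_i j i.
have lE x : phi 0%N x = 0 -> A ^+ l *m x = 0.
  move=> /hb.1[y ->]; rewrite /comb mulmx_sumr big1 // => i _.
  rewrite -scaler_int -scalemxAr.
  have /subnK <- : (j i <= l)%N by apply: leq_bigmax.
  by rewrite exprD_mulmx hj mulmx0 scaler0.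
have [g gE] : {g : V -> 'cV[int]_k & forall v, range (phi 0%N) v -> phi 0%N (g v) = v}.
  apply: (@choice _ _ (fun v x => range (phi 0%N) v -> phi 0%N x = v)) => v.
  by have [[x _ <-]|nr] := pselect (range (phi 0%N) v); [exists x | exists 0].
have sR := range_subgroup (phi 0%N).
apply: (@sublattice_basis _ _ _ (fun v => A ^+ l *m g v)) => // [v w rv rw|v rv e].
  have [_ /(_ _ _ rv rw) rvw] := sR.
  apply/eqP; rewrite -mulmxBr -subr_eq0 -mulmxBr; apply/eqP/lE.
  by rewrite raddfB [X in _ - X]raddfB /= !gE // subrr.
by rewrite -(gE v rv) -(pres_iter pr 0 l) e raddf0.
Qed.

Section Auto.
Variables (alpha beta : {additive V -> V}).
Hypotheses (alphaK : cancel alpha beta) (betaK : cancel beta alpha).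
Hypothesis alphaE : forall i x, alpha (phi i x) = phi i (A *m x).

Lemma alpha_iterE j i x : iter j alpha (phi i x) = phi i (A ^+ j *m x).
Proof. by elim: j => [|j IH]; rewrite ?expr0_mulmx //= IH alphaE exprS_mulmx. Qed.

Lemma alpha_range v : range (phi 0%N) v -> range (phi 0%N) (alpha v).
Proof. by move=> [x _ <-]; rewrite alphaE; exists (A *m x). Qed.

Lemma range_dilation v : exists j, range (phi 0%N) (iter j alpha v).
Proof.
have [j [x ->]] := stage_repr v; exists j; rewrite alpha_iterE.
by have := pres_iter pr 0 j x; rewrite addn0 => ->; exists x.
Qed.

(** Modulo M there are only finitely many matrices, so A^i and A^j agree there for some i < j.
    Moving a representative i stages on supplies a factor A^i, which turns A^j = A^i into
    alpha^(j-i) = 1 modulo M on all of [V], even when [A] is singular. *)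
Lemma alpha_period (M : int) : M != 0 ->
  exists2 n, (0 < n)%N & forall t v, exists w, iter (n * t) alpha v - v = w *~ M.
Proof.
move=> M0; pose m := `|M|%N; have m0 : (0 < m)%N by rewrite absz_gt0.
have red_lt (z : int) : (`|(z %% M)%Z| < m)%N by rewrite /m; have := ltz_mod z M0; lia.
pose red j : {ffun 'I_k * 'I_k -> 'I_m} := [ffun sl => Ordinal (red_lt ((A ^+ j) sl.1 sl.2))].
have [i [j [ij e]]] : exists i j, (i < j)%N /\ red i = red j.
  apply: contrapT => h.
  have inj : injective (fun i : 'I_(#|{: {ffun 'I_k * 'I_k -> 'I_m}}|.+1) => red i).
    move=> i j e; apply/val_inj; case: (ltngtP i j) => // lt; exfalso; apply: h.
      by exists i, j.
    by exists j, i.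
  by have := leq_card _ inj; rewrite card_ord ltnn.
have [W hW] : exists W : 'M[int]_k, A ^+ j - A ^+ i = M *: W.
  exists (\matrix_(s, l) (((A ^+ j) s l - (A ^+ i) s l) %/ M)%Z).
  apply/matrixP => s l; rewrite !mxE mulrC divzK //.
  move/ffunP/(_ (s, l)) : e; rewrite !ffunE /= => /(congr1 val) /= e.
  rewrite -eqz_mod_dvd; apply/eqP.
  by have := modz_ge0 ((A ^+ j) s l) M0; have := modz_ge0 ((A ^+ i) s l) M0; lia.
exists (j - i)%N; first by rewrite subn_gt0.
have one v : exists w, iter (j - i) alpha v - v = w *~ M.
  have [l [x ->]] := stage_repr v; exists (phi (i + l)%N (W *m x)).
  rewrite alpha_iterE -(pres_iter pr l i x) -(pres_iter pr l i (_ *m x)) -raddfB /=.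
  rewrite -exprD_mulmx subnKC ?(ltnW ij) // -mulmxBl hW -scalemxAl.
  by rewrite -raddfMz -scaler_int intz.
elim=> [|t IH] v; first by exists 0; rewrite muln0 subrr mul0rz.
have [w1 e1] := one v; have [w2 e2] := IH (iter (j - i) alpha v).
exists (w1 + w2); rewrite mulrzDl -e1 -e2 mulnS addnC iterD.
by rewrite [RHS]addrC addrA subrK.
Qed.

End Auto.
End Stationary.

(** * The eigenvalue of the shift and its rank one convergence *)

Section Growth.
Variables (R : realType) (V : zmodType) (k : nat) (A : 'M[int]_k).
Variables (phi : nat -> {additive 'cV[int]_k -> V}) (tau : {additive V -> R}).
Hypotheses (pr : presentation [set: V] A phi) (A0 : nonneg_mx A).
Hypothesis coneE : forall v, pres_cone phi v <-> (0 < tau v \/ v = 0).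
Variables (alpha beta : {additive V -> V}).
Hypothesis alphaK : cancel alpha beta.
Hypothesis alphaE : forall i x, alpha (phi i x) = phi i (A *m x).
Hypothesis tau_neq0 : exists v, tau v != 0.

Let tauMzB v w a b : tau (v *~ a - w *~ b) = tau v * a%:~R - tau w * b%:~R.
Proof. by rewrite raddfB /= !mulrzr; congr (_ - _); exact: raddfMz. Qed.

Let tau_gt0 : exists v, 0 < tau v.
Proof.
have [v] := tau_neq0; rewrite neq_lt => /orP[lt0|gt0]; last by exists v.
by exists (- v); rewrite raddfN oppr_gt0.
Qed.

Let alpha_cone v : pres_cone phi v -> pres_cone phi (alpha v).
Proof.
move=> [i [x [hx ->]]]; exists i, (A *m x); rewrite alphaE; split=> //.
exact: nonneg_mul.
Qed.

(** The cone determines tau up to scale: if tau v / tau h decreased under alpha, a rational number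
    in the gap would give an integral combination of v and h that is positive while its image is
    negative. Applying this to [- v] turns the inequality into an equality. *)
Lemma shift_eigenvalue : exists2 lam, 0 < lam & forall v, tau (alpha v) = lam * tau v.
Proof.
have [h h0] := tau_gt0.
have ah0 : 0 < tau (alpha h).
  have /alpha_cone/coneE[//|e] : pres_cone phi h by apply/coneE; left.
  move: h0; have -> : h = 0 by rewrite -(alphaK h) e raddf0.
  by rewrite raddf0 ltxx.
have half v : tau v / tau h <= tau (alpha v) / tau (alpha h).
  rewrite leNgt; apply/negP => /rat_in_itvoo[q]; rewrite in_itv /= => /andP[q1 q2].
  have d0 : 0 < (denq q)%:~R :> R by rewrite ltr0z.
  have qE : ratr q = (numq q)%:~R / (denq q)%:~R :> R by [].
  pose w := v *~ denq q - h *~ numq q.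
  have : 0 < tau w.
    rewrite /w tauMzB subr_gt0.
    by move: q2; rewrite qE ltr_pdivlMr // mulrAC ltr_pdivrMr // mulrC.
  have : tau (alpha w) < 0.
    have -> : alpha w = alpha v *~ denq q - alpha h *~ numq q.
      by rewrite raddfB; congr (_ - _); exact: raddfMz.
    rewrite tauMzB subr_lt0.
    by move: q1; rewrite qE ltr_pdivrMr // mulrAC ltr_pdivlMr // [X in _ < X]mulrC.
  move=> lt0 w0; have /alpha_cone/coneE[gt0|e] : pres_cone phi w by apply/coneE; left.
    by have := lt_trans lt0 gt0; rewrite ltxx.
  by move: lt0; rewrite e raddf0 ltxx.
exists (tau (alpha h) / tau h) => [|v]; first exact: divr_gt0.
have e : tau v / tau h = tau (alpha v) / tau (alpha h).
  apply/eqP; rewrite eq_le half /=.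
  by have := half (- v); rewrite !raddfN /= !mulNr lerN2.
by rewrite mulrAC -mulrA e mulrCA mulfV ?mulr1 // gt_eqF.
Qed.

Variable lam : R.
Hypotheses (lam0 : 0 < lam) (tau_alpha : forall v, tau (alpha v) = lam * tau v).

Let e l := phi 0%N (delta_mx l 0).
Let t l := tau (e l).

Let cone0 i (x : 'cV[int]_k) : (forall s, 0 <= x s 0) -> pres_cone phi (phi i x).
Proof. by move=> hx; exists i, x. Qed.

Let cone_ge0 v : pres_cone phi v -> 0 <= tau v.
Proof. by move=> /coneE[/ltW //|->]; rewrite raddf0. Qed.

Let delta_ge0 l s : 0 <= (delta_mx l 0 : 'cV[int]_k) s 0.
Proof. by rewrite mxE ler0n. Qed.

Let t_ge0 l : 0 <= t l.
Proof. by apply: cone_ge0; apply: cone0. Qed.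

Let e0 l : t l = 0 -> e l = 0.
Proof.
move=> tl; have : pres_cone phi (e l) by apply: cone0.
by case/coneE => //; rewrite -/(t l) tl ltxx.
Qed.

Let phi0E x : phi 0%N x = \sum_l e l *~ x l 0.
Proof. exact: additive_cV. Qed.

Let tau0E x : tau (phi 0%N x) = \sum_l t l * (x l 0)%:~R.
Proof.
by rewrite phi0E raddf_sum; apply: eq_bigr => l _; rewrite raddfMz /= mulrzr.
Qed.

Let alpha_iter_tau j v : tau (iter j alpha v) = lam ^+ j * tau v.
Proof. exact: tau_iter. Qed.

Let alpha_phi i x : iter i alpha (phi i x) = phi 0%N x.
Proof.
by rewrite (alpha_iterE alphaE); have := pres_iter pr 0 i x; rewrite addn0.
Qed.

Let tauE i x : lam ^+ i * tau (phi i x) = \sum_l t l * (x l 0)%:~R.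
Proof. by rewrite -alpha_iter_tau alpha_phi tau0E. Qed.

(* If lam <= 1, the least positive value m among the tau (e l) is the least positive value of
   tau, and the elements where tau = m at a given stage lie among the k images of the basis
   vectors; so ker tau has no room for a line, and G is generated by one element. *)
Lemma eigenvalue_gt1 : ~ cyclic_group [set: V] -> 1 < lam.
Proof.
move=> ncyc; rewrite ltNge; apply/negP => lam1; apply: ncyc.
have lam_le1 i : lam ^+ i <= 1 by rewrite exprn_ile1 // ltW.
have li0 i : 0 < lam ^+ i by rewrite exprn_gt0.
have pos_l i (x : 'cV[int]_k) : (forall s, 0 <= x s 0) -> 0 < tau (phi i x) ->
    exists l, 0 < t l /\ 1 <= x l 0.
  move=> hx tx; apply: contrapT => h.
  have : 0 < \sum_l t l * (x l 0)%:~R by rewrite -(tauE i) mulr_gt0.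
  rewrite big1 ?ltxx // => l _.
  have := hx l; rewrite le_eqVlt => /orP[/eqP <-|xl]; first by rewrite mulr0.
  have := t_ge0 l; rewrite le_eqVlt => /orP[/eqP <-|tl]; first by rewrite mul0r.
  by exfalso; apply: h; exists l.
have [l1 tl1] : exists l, 0 < t l.
  have [v tv] := tau_gt0; have [i [x [hx vE]]] : pres_cone phi v by apply/coneE; left.
  by move: tv; rewrite vE => /(pos_l _ _ hx)[l []]; exists l.
have [l0 tl0 lmin] := @arg_minP _ _ _ l1 (fun l => 0 < t l) t tl1.
set m := t l0 in tl0.
have minE v : 0 < tau v -> m <= tau v.
  move=> tv; have [i [x [hx vE]]] : pres_cone phi v by apply/coneE; left.
  have [l [tl xl]] : exists l, 0 < t l /\ 1 <= x l 0 by apply: (pos_l i); rewrite -?vE.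
  apply: (@le_trans _ _ (lam ^+ i * tau v)); last by rewrite ger_pMl.
  rewrite vE tauE (bigD1 l) //= ler_wpDr //.
    by apply: sumr_ge0 => s _; rewrite mulr_ge0 ?ler0z.
  apply: le_trans (lmin l tl) _; rewrite ler_pMr //.
  by rewrite (ler_int R 1).
have ker0 x : tau x = 0 -> x = 0.
  move=> tx; pose y n := e l0 + x *+ n.
  have ty n : tau (y n) = m by rewrite raddfD raddfMn /= tx mul0rn addr0.
  have [z hz] : {z : nat -> nat * 'cV[int]_k & forall n, (forall s, 0 <= (z n).2 s 0)
      /\ y n = phi (z n).1 (z n).2}.
    apply: (@choice _ _ (fun n (z : nat * 'cV[int]_k) => (forall s, 0 <= z.2 s 0)
      /\ y n = phi z.1 z.2)) => n.
    have [i [x' [hx' yE]]] : pres_cone phi (y n) by apply/coneE; left; rewrite ty.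
    by exists (i, x').
  pose i := \max_(n < k.+1) (z n).1.
  have [l hl] : {l : 'I_k.+1 -> 'I_k & forall n : 'I_k.+1, y n = phi i (delta_mx (l n) 0)}.
    apply: (@choice _ _ (fun (n : 'I_k.+1) l => y n = phi i (delta_mx l 0))) => n.
    have [hz2 yE] := hz n.
    have [x' yE' hx'] := pres_cone_later pr A0 yE hz2
      (leq_bigmax (F := fun n : 'I_k.+1 => (z n).1) n).
    have [l [tl xl]] : exists l, 0 < t l /\ 1 <= x' l 0.
      by apply: (pos_l i); rewrite -?yE' ?ty.
    exists l; apply/eqP; rewrite -subr_eq0; apply/eqP.
    (* The difference is in the cone, but tau of the basis vector is at least m = tau (y n); hence
       the difference is 0. With k basis vectors and k + 1 elements [y n], two of these coincide. *)
    have : pres_cone phi (y n - phi i (delta_mx l 0)).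
      rewrite yE' -raddfB; apply: cone0 => s.
      rewrite !mxE; case: eqP => [->|_]; rewrite ?andbF ?subr0 ?hx' //=.
      by rewrite subr_ge0.
    case/coneE => //; rewrite raddfB /= ty subr_gt0 ltNge => /negP[].
    apply: le_trans (lmin l tl) _.
    have := tauE i (delta_mx l 0); rewrite -tau0E -/(e l) -/(t l) => <-.
    by rewrite ger_pMl // -(pmulr_rgt0 _ (li0 i)) tauE -tau0E.
  have : ~ injective l by move=> /leq_card; rewrite !card_ord ltnn.
  apply: contra_notP => x0 n n' ll.
  have /eqP : x *~ (n%:Z - n'%:Z) = 0.
    rewrite mulrzBr -!pmulrn; apply/eqP; rewrite subr_eq0; apply/eqP.
    by apply: (addrI (e l0)); rewrite -/(y n) -/(y n') !hl ll.
  have [//|nn] := eqVneq n n'.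
  move=> /eqP /(torsion_free_pres pr) h; exfalso; apply/x0/h.
  by rewrite subr_eq0 eqz_nat.
exists (e l0); apply/seteqP; split=> // v _ /=.
exists (Num.floor (tau v / m)); apply/eqP; rewrite -subr_eq0; apply/eqP/ker0.
have /andP[f1 f2] := floor_itv (tau v / m).
set q := Num.floor _ in f1 f2 *.
have tw : tau (v - e l0 *~ q) = tau v - m * q%:~R by rewrite raddfB raddfMz /= mulrzr.
have w0 : 0 <= tau (v - e l0 *~ q).
  by rewrite tw subr_ge0 mulrC -ler_pdivlMr.
have w1 : tau (v - e l0 *~ q) < m.
  by move: f2; rewrite tw ltrBlDl -[X in _ < _ + X]mulr1 -mulrDr [m * _]mulrC -ltr_pdivrMr ?intrD.
apply/eqP; rewrite eq_le w0 andbT leNgt; apply/negP => /minE.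
by rewrite leNgt w1.
Qed.

Section Functional.
Variable l : V -> R.
Hypothesis lB : additive_on (range (phi 0%N)) l.

Let sR : subgroup (range (phi 0%N)). Proof. exact: range_subgroup. Qed.

Let re s : range (phi 0%N) (e s). Proof. by exists (delta_mx s 0). Qed.

Let l0E x : l (phi 0%N x) = \sum_s l (e s) * (x s 0)%:~R.
Proof.
rewrite phi0E (additive_on_sum sR lB) => [|s]; last by apply: subgroupMz => //; apply: re.
by apply: eq_bigr => s _; rewrite (additive_onMz sR lB) ?mulrzr //; apply: re.
Qed.

Let one : 'cV[int]_k := const_mx 1.
Let h := phi 0%N one.

Let iterA_one_ge0 j s : 0 <= (A ^+ j *m one) s 0.
Proof. by apply: nonneg_mul; [exact: nonneg_expr | move=> i; rewrite mxE]. Qed.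

Let h_gt0 : 0 < tau h.
Proof.
have : pres_cone phi h by apply: cone0 => s; rewrite mxE.
case/coneE => // h0; exfalso; have [v] := tau_neq0; have [i [x ->]] := stage_repr pr v.
move/eqP; apply; apply: (mulfI (lt0r_neq0 (exprn_gt0 i lam0))).
rewrite mulr0 tauE big1 // => s _.
have /eqP : tau h = 0 by rewrite h0 raddf0.
rewrite tau0E; under eq_bigr do rewrite mxE mulr1.
rewrite psumr_eq0 => [/allP/(_ s (mem_index_enum _))/eqP ->|s' _]; first by rewrite mul0r.
exact: t_ge0.
Qed.

Let ratio x := tau (phi 0%N x) / tau h.

(** A rational number strictly in between clears to an integral vector of positive tau, which is
    non-negative at all late stages. *)
Let ratio_le x c : ratio x < c -> \forall j \near \oo,
  forall s, ((A ^+ j *m x) s 0)%:~R <= c * ((A ^+ j *m one) s 0)%:~R.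
Proof.
move=> /rat_in_itvoo[q]; rewrite in_itv /= => /andP[q1 q2].
have d0 : 0 < (denq q)%:~R :> R by rewrite ltr0z.
have qE : ratr q = (numq q)%:~R / (denq q)%:~R :> R by [].
pose w := numq q *: one - denq q *: x.
have /coneE : 0 < tau (phi 0%N w) \/ phi 0%N w = 0.
  left; have -> : phi 0%N w = h *~ numq q - phi 0%N x *~ denq q.
    by rewrite raddfB; congr (_ - _); rewrite -[X in X *: _]intz scaler_int; exact: raddfMz.
  rewrite tauMzB subr_gt0.
  by move: q1; rewrite qE /ratio ltr_pdivrMr // mulrAC ltr_pdivlMr // [X in _ < X]mulrC.
move=> /(pres_cone_stage pr A0)[j0 hj0]; exists j0 => // j /hj0 hj s.
apply: (@le_trans _ _ (ratr q * ((A ^+ j *m one) s 0)%:~R)); last first.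
  by rewrite ler_wpM2r ?ler0z // ltW.
have ent (a b : int) (y z : 'cV[int]_k) : (a *: y - b *: z) s 0 = a * y s 0 - b * z s 0.
  by rewrite !mxE.
have := hj s; rewrite /w mulmxBr -!scalemxAr ent subr_ge0.
rewrite -(ler_int R) !intrM qE => le_pq.
by rewrite mulrAC ler_pdivlMr // mulrC.
Qed.

Let ratio_approx x eps : 0 < eps -> \forall j \near \oo, forall s,
  `|((A ^+ j *m x) s 0)%:~R - ratio x * ((A ^+ j *m one) s 0)%:~R|
    <= eps * ((A ^+ j *m one) s 0)%:~R.
Proof.
move=> eps0; have h1 : ratio x < ratio x + eps by rewrite ltrDl.
have h2 : ratio (- x) < - ratio x + eps by rewrite /ratio !raddfN /= mulNr ltrDl.
apply: filterS (filterI (ratio_le h1) (ratio_le h2)) => j [/= le1 le2] s.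
have := le1 s; have := le2 s; rewrite mulmxN [(- (A ^+ j *m x)) s 0]mxE rmorphN /= ler_norml.
by move: (_ s 0)%:~R (_ s 0)%:~R => a b; rewrite !mulrDl mulNr => *; apply/andP; split; lra.
Qed.

(** Chosen so that |l (e s)| <= K t_s for every s and 1 <= T t_s whenever t_s > 0. If t_s = 0 then e
    s = 0, and the corresponding summand is 0 because division by zero gives 0. *)
Let K := \sum_s `|l (e s)| / t s + 1.
Let T := \sum_s (t s)^-1.

Let K_gt0 : 0 < K.
Proof. by rewrite ltr_wpDl // sumr_ge0 // => s _; rewrite divr_ge0. Qed.

Let l_le s : `|l (e s)| <= K * t s.
Proof.
have := t_ge0 s; rewrite le_eqVlt => /orP[/eqP ts|ts].
  by rewrite e0 // (additive_on0 sR lB) normr0 -ts mulr0.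
rewrite -ler_pdivrMr // /K (bigD1 s) //= -addrA lerDl addr_ge0 // sumr_ge0 // => i _.
exact: divr_ge0.
Qed.

Let T_ge0 : 0 <= T. Proof. by apply: sumr_ge0 => s _; rewrite invr_ge0. Qed.

Let T_ge s : 0 < t s -> 1 <= T * t s.
Proof.
move=> ts; rewrite -ler_pdivrMr // mul1r /T (bigD1 s) //= lerDl sumr_ge0 // => i _.
by rewrite invr_ge0.
Qed.

(* The error is measured against tau, which bounds every functional on the cone. *)
Let functional_approx x eps : 0 < eps -> \forall j \near \oo,
  `|l (iter j alpha (phi 0%N x)) - ratio x * l (iter j alpha h)|
    <= eps * K * (lam ^+ j * tau h).
Proof.
move=> eps0; apply: filterS (ratio_approx x eps0) => j hj.
rewrite !(alpha_iterE alphaE) !l0E mulr_sumr -sumrB.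
apply: le_trans (ler_norm_sum _ _ _) _.
have -> : lam ^+ j * tau h = \sum_s t s * ((A ^+ j *m one) s 0)%:~R.
  by rewrite -tau0E -(alpha_iterE alphaE) alpha_iter_tau.
rewrite mulr_sumr; apply: ler_sum => s _.
rewrite mulrCA -mulrBr normrM.
apply: (@le_trans _ _ (K * t s * (eps * ((A ^+ j *m one) s 0)%:~R))).
  by apply: ler_pM.
by rewrite le_eqVlt; apply/orP; left; apply/eqP; ring.
Qed.

Let w j := l (iter j alpha h) / lam ^+ j.

Let lj0 j : 0 < lam ^+ j. Proof. exact: exprn_gt0. Qed.

(* A^m one is a combination of basis vectors with total tau-mass lam^m tau h, so
   w (m + j) is an average of the values at stage j of the functional on basis vectors. *)
Let near_cauchy eps : 0 < eps -> \forall j \near \oo, forall m,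
  `|w (m + j)%N - w j| <= eps * K * (T * tau h ^+ 2).
Proof.
move=> eps0.
have ev : \forall j \near \oo, forall s : 'I_k,
  `|l (iter j alpha (e s)) - ratio (delta_mx s 0) * l (iter j alpha h)|
    <= eps * K * (lam ^+ j * tau h).
  by apply: filter_forall => s; apply: functional_approx.
apply: filterS ev => j hj m.
have th : 0 <= tau h by apply: ltW.
pose a s : R := ((A ^+ m *m one) s 0)%:~R.
have a_ge0 s : 0 <= a s by rewrite ler0z.
have ta : \sum_s t s * a s = lam ^+ m * tau h.
  by rewrite -tau0E -(alpha_iterE alphaE) alpha_iter_tau.
have lE : l (iter (m + j) alpha h) = \sum_s l (iter j alpha (e s)) * a s.
  rewrite addnC iterD [iter m alpha h](alpha_iterE alphaE) phi0E.
  have -> : iter j alpha (\sum_s e s *~ (A ^+ m *m one) s 0) =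
      \sum_s iter j alpha (e s) *~ (A ^+ m *m one) s 0.
    rewrite -[LHS]/(iter_additive alpha j _) raddf_sum.
    by apply: eq_bigr => s _; exact: raddfMz.
  have rj s : range (phi 0%N) (iter j alpha (e s)).
    by rewrite (alpha_iterE alphaE); exists (A ^+ j *m delta_mx s 0).
  rewrite (additive_on_sum sR lB) => [|s]; last exact: subgroupMz.
  by apply: eq_bigr => s _; rewrite (additive_onMz sR lB) // mulrzr.
have wE : w j = (\sum_s ratio (delta_mx s 0) * l (iter j alpha h) * a s) / lam ^+ (m + j).
  under eq_bigr do rewrite mulrAC.
  rewrite -mulr_suml /ratio; under eq_bigr do rewrite mulrAC.
  rewrite -mulr_suml ta mulfK ?gt_eqF // exprD.
  by rewrite /w -mulf_div divff ?gt_eqF // mul1r.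
rewrite wE /w lE -mulrBl -sumrB normrM [`|_^-1|]ger0_norm ?invr_ge0 ?(ltW (lj0 _)) //.
rewrite ler_pdivrMr //; apply: le_trans (ler_norm_sum _ _ _) _.
have -> : eps * K * (T * tau h ^+ 2) * lam ^+ (m + j) =
   \sum_s (eps * K * (lam ^+ j * tau h)) * (T * t s * a s).
  rewrite -mulr_sumr; under eq_bigr do rewrite -mulrA.
  by rewrite -mulr_sumr ta exprD; ring.
apply: ler_sum => s _; rewrite -mulrBl normrM (ger0_norm (a_ge0 s)).
have := t_ge0 s; rewrite le_eqVlt => /orP[/eqP ts|ts].
  rewrite -ts mulr0 mul0r mulr0 e0 // iter0 (additive_on0 sR lB).
  by rewrite /ratio -/(e s) e0 // raddf0 !mul0r subrr normr0 mul0r.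
rewrite [T * t s * a s]mulrC [X in _ <= X]mulrA.
apply: (@le_trans _ _ (eps * K * (lam ^+ j * tau h) * a s)).
  by apply: ler_wpM2r => //; apply: hj.
rewrite ler_peMr ?T_ge // mulr_ge0 // !mulr_ge0 //; apply: ltW => //.
Qed.

(** The values at h converge by completeness of the reals; any other x differs from [ratio x] times
    h by an error that is small compared with lam^j. *)
Lemma functional_cvg : exists c, forall x, range (phi 0%N) x ->
  l (iter N alpha x) / lam ^+ N @[N --> \oo] --> c * tau x.
Proof.
have [c hc] : exists c : R, w j @[j --> \oo] --> c.
  apply/cvg_ex; apply: cauchy_cvg; apply: cauchy_exP => eps eps0.
  pose C := K * (T * tau h ^+ 2) + 1.
  have C0 : 0 < C.
    by rewrite ltr_wpDl // !mulr_ge0 ?exprn_ge0 // ltW.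
  have [j _ hj] := near_cauchy (divr_gt0 eps0 C0).
  exists (w j); exists j => // n /= jn; rewrite -ball_normE /= distrC.
  have := hj j (leqnn j) (n - j)%N; rewrite subnK // => le1.
  apply: le_lt_trans le1 _; rewrite -mulrA -[X in _ < X](divfK (lt0r_neq0 C0)).
  by rewrite ltr_pM2l ?divr_gt0 // /C ltrDl.
exists (c / tau h) => _ [x _ <-].
have -> : c / tau h * tau (phi 0%N x) = ratio x * c + 0 by rewrite /ratio addr0; ring.
have -> : (fun N => l (iter N alpha (phi 0%N x)) / lam ^+ N) = (fun N => ratio x * w N +
    (l (iter N alpha (phi 0%N x)) - ratio x * l (iter N alpha h)) / lam ^+ N).
  by apply/funext => N; rewrite /w; ring.
apply: cvgD; first exact: cvgMl_tmp.
apply/cvgrPdist_le => eps eps0.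
have eps1 : 0 < eps / (K * tau h) by rewrite divr_gt0 // mulr_gt0.
apply: filterS (functional_approx x eps1) => j.
rewrite sub0r normrN normrM [`|_^-1|]ger0_norm ?invr_ge0 ?(ltW (lj0 _)) // ler_pdivrMr // => le1.
apply: le_trans le1 _; rewrite le_eqVlt; apply/orP; left; apply/eqP.
by field; rewrite !gt_eqF.
Qed.

End Functional.

Lemma range_perron_cvg : perron_cvg alpha tau lam (range (phi 0%N)).
Proof. by move=> l lB; apply: functional_cvg. Qed.
End Growth.

(** * The state of a simple stationary group *)

Section State.
Variables (R : realType) (V : zmodType) (k : nat) (A : 'M[int]_k).
Variable phi : nat -> {additive 'cV[int]_k -> V}.
Hypotheses (pr : presentation [set: V] A phi) (A0 : nonneg_mx A).
Hypothesis simple : simple_ordered [set: V] (pres_cone phi).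
Hypothesis directed : forall v : V, exists y z, [/\ pres_cone phi y, pres_cone phi z & v = y - z].

Let one : 'cV[int]_k := const_mx 1.
Let g i : 'cV[int]_k := A ^+ i *m one.
Let h := phi 0%N one.
Let e l := phi 0%N (delta_mx l 0).

Let g_ge0 i s : 0 <= g i s 0.
Proof. by apply: nonneg_mul; [exact: nonneg_expr | move=> s'; rewrite mxE]. Qed.

Let gE i : phi i (g i) = h.
Proof. by have := pres_iter pr 0 i one; rewrite addn0. Qed.

Let cone_mem i (x : 'cV[int]_k) : (forall s, 0 <= x s 0) -> pres_cone phi (phi i x).
Proof. by move=> hx; exists i, x. Qed.

Let phi_sum x : phi 0%N x = \sum_l e l *~ x l 0.
Proof. exact: additive_cV. Qed.

Let e_neq0 : exists l, e l <> 0.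
Proof.
apply: contrapT => /forallNP e0; have [[v _ v0] _] := simple; apply: v0.
have e0' l : e l = 0 by apply: contrapT; apply: e0.
have [i [x ->]] := stage_repr pr v.
suff [j hj] : exists j, A ^+ j *m x = 0 by rewrite -(pres_iter pr i j) hj raddf0.
by apply: (pres_ker pr (i := 0%N)); rewrite phi_sum big1 // => l _; rewrite e0' mul0rz.
Qed.

Let h_neq0 : h <> 0.
Proof.
have [l el] := e_neq0 => h0; apply: el.
have /(pres_ker pr)[j hj] : phi 0%N one = 0 by [].
rewrite /e -(pres_iter pr 0 j).
suff -> : A ^+ j *m delta_mx l (0 : 'I_1) = 0 by rewrite raddf0.
apply/colP => s; rewrite -colE !mxE; apply/eqP.
have := congr1 (fun x : 'cV[int]_k => x s 0) hj; rewrite !mxE => /eqP.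
rewrite psumr_eq0 => [|i _]; last by rewrite mxE mulr1; apply: nonneg_expr.
by move=> /allP/(_ l (mem_index_enum _)); rewrite mxE mulr1.
Qed.

(* [low a v] means a h <= v; as a is real, the comparison is made coordinatewise at some stage. *)
Let low (a : R) (v : V) := exists i (x : 'cV[int]_k),
  v = phi i x /\ forall s, a * (g i s 0)%:~R <= (x s 0)%:~R.

Let raise (a : R) i j (x : 'cV[int]_k) : (forall s, a * (g i s 0)%:~R <= (x s 0)%:~R) ->
  forall s, a * (g (j + i) s 0)%:~R <= ((A ^+ j *m x) s 0)%:~R.
Proof.
move=> hx s; rewrite /g exprD_mulmx -/(g i) !mxE !rmorph_sum /= mulr_sumr.
apply: ler_sum => l _; rewrite !rmorphM /= mulrCA ler_wpM2l ?ler0z //.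
exact: nonneg_expr.
Qed.

Let low_common a v b w : low a v -> low b w -> exists i x y,
  [/\ v = phi i x, w = phi i y, forall s, a * (g i s 0)%:~R <= (x s 0)%:~R &
      forall s, b * (g i s 0)%:~R <= (y s 0)%:~R].
Proof.
move=> [i [x [-> hx]]] [j [y [-> hy]]].
exists (i + j)%N, (A ^+ j *m x), (A ^+ i *m y); split.
- by rewrite addnC (pres_iter pr).
- by rewrite (pres_iter pr).
- by move=> s; rewrite addnC; apply: raise.
- by move=> s; apply: raise.
Qed.

Let low_pair a b v : low a v -> low (- b) (- v) -> exists i x, v = phi i x /\
  forall s, a * (g i s 0)%:~R <= (x s 0)%:~R <= b * (g i s 0)%:~R.
Proof.
move=> la lb; have [i [x [y [vE vNE hx hy]]]] := low_common la lb.
have /(pres_ker pr)[j] : phi i (x + y) = 0 by rewrite raddfD -vE -vNE subrr.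
rewrite mulmxDr => xy; exists (j + i)%N, (A ^+ j *m x); split; first by rewrite (pres_iter pr).
move=> s; rewrite (raise j hx) /=; have := raise j hy s.
have : A ^+ j *m y = - (A ^+ j *m x) by apply/eqP; rewrite -addr_eq0 addrC xy.
by move=> ->; rewrite mulNr [(- (A ^+ j *m x)) s 0]mxE rmorphN lerN2.
Qed.

Let low_le a b v : low a v -> low (- b) (- v) -> a <= b.
Proof.
move=> la lb; have [i [x [vE hx]]] := low_pair la lb.
have [s gs] : exists s, 0 < g i s 0.
  apply: contrapT => /forallNP g0; apply: h_neq0; rewrite -(gE i).
  suff -> : g i = 0 by rewrite raddf0.
  apply/colP => s; rewrite [RHS]mxE; apply/eqP; rewrite eq_le g_ge0 andbT leNgt.
  exact/negP/g0.
have /andP[h1 h2] := hx s.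
by have := le_trans h1 h2; rewrite ler_pM2r // ltr0z.
Qed.

Let lowD a v b w : low a v -> low b w -> low (a + b) (v + w).
Proof.
move=> la lb; have [i [x [y [-> -> hx hy]]]] := low_common la lb.
exists i, (x + y); split; first by rewrite raddfD.
by move=> s; rewrite [(x + y) s 0]mxE rmorphD mulrDl lerD.
Qed.

Let low_mono a b v : b <= a -> low a v -> low b v.
Proof.
move=> ba [i [x [-> hx]]]; exists i, x; split=> // s.
by apply: le_trans (hx s); rewrite ler_wpM2r // ler0z.
Qed.

Let low0 v : low 0 v <-> pres_cone phi v.
Proof.
by split=> -[i [x []]] => [-> hx|hx ->]; exists i, x; split=> // s;
  have := hx s; rewrite mul0r ler0z.
Qed.

Let low_h (m : int) : low m%:~R (h *~ m).
Proof.
exists 0%N, (m *: one); split; first by rewrite -[X in X *: _]intz scaler_int raddfMz.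
by move=> s; rewrite /g expr0_mulmx !mxE !mulr1.
Qed.

(** Simplicity gives e l' <= n e l as soon as e l is non-zero, and at a late stage this compares two
    columns of A^j. Finitely many pairs share one j, at which the basis vectors vanishing in G have
    become zero columns. *)
Let harnack : exists j C, [/\ 1 <= C :> R,
  forall l l' s, e l <> 0 -> ((A ^+ j) s l')%:~R <= C * ((A ^+ j) s l)%:~R &
  forall l s, e l = 0 -> (A ^+ j) s l = 0].
Proof.
have [c hc] : {c : 'I_k * 'I_k -> nat & forall ll, e ll.1 <> 0 ->
    \forall j \near \oo, forall s, (A ^+ j) s ll.2 <= (A ^+ j) s ll.1 *+ c ll}.
  apply: (@choice _ _ (fun ll n => e ll.1 <> 0 ->
    \forall j \near \oo, forall s, (A ^+ j) s ll.2 <= (A ^+ j) s ll.1 *+ n)) => -[l l'] /=.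
  have [el|nel] := pselect (e l <> 0); last by exists 0%N.
  have ce l0 : pres_cone phi (e l0) by apply: cone_mem => s; rewrite mxE ler0n.
  have [n] := simple.2 _ _ (ce l) (ce l') el.
  rewrite -raddfMn -raddfB => /(pres_cone_stage pr A0)[j0 hj0].
  exists n => _; exists j0 => // j /hj0 hj s.
  have := hj s; rewrite mulmxBr (raddfMn (mulmx _)) /= -!colE.
  by rewrite !mxE mulmxnE mxE subr_ge0.
have ev1 : \forall j \near \oo, forall ll : 'I_k * 'I_k, e ll.1 <> 0 ->
    forall s, (A ^+ j) s ll.2 <= (A ^+ j) s ll.1 *+ c ll.
  apply: filter_forall => ll; have [ell|nell] := pselect (e ll.1 <> 0).
    by apply: filterS (hc ll ell).
  by apply: nearW.
have ev2 : \forall j \near \oo, forall l, e l = 0 -> forall s, (A ^+ j) s l = 0.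
  apply: filter_forall => l; have [el|nel] := pselect (e l = 0); last exact: nearW.
  have [j0 hj0] := pres_ker pr el; exists j0 => // j /= hj _ s.
  have : A ^+ j *m delta_mx l (0 : 'I_1) = 0.
    by rewrite -(subnK hj) exprD_mulmx hj0 mulmx0.
  by rewrite -colE => /colP/(_ s); rewrite !mxE.
have [j [h1 h2]] := filter_ex (filterI ev1 ev2).
exists j, (1 + \sum_ll (c ll)%:R); split=> [|l l' s el|l s el]; last exact: h2.
  by rewrite lerDl sumr_ge0.
have := h1 (l, l') el s; rewrite -(ler_int R) rmorphMn /= => le1.
apply: le_trans le1 _; rewrite -mulr_natl ler_wpM2r ?ler0z //; first exact: nonneg_expr.
rewrite (bigD1 (l, l')) //= addrCA lerDl addr_ge0 // sumr_ge0 //.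
Qed.

(* If a g <= x <= b g, one of x - a g and b g - x carries half of the mass of (b - a) g, and
   by the Harnack inequality this mass spreads evenly over all coordinates. *)
Let contraction : exists2 theta : R, 0 <= theta < 1 & forall v a b,
  low a v -> low (- b) (- v) -> exists a' b',
    [/\ low a' v, low (- b') (- v) & b' - a' = theta * (b - a)].
Proof.
have [j [C [C1 hC hC0]]] := harnack; have [l0 el0] := e_neq0.
have C0 : 0 < C by apply: lt_le_trans C1.
(* The 2 comes from having half of the mass. Each C is one comparison with the fixed column l0: one
   bounds the image of g from above, the other bounds the image of the difference from below. *)
pose del := (2 * C ^+ 2)^-1.
have C2 : 1 <= C ^+ 2 by rewrite expr_ge1 // ltW.
have del0 : 0 < del by rewrite invr_gt0 mulr_gt0 // exprn_gt0.
have del1 : del <= 1 by rewrite invf_le1 ?mulr_gt0 ?exprn_gt0 //; lra.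
pose Asl s l : R := ((A ^+ j) s l)%:~R.
have Asl0 s l : 0 <= Asl s l by rewrite ler0z; apply: nonneg_expr.
pose T l := `[< e l <> 0 >].
have AslT (z : 'I_k -> R) s : \sum_l Asl s l * z l = \sum_(l | T l) Asl s l * z l.
  rewrite [LHS](bigID T) /= [X in _ + X]big1 ?addr0 // => l /asboolPn/contrapT el.
  by rewrite /Asl hC0 ?mul0r.
have step (z y : 'I_k -> R) c : 0 <= c -> (forall l, 0 <= z l) -> (forall l, 0 <= y l) ->
    c / 2 * \sum_(l | T l) y l <= \sum_(l | T l) z l ->
    forall s, del * c * \sum_l Asl s l * y l <= \sum_l Asl s l * z l.
  move=> c0 z0 y0 yz s; rewrite !AslT.
  have up : \sum_(l | T l) Asl s l * y l <= C * Asl s l0 * \sum_(l | T l) y l.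
    rewrite mulr_sumr; apply: ler_sum => l _; apply: ler_wpM2r => //; exact: hC.
  have down : Asl s l0 / C * \sum_(l | T l) z l <= \sum_(l | T l) Asl s l * z l.
    rewrite mulr_sumr; apply: ler_sum => l /asboolP el; apply: ler_wpM2r => //.
    by rewrite ler_pdivrMr // mulrC; apply: hC.
  apply: le_trans down; apply: (@le_trans _ _ (Asl s l0 / C * (c / 2 * \sum_(l | T l) y l))).
    apply: le_trans (ler_wpM2l _ up) _; first by rewrite mulr_ge0 // ltW.
    rewrite le_eqVlt; apply/orP; left; apply/eqP; rewrite /del.
    by move: (Asl s l0) (\sum_(l | T l) y l) => p q; field; rewrite gt_eqF.
  by apply: ler_wpM2l => //; rewrite divr_ge0 // ltW.
exists (1 - del); first by rewrite subr_ge0 del1 ltrBlDl ltrDr.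
move=> v a b la lb; have ab := low_le la lb.
have [i [x [vE hx]]] := low_pair la lb.
pose G l : R := (g i l 0)%:~R; pose X l : R := (x l 0)%:~R.
have G0 l : 0 <= G l by rewrite ler0z.
have mulE (z : 'cV[int]_k) s : ((A ^+ j *m z) s 0)%:~R = \sum_l Asl s l * (z l 0)%:~R.
  by rewrite mxE rmorph_sum; apply: eq_bigr => l _; rewrite rmorphM.
have z0 l : 0 <= X l - a * G l by rewrite subr_ge0; case/andP: (hx l).
have z0' l : 0 <= b * G l - X l by rewrite subr_ge0; case/andP: (hx l).
have c0 : 0 <= b - a by rewrite subr_ge0.
have [le1|gt1] := leP ((b - a) / 2 * \sum_(l | T l) G l) (\sum_(l | T l) (X l - a * G l)).
  exists (a + del * (b - a)), b; split=> //; last by ring.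
  exists (j + i)%N, (A ^+ j *m x); split; first by rewrite (pres_iter pr).
  move=> s; have := step _ _ _ c0 z0 G0 le1 s.
  rewrite /g exprD_mulmx -/(g i) !mulE; under [X in _ <= X -> _]eq_bigr do rewrite mulrBr mulrCA.
  rewrite sumrB -mulr_sumr -/G -/X mulrDl.
  by move: (\sum_l _) (\sum_l _) => p q; lra.
exists a, (b - del * (b - a)); split=> //; last by ring.
exists (j + i)%N, (A ^+ j *m - x); split; first by rewrite (pres_iter pr) raddfN vE.
have le2 : (b - a) / 2 * \sum_(l | T l) G l <= \sum_(l | T l) (b * G l - X l).
  move: gt1; rewrite !sumrB -!mulr_sumr mulrAC mulrBl.
  by move: (\sum_(l | T l) _) (\sum_(l | T l) _) => p q; lra.
move=> s; have := step _ _ _ c0 z0' G0 le2 s.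
rewrite mulmxN [(- (A ^+ j *m x)) s 0]mxE rmorphN /=.
rewrite /g exprD_mulmx -/(g i) !mulE; under [X in _ <= X -> _]eq_bigr do rewrite mulrBr mulrCA.
rewrite sumrB -mulr_sumr -/G -/X mulNr mulrBl.
by move: (\sum_l _) (\sum_l _) => p q; lra.
Qed.

(** By simplicity h is an order unit. *)
Let bounded v : exists a b, low a v /\ low (- b) (- v).
Proof.
have half y : pres_cone phi y -> exists n : nat, low (- n%:R) (- y).
  move=> Py; have Ph : pres_cone phi h by apply: cone_mem => s; rewrite mxE.
  have [n /low0 Pn] := simple.2 _ _ Ph Py h_neq0; exists n.
  have := lowD (low_h (- n%:Z)) Pn; rewrite addr0 [h *~ _]mulrNz -[h *~ _]pmulrn addrA addNr sub0r.
  by rewrite rmorphN.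
have [y [z [Py Pz ->]]] := directed v.
have [[n ny] [m mz]] := (half y Py, half z Pz).
exists (- m%:R), n%:R; split.
  by move/low0 in Py; have := lowD Py mz; rewrite add0r.
by move/low0 in Pz; have := lowD Pz ny; rewrite add0r opprB.
Qed.

Let squeeze v eps : 0 < eps -> exists a b, [/\ low a v, low (- b) (- v) & b - a < eps].
Proof.
move=> eps0; have [theta /andP[th0 th1] step] := contraction.
have [a [b [la lb]]] := bounded v.
have it N : exists a' b', [/\ low a' v, low (- b') (- v) & b' - a' = theta ^+ N * (b - a)].
  elim: N => [|N [a' [b' [la' lb' e']]]]; first by exists a, b; rewrite expr0 mul1r.
  have [a2 [b2 [la2 lb2 e2]]] := step v a' b' la' lb'.
  by exists a2, b2; split=> //; rewrite e2 e' exprS mulrA.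
have : theta ^+ N * (b - a) @[N --> \oo] --> 0 * (b - a).
  by apply: cvgMr_tmp; apply: cvg_expr; rewrite ger0_norm.
rewrite mul0r => /cvgr_lt/(_ _ eps0) [N _ /(_ N (leqnn N)) hN].
by have [a' [b' [la' lb' e']]] := it N; exists a', b'; rewrite e'.
Qed.

Let state v : R := sup [set a | low a v].

Let has_sup_low v : has_sup [set a | low a v].
Proof.
have [a [b [la lb]]] := bounded v; split; first by exists a.
by exists b => c lc; apply: low_le lc lb.
Qed.

Let low_state a v : a < state v -> low a v.
Proof.
move=> av; have [b lb ab] := sup_gt (has_sup_low v).1 av.
exact: low_mono (ltW ab) lb.
Qed.

Let state_ge a v : low a v -> a <= state v.
Proof. by move=> la; apply: ub_le_sup => //; case: (has_sup_low v). Qed.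

Let state_le b v : low (- b) (- v) -> state v <= b.
Proof. by move=> lb; apply: ge_sup => [|a la]; [case: (has_sup_low v) | apply: low_le la lb]. Qed.

(** [squeeze] leaves no gap between lower and upper bounds, so the supremum of the former is the
    infimum of the latter. Lower bounds alone give superadditivity; this gives the other half. *)
Let upper_state b v : state v < b -> low (- b) (- v).
Proof.
move=> vb; have : 0 < b - state v by rewrite subr_gt0.
move=> /(squeeze v)[a [c [la lc ac]]].
apply: low_mono lc; rewrite lerN2; have := state_ge la.
by move: ac; lra.
Qed.

Let stateD v w : state (v + w) = state v + state w.
Proof.
apply/eqP; rewrite eq_le; apply/andP; split; apply/ler_addgt0Pr => eps eps0.
  have e2 : 0 < eps / 2 by rewrite divr_gt0.
  have hv : state v < state v + eps / 2 by rewrite ltrDl.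
  have hw : state w < state w + eps / 2 by rewrite ltrDl.
  have := lowD (upper_state hv) (upper_state hw); rewrite -!opprD => /state_le.
  by move=> le1; apply: le_trans le1 _; lra.
have e2 : 0 < eps / 2 by rewrite divr_gt0.
have hv : state v - eps / 2 < state v by rewrite gtrDl oppr_lt0.
have hw : state w - eps / 2 < state w by rewrite gtrDl oppr_lt0.
have := state_ge (lowD (low_state hv) (low_state hw)).
by lra.
Qed.

Let stateB v w : state (v - w) = state v - state w.
Proof. by apply/eqP; rewrite eq_sym subr_eq -stateD subrK. Qed.

(** The state is normalised at h. It is strictly positive on a non-zero v of the cone because h <= n
    v for some n, by simplicity again. *)
Lemma simple_state : exists tau : {additive V -> R},
  (exists v, tau v != 0) /\ forall v, pres_cone phi v <-> (0 < tau v \/ v = 0).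
Proof.
exists (mkadd stateB) => /=.
have h1 : state h = 1.
  apply/eqP; rewrite eq_le; apply/andP; split.
    by apply: state_le; have := low_h (- 1); rewrite !mulrN1z.
  by apply: state_ge; have := low_h 1; rewrite !mulr1z.
split; first by exists h; rewrite h1 oner_eq0.
move=> v; split=> [Pv|[v0|->]]; last first.
- by apply/low0; exists 0%N, 0; rewrite raddf0; split=> // s; rewrite mul0r mxE.
- by apply/low0; apply: low_state.
have [->|/eqP v0] := eqVneq v 0; first by right.
left; have Ph : pres_cone phi h by apply: cone_mem => s; rewrite mxE.
have [n /low0/state_ge] := simple.2 _ _ Pv Ph v0.
rewrite stateB h1 subr_ge0 => le1.
have nE : state (v *+ n) = state v *+ n by have := raddfMn (mkadd stateB) n v.
rewrite ltNge; apply/negP => v_le0.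
have := le_trans le1 (eq_ind_r (fun x => x <= 0) (mulrn_wle0 n v_le0) nE).
by rewrite ler10.
Qed.

End State.

(** * From generating data to stationary groups *)

Section Product.
Variables (R : realType) (U W : zmodType) (k m : nat) (A : 'M[int]_k) (C : 'M[int]_m).
Variables (phi : nat -> {additive 'cV[int]_k -> U}) (psi : nat -> {additive 'cV[int]_m -> W}).
Hypotheses (prU : presentation [set: U] A phi) (prW : presentation [set: W] C psi).
Variables (alpha beta : {additive U -> U}) (gamma delta : {additive W -> W}).
Hypotheses (alphaK : cancel alpha beta) (betaK : cancel beta alpha).
Hypotheses (gammaK : cancel gamma delta) (deltaK : cancel delta gamma).
Hypothesis alphaE : forall i x, alpha (phi i x) = phi i (A *m x).
Hypothesis gammaE : forall i x, gamma (psi i x) = psi i (C *m x).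
Variables (tau : {additive U -> R}) (lam : R).
Hypotheses (lam1 : 1 < lam) (tau_alpha : forall v, tau (alpha v) = lam * tau v).
Hypotheses (Ucvg : perron_cvg alpha tau lam (range (phi 0%N))) (tau0 : exists v, tau v != 0).
Variables (M : int) (D : set (U * W)%type).
Hypotheses (M0 : M != 0) (sD : subgroup D) (DM : forall v, D (v *~ M)).

Let pairB (a c : U) (b d : W) : (a, b) - (c, d) = (a - c, b - d).
Proof. by []. Qed.

Let pairD (a c : U) (b d : W) : (a, b) + (c, d) = (a + c, b + d).
Proof. by []. Qed.

(** The entrywise l1 norm, which bounds the operator norm of [C] on vectors with the l1 norm. *)
Let growth := \sum_i \sum_j `|(C i j)%:~R : R|.

Let growth_ge0 : 0 <= growth.
Proof. by apply: sumr_ge0 => i _; apply: sumr_ge0. Qed.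

Let growth_expr n (y : 'cV[int]_m) :
  \sum_i `|((C ^+ n *m y) i 0)%:~R : R| <= growth ^+ n * \sum_i `|(y i 0)%:~R|.
Proof.
elim: n => [|n IH]; first by rewrite expr0_mulmx expr0 mul1r.
rewrite exprS_mulmx exprS -mulrA; apply: le_trans (ler_wpM2l growth_ge0 IH).
rewrite /growth mulr_suml; apply: ler_sum => i _.
rewrite mxE rmorph_sum /= mulr_suml; apply: le_trans (ler_norm_sum _ _ _) _.
apply: ler_sum => j _; rewrite rmorphM normrM /= ler_wpM2l //.
by rewrite [X in _ <= X](bigD1 j) //= lerDl sumr_ge0.
Qed.

Let exp_gt (B : R) : exists2 t, (0 < t)%N & B < lam ^+ t.
Proof.
have l0 t : 0 < lam ^+ t by rewrite exprn_gt0 // (lt_trans _ lam1).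
have B1 : 0 < `|B| + 1 by rewrite ltr_wpDl.
have Bi : 0 < (`|B| + 1)^-1 by rewrite invr_gt0.
have [t [t0 ht]] := filter_ex (filterI (nbhs_infty_ge 1) (cvgr_lt _ (cvg_inv_exp lam1) _ Bi)).
exists t => //; move: ht; rewrite /= ltf_pV2 ?posrE // => lt1.
by apply: le_lt_trans (lt_trans _ lt1); [exact: ler_norm | rewrite ltrDl].
Qed.

Let LU := range (phi 0%N).
Let LW := range (psi 0%N).

Let sLU : subgroup LU. Proof. exact: range_subgroup. Qed.

Let sLW : subgroup LW. Proof. exact: range_subgroup. Qed.

Let slow (l : W -> R) (mu : R) q y : additive_on LW l -> growth ^+ q < mu -> LW y ->
  l (iter (N * q) gamma y) / mu ^+ N @[N --> \oo] --> (0 : R).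
Proof.
move=> lB qmu [x _ <-].
pose B := \sum_s `|l (psi 0%N (delta_mx s 0))|; pose Y := \sum_i `|(x i 0)%:~R : R|.
have gq0 : 0 <= growth ^+ q by apply: exprn_ge0.
have mu0 : 0 < mu by apply: le_lt_trans qmu.
have B0 : 0 <= B by apply: sumr_ge0.
have z0 : B * Y * (growth ^+ q / mu) ^+ N @[N --> \oo] --> (0 : R).
  rewrite -[X in _ --> X](mulr0 (B * Y)); apply: cvgMl_tmp; apply: cvg_expr.
  by rewrite ger0_norm ?divr_ge0 ?(ltW mu0) // ltr_pdivrMr // mul1r.
apply/cvgrPdist_le => eps eps0; move/cvgrPdist_le: z0 => /(_ _ eps0).
apply: filterS => N; rewrite !sub0r !normrN; apply: le_trans.
rewrite (ger0_norm (_ : 0 <= B * Y * _)); last first.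
  by rewrite !mulr_ge0 ?sumr_ge0 // exprn_ge0 // divr_ge0 // ltW.
rewrite normrM normfV (ger0_norm (exprn_ge0 _ (ltW mu0))) expr_div_n mulrA.
rewrite ler_wpM2r ?invr_ge0 ?exprn_ge0 ?(ltW mu0) //.
rewrite (alpha_iterE gammaE).
have Lp s : LW (psi 0%N (delta_mx s 0)) by exists (delta_mx s 0).
rewrite additive_cV (additive_on_sum sLW lB) => [|s]; last exact: subgroupMz.
apply: le_trans (ler_norm_sum _ _ _) _.
have e : growth ^+ q ^+ N = growth ^+ (N * q) by rewrite -exprM mulnC.
rewrite -mulrA e; apply: le_trans (ler_wpM2l B0 (_ : _ <= Y * growth ^+ (N * q))); last first.
  by rewrite mulrC; apply: growth_expr.
rewrite /B mulr_suml; apply: ler_sum => s _.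
rewrite (additive_onMz sLW lB) // -mulrzr normrM ler_wpM2l //.
by rewrite [X in _ <= X](bigD1 s) //= lerDl sumr_ge0.
Qed.

(* gamma^q grows at most like growth^q, so (alpha^p, gamma^q) has dominant eigenvalue lam^p
   once p is large compared to q. *)
Lemma product_stationary_ordered :
  stationary_ordered_group D ([set v | D v /\ 0 < tau v.1] `|` [set 0]).
Proof.
have [n1 n1_gt0 per1] := alpha_period prU alphaE M0.
have [q q_gt0 per2] := alpha_period prW gammaE M0.
(* The exponent on [U] has to stay a multiple of the period n1; t is the freedom left to make it
   large. *)
have [t t_gt0 ht] := exp_gt (growth ^+ q).
pose p := (n1 * t)%N; have p_gt0 : (0 < p)%N by rewrite muln_gt0 n1_gt0.
have lamp : growth ^+ q < lam ^+ p.
  apply: lt_le_trans ht _; rewrite /p mulnC exprM; apply: ler_eXnr => //.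
  by rewrite exprn_ege1 // ltW.
have fB : forall x y : (U * W)%type, (iter p alpha (x - y).1, iter q gamma (x - y).2) =
    (iter p alpha x.1, iter q gamma x.2) - (iter p alpha y.1, iter q gamma y.2).
  by move=> x y; rewrite [(x - y).1]/(x.1 - y.1) [(x - y).2]/(x.2 - y.2) !iterB.
have gB : forall x y : (U * W)%type, (iter p beta (x - y).1, iter q delta (x - y).2) =
    (iter p beta x.1, iter q delta x.2) - (iter p beta y.1, iter q delta y.2).
  by move=> x y; rewrite [(x - y).1]/(x.1 - y.1) [(x - y).2]/(x.2 - y.2) !iterB.
pose f : {additive (U * W)%type -> (U * W)%type} := mkadd fB.
pose g : {additive (U * W)%type -> (U * W)%type} := mkadd gB.
have fK : cancel f g by move=> [x y]; rewrite /f /g /= (iter_cancel _ alphaK) (iter_cancel _ gammaK).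
have gK : cancel g f by move=> [x y]; rewrite /f /g /= (iter_cancel _ betaK) (iter_cancel _ deltaK).
have fiter N v : iter N f v = (iter (N * p) alpha v.1, iter (N * q) gamma v.2).
  by elim: N => [|N IH]; [case: v | rewrite /= IH /= !mulSn !iterD].
have f1 v : exists w, f v - v = w *~ M.
  have [w1 e1] := per1 t v.1; have [w2 e2] := per2 1%N v.2; rewrite muln1 in e2.
  exists (w1, w2); have -> : (w1, w2) *~ M = (w1 *~ M, w2 *~ M).
    by rewrite [LHS]surjective_pairing (raddfMz fst) (raddfMz snd).
  by rewrite -e1 -e2.
(* [f] is the identity modulo multiples of M, all of which lie in [D]; hence [f] and its inverse
   both preserve [D]. *)
have Df v : D v -> D (f v).
  move=> Dv; have [w e] := f1 v; rewrite -(subrK v (f v)) e.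
  by apply: subgroupD => //; apply: DM.
have Dg v : D v -> D (g v).
  move=> Dv; have [w e] := f1 (g v); have [_ DB] := sD.
  rewrite gK in e; rewrite (_ : g v = v - w *~ M); last by rewrite -e opprB addrC subrK.
  by apply: (DB) => //; apply: DM.
pose L := [set v | [/\ D v, LU v.1 & LW v.2]].
have iterLU j u : LU u -> LU (iter j alpha u) by move=> Lu; elim: j => //= j; apply: alpha_range.
have iterLW j u : LW u -> LW (iter j gamma u) by move=> Lu; elim: j => //= j; apply: alpha_range.
have fL v : L v -> L (f v).
  by move=> [Dv Lv1 Lv2]; split; [exact: Df | exact: iterLU | exact: iterLW].
have [m1 [b1 [_ hb1]]] := range_basis prU; have [m2 [b2 [_ hb2]]] := range_basis prW.
have [d1 [d1B _ d1K]] := basis_coord hb1; have [d2 [d2B _ d2K]] := basis_coord hb2.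
have sL : subgroup L.
  split; first by split; [case: sD | case: sLU | case: sLW].
  move=> v w [Dv v1 v2] [Dw w1 w2].
  by split; [case: sD => _; apply | case: sLU => _; apply | case: sLW => _; apply].
have [n [b [_ hb]]] : exists n (b : 'I_n -> (U * W)%type), (n <= m1 + m2)%N /\ basis L b.
  apply: (@sublattice_basis _ _ _ (fun v => col_mx (d1 v.1) (d2 v.2))) => // [v w Lv Lw|v Lv].
    have [[_ v1 v2] [_ w1 w2]] := (Lv, Lw).
    by rewrite [(v - w).1]/(v.1 - w.1) [(v - w).2]/(v.2 - w.2) d1B // d2B // opp_col_mx add_col_mx.
  move=> /eqP; rewrite col_mx_eq0 => /andP[/eqP e1 /eqP e2]; have [_ v1 v2] := Lv.
  by rewrite [v]surjective_pairing -(d1K _ v1) -(d2K _ v2) e1 e2 !raddf0.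
have LD v : D v <-> exists j, L (iter j f v).
  split=> [Dv|[j [Dj _ _]]].
    have [j1 h1] := range_dilation prU alphaE v.1; have [j2 h2] := range_dilation prW gammaE v.2.
    exists (j1 + j2)%N; split; first by elim: (j1 + j2)%N => //= j; apply: Df.
      rewrite fiter /= (_ : (_ * p)%N = ((j1 + j2) * p - j1 + j1)%N); last first.
        by rewrite subnK // (leq_trans (leq_addr j2 j1)) // leq_pmulr.
      by rewrite iterD; apply: iterLU.
    rewrite fiter /= (_ : (_ * q)%N = ((j1 + j2) * q - j2 + j2)%N); last first.
      by rewrite subnK // (leq_trans (leq_addl j1 j2)) // leq_pmulr.
    by rewrite iterD; apply: iterLW.
  rewrite -(iter_cancel j fK v); move: (iter j f v) Dj => w Dw.
  by elim: j => //= j; apply: Dg.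
have tauB (x y : U * W) : tau (x - y).1 = tau x.1 - tau y.1 by rewrite -raddfB.
pose tau1 : {additive (U * W)%type -> R} := mkadd tauB.
have mu1 : 1 < lam ^+ p by rewrite exprn_egt1 // -lt0n.
have tau_f v : tau1 (f v) = lam ^+ p * tau1 v by rewrite /tau1 /f /= (tau_iter tau_alpha).
have MR0 : (M%:~R : R) != 0 by rewrite intr_eq0.
have Lcvg : perron_cvg f tau1 (lam ^+ p) L.
  move=> l lB.
  (* [L] need not be a product of lattices, but M times each component lies in it; so M l is the sum
     of a functional on [LU] and one on [LW]. *)
  have LUM u : LU u -> L ((u, 0) *~ M).
    move=> Lu; split; first exact: DM.
      by rewrite (raddfMz fst); apply: subgroupMz.
    by rewrite (raddfMz snd) /= mul0rz; case: sLW.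
  have LWM u : LW u -> L ((0, u) *~ M).
    move=> Lu; split; first exact: DM.
      by rewrite (raddfMz fst) /= mul0rz; case: sLU.
    by rewrite (raddfMz snd); apply: subgroupMz.
  have l1B : additive_on LU (fun u => l ((u, 0) *~ M)).
    move=> u u' Lu Lu'; rewrite -lB; try exact: LUM.
    by rewrite -mulrzBl; rewrite pairB subr0.
  have l2B : additive_on LW (fun u => l ((0, u) *~ M)).
    move=> u u' Lu Lu'; rewrite -lB; try exact: LWM.
    by rewrite -mulrzBl; rewrite pairB subr0.
  have [c hc] := Ucvg l1B; exists (c / M%:~R) => v [Dv v1 v2].
  have h1 : l ((iter (N * p) alpha v.1, 0) *~ M) / (lam ^+ p) ^+ N @[N --> \oo] --> c * tau v.1.
    have sub : (fun N => (N * p)%N) @ \oo --> \oo.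
      apply/cvgnyPge => B; near=> N; apply: leq_trans (leq_pmulr N p_gt0).
      by near: N; exact: nbhs_infty_ge.
    have := @cvg_comp _ _ _ (fun N => (N * p)%N)
      (fun N => l ((iter N alpha v.1, 0) *~ M) / lam ^+ N) _ _ _ sub (hc _ v1); apply: cvg_trans; apply: near_eq_cvg; apply: nearW => N /=.
    by rewrite -exprM mulnC.
  have h2 := slow (q := q) l2B lamp v2.
  have -> : c / M%:~R * tau1 v = (M%:~R)^-1 * (c * tau v.1 + 0).
    by rewrite addr0 /tau1 /= mulrAC mulrC.
  have -> : (fun N => l (iter N f v) / (lam ^+ p) ^+ N) = (fun N => (M%:~R)^-1 *
      (l ((iter (N * p) alpha v.1, 0) *~ M) / (lam ^+ p) ^+ N +
       l ((0, iter (N * q) gamma v.2) *~ M) / (lam ^+ p) ^+ N)).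
    apply/funext => N; have LN : L (iter N f v).
      by have Lv : L v by []; elim: N => //= N; apply: fL.
    rewrite -mulrDl -(additive_onD sL lB); [|exact/LUM/iterLU|exact/LWM/iterLW].
    rewrite -mulrzDl mulrA; congr (_ / _).
    have -> : (iter (N * p) alpha v.1, 0) + (0, iter (N * q) gamma v.2) = iter N f v.
      by rewrite fiter pairD addr0 add0r.
    by rewrite (additive_onMz sL lB) // -[l _ *~ M]mulrzr mulrC mulfK.
  by apply: cvgMl_tmp; apply: cvgD.
apply: (dilation_stationary_ordered fK gK hb fL LD mu1 tau_f Lcvg).
have [u u0] := tau0; have /LD[j Lj] := DM (u, 0).
exists (iter j f ((u, 0) *~ M)) => //.
have mu0 : lam ^+ p != 0 by rewrite gt_eqF // (lt_trans _ mu1).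
have tM : tau1 ((u, 0) *~ M) = tau u * M%:~R by rewrite raddfMz mulrzr.
by rewrite (tau_iter tau_f) tM !mulf_neq0 // expf_neq0.
Unshelve. all: by end_near.
Qed.

End Product.

Section PerronData.
Variables (R : realType) (V : zmodType) (k : nat) (A : 'M[int]_k).
Variables (phi : nat -> {additive 'cV[int]_k -> V}) (tau : {additive V -> R}).
Hypotheses (pr : presentation [set: V] A phi) (A0 : nonneg_mx A).
Hypothesis coneE : forall v, pres_cone phi v <-> (0 < tau v \/ v = 0).
Hypotheses (tau_neq0 : exists v, tau v != 0) (ncyc : ~ cyclic_group [set: V]).

Lemma perron_data : exists (alpha beta : {additive V -> V}) (lam : R),
  [/\ cancel alpha beta /\ cancel beta alpha,
      forall i x, alpha (phi i x) = phi i (A *m x),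
      1 < lam,
      forall v, tau (alpha v) = lam * tau v &
      perron_cvg alpha tau lam (range (phi 0%N))].
Proof.
have [alpha [beta [alphaK betaK alphaE betaE]]] := pres_shift_auto pr.
have [lam lam0 tau_alpha] := shift_eigenvalue A0 coneE alphaK alphaE tau_neq0.
exists alpha, beta, lam.
have lam1 := eigenvalue_gt1 pr A0 coneE alphaE tau_neq0 lam0 tau_alpha ncyc.
by split=> //; apply: (range_perron_cvg pr A0 coneE alphaE tau_neq0 lam0 tau_alpha).
Qed.

End PerronData.

Lemma stationary_ordered_iso (V W : zmodType) (D P : set V) (E Q : set W) :
  order_iso D P E Q -> stationary_ordered_group E Q -> stationary_ordered_group D P.
Proof.
move=> DE [k [A [A0 EL]]]; exists k, A; split=> //; exact: order_iso_comp DE EL.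
Qed.

Lemma clear_denoms_seq (V : lmodType rat) (S : set V) (s : seq V) : subgroup S ->
  [set` s] `<=` Qspan S -> exists2 M : int, 0 < M & forall x, x \in s -> S (x *~ M).
Proof.
move=> sS; elim: s => [|x s IH] hs; first by exists 1.
have [M M0 hM] : exists2 M : int, 0 < M & forall y, y \in s -> S (y *~ M).
  by apply: IH => y ys; apply: hs; rewrite /= inE ys orbT.
have [n [c [y [Sy xE]]]] : Qspan S x by apply: hs; rewrite /= inE eqxx.
have [d d0 [w hw]] := clear_denoms c.
(* The denominator d may be negative; its square keeps the multiplier positive, so that
   multiplication by it preserves order. *)
exists (M * (d * d)); first by rewrite mulr_gt0 // -expr2 exprn_even_gt0.
move=> u; rewrite inE => /predU1P[->|us]; last first.
  by rewrite mulrzA; apply: subgroupMz => //; exact: hM.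
have Sxd : S (x *~ d).
  rewrite xE mulrz_suml; apply: subgroup_sum => // i.
  rewrite -scaler_int scalerA mulrC hw scaler_int; exact: subgroupMz.
by rewrite mulrC mulrzA mulrzA; do 2!apply: subgroupMz => //.
Qed.

Section Generated.
Variable V : zmodType.

Lemma generated_subgroup (X : set V) : subgroup (generated X).
Proof.
split=> [S [[S0 _] _] //|x y gx gy S [sS XS]].
have Sx : S x by apply: gx; split.
have Sy : S y by apply: gy; split.
by case: sS => _; apply.
Qed.

Lemma generated_sub (X : set V) : X `<=` generated X.
Proof. by move=> x Xx S [_ XS]; apply: XS. Qed.

Lemma generated_min (X S : set V) : subgroup S -> X `<=` S -> generated X `<=` S.
Proof. by move=> sS XS x gx; apply: gx; split. Qed.

End Generated.

(** * Stationarity of the group generated by the data *)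

Section Converse.
Variables (R : realType) (r : nat) (H K : set (realQ R r)) (z : seq (realQ R r)).
Hypothesis data : generating_data H K z.

Let G := group_of_data H K z.

Let sG : subgroup G. Proof. exact: generated_subgroup. Qed.

Lemma group_of_data_stationary : stationary_ordered_group G (first_coord_cone G).
Proof.
have [sH Hreal Hnc Hst sK Krat Krk Kst zspan] := data.
have coneH : first_coord_cone H `<=` H by move=> v [[]|->] //; case: sH.
have [k [A [phi [A0 prH Hcone]]]] := (stationary_orderedP sH coneH).1 Hst.
have [m [C [psi prK]]] := (stationary_groupP sK).1 Kst.
have [f0 fi fE] := pres_map (limit_pres A) prH.
have [g0 gi gE] := pres_map (limit_pres C) prK.
pose f := mkadd (group_isoB fi); pose g := mkadd (group_isoB gi).
have [_ finj fim] := fi; have [_ ginj gim] := gi.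
have fI : injective f by move=> x y; apply: finj; rewrite inE.
have gI : injective g by move=> x y; apply: ginj; rewrite inE.
have fH v : H (f v) by rewrite -fim; exists v.
have gK v : K (g v) by rewrite -gim; exists v.
have tauB x y : (f (x - y)).1 = (f x).1 - (f y).1 by rewrite raddfB.
pose tau : {additive stationary_limit A -> R} := mkadd tauB.
have f0E v : tau v = 0 -> v = 0.
  move=> tv; apply: fI; rewrite raddf0 [LHS]surjective_pairing.
  by rewrite (Hreal _ (fH v)) -[(f v).1]/(tau v) tv.
have coneE v : pres_cone (limit_phi A) v <-> (0 < tau v \/ v = 0).
  have -> : pres_cone (limit_phi A) v <-> first_coord_cone H (f v).
    rewrite Hcone; split=> -[i [x [hx e]]]; exists i, x; split=> //.
      by rewrite e -fE.
    by apply: fI; rewrite e -fE.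
  split=> [[[_ v0]|v0]|[v0|->]].
  - by left.
  - by right; apply: fI; rewrite raddf0; exact: v0.
  - by left; split; [exact: fH | exact: v0].
  - by right; rewrite raddf0.
have ncyc : ~ cyclic_group [set: stationary_limit A].
  move=> [x xE]; apply: Hnc; exists (f x); apply/seteqP; split=> [v Hv|_ [n ->]]; last first.
    by rewrite -raddfMz; apply: fH.
  have [w _ <-] : (f0 @` setT) v by rewrite fim.
  have [n ->] : [set v | exists n : int, v = x *~ n] w by rewrite -xE.
  by exists n; rewrite -[LHS]/(f _) raddfMz.
have tau_neq0 : exists v, tau v != 0.
  apply: contrapT => /forallNP t0; apply: ncyc; exists 0; apply/seteqP; split=> // v _.
  exists 0; rewrite mul0rz; apply: f0E; apply: contrapT => /eqP; exact: t0.
have [alpha [beta [lam [[alphaK betaK] alphaE lam1 tau_alpha cvgH]]]] :=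
  perron_data (limit_pres A) A0 coneE tau_neq0 ncyc.
have [gamma [delta [gammaK deltaK gammaE _]]] := pres_shift_auto (limit_pres C).
pose V := (stationary_limit A * stationary_limit C)%type.
have FB (x y : V) : f (x - y).1 + g (x - y).2 = f x.1 + g x.2 - (f y.1 + g y.2).
  by rewrite [(x - y).1]/(x.1 - y.1) [(x - y).2]/(x.2 - y.2) !raddfB opprD addrACA.
pose F : {additive V -> realQ R r} := mkadd FB.
have F1 v : (F v).1 = tau v.1.
  have g1 : (g v.2).1 = 0 := Krat _ (gK v.2).
  by rewrite -[RHS]addr0 -g1.
have FE a b : F (a, b) = f a + g b by [].
have FI : injective F.
  apply: raddf_inj => -[a b] e; have a0 : a = 0.
    by apply: f0E; rewrite -[RHS](congr1 fst e) F1.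
  move: e; rewrite FE a0 raddf0 add0r => e; congr (_, _).
  by apply: gI; rewrite e raddf0.
have FG v : G (F v).
  by apply: (subgroupD sG); apply: generated_sub; left; [left; exact: fH | right; exact: gK].
have HK : [set h + l | h in H & l in K] = range F.
  apply/seteqP; split=> [_ [h Hh [l Kl <-]]|_ [v _ <-]].
    have [a _ <-] : (f0 @` setT) h by rewrite fim.
    have [b _ <-] : (g0 @` setT) l by rewrite gim.
    by exists (a, b).
  by exists (f v.1) => //; exists (g v.2).
have sF : subgroup (range F) := range_subgroup F.
rewrite HK in zspan.
have [M M0 hM] := clear_denoms_seq sF zspan.
have GM x : G x -> range F (x *~ M).
  apply: (@generated_min _ _ [set x | range F (x *~ M)]).
    split; first by rewrite /= mul0rz; case: sF.
    by move=> u w Fu Fw; rewrite /= mulrzBl; case: sF => _; apply.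
  move=> u [[Hu|Ku]|zu]; last exact: hM.
    apply: subgroupMz => //; have [a _ <-] : (f0 @` setT) u by rewrite fim.
    by exists (a, 0) => //; rewrite FE raddf0 addr0.
  apply: subgroupMz => //; have [b _ <-] : (g0 @` setT) u by rewrite gim.
  by exists (0, b) => //; rewrite FE raddf0 add0r.
(* Multiplication by M is injective and carries G into H + K, which is the direct product of the two
   limits; [D] is the resulting copy of G there. *)
pose D : set V := [set v | exists2 x, G x & F v = x *~ M].
have sD : subgroup D.
  split; first by exists 0; rewrite ?raddf0 ?mul0rz //; case: sG.
  move=> v w [x Gx vx] [y Gy wy]; exists (x - y); first by case: sG => _; apply.
  by rewrite raddfB vx wy mulrzBl.
have DM v : D (v *~ M) by exists (F v) => //; rewrite raddfMz.
have Mn0 : M != 0 by rewrite gt_eqF.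
have st := product_stationary_ordered (limit_pres A) (limit_pres C) alphaK betaK gammaK deltaK
  alphaE gammaE lam1 tau_alpha cvgH tau_neq0 Mn0 sD DM.
apply: stationary_ordered_iso st; apply: order_iso_sym => //.
  by move=> v [[]|->] //; case: sD.
have Mq0 : (M%:~R : rat) != 0 by rewrite intr_eq0.
have sc x : (M%:~R : rat)^-1 *: (x *~ M) = x :> realQ R r.
  by rewrite -scaler_int scalerA mulVf // scale1r.
exists (fun v => (M%:~R : rat)^-1 *: F v).
  split.
  - by move=> x y _ _; rewrite (raddfD F); exact: scalerDr.
  - by move=> x y _ _ /(scalerI (invr_neq0 Mq0)) /FI.
  - apply/seteqP; split=> [_ [v [x Gx vx] <-]|x Gx]; first by rewrite vx sc.
    by have [v _ vE] := GM x Gx; exists v; rewrite ?vE ?sc //; exists x.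
have pos x : (0 < x.1) = (0 < (x *~ M : realQ R r).1).
  by rewrite (raddfMz fst) pmulrz_lgt0.
apply/seteqP; split=> [_ [v [[[x Gx vx] tv]|->] <-]|x [[Gx x0]|->]].
- by left; split; rewrite vx sc //= pos -vx F1.
- by right; apply: (etrans (congr1 _ (raddf0 F))); exact: scaler0.
- have [v _ vE] := GM x Gx; exists v; rewrite ?vE ?sc //; left; split; first by exists x.
  by rewrite -F1 vE -pos.
- by exists 0; [right | rewrite (raddf0 F) scaler0].
Qed.

End Converse.

(** * From stationary groups to generating data *)

Section PolynomialAction.
Variables (V : zmodType) (alpha : {additive V -> V}).
Implicit Types (p q : {poly int}) (v : V).

Definition pact p v : V := \sum_(i < size p) iter i alpha v *~ p`_i.

Lemma pact_wide n p v : (size p <= n)%N -> pact p v = \sum_(i < n) iter i alpha v *~ p`_i.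
Proof.
move=> pn; rewrite /pact (big_ord_widen n (fun i => iter i alpha v *~ p`_i)) // big_mkcond.
apply: eq_bigr => i _; case: ltnP => // le; rewrite nth_default ?mulr0z //.
Qed.

Lemma pactB p u v : pact p (u - v) = pact p u - pact p v.
Proof. by rewrite /pact -sumrB; apply: eq_bigr => i _; rewrite iterB mulrzBl. Qed.

Definition pact_additive p : {additive V -> V} := mkadd (pactB p).

Lemma pact0 p : pact p 0 = 0.
Proof. exact: (raddf0 (pact_additive p)). Qed.

Lemma pactDl p q v : pact (p + q) v = pact p v + pact q v.
Proof.
pose n := maxn (size p) (size q).
rewrite !(@pact_wide n) ?leq_maxl ?leq_maxr //; last exact: size_polyD.
by rewrite -big_split; apply: eq_bigr => i _; rewrite coefD mulrzDr.
Qed.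

Lemma pactC c v : pact c%:P v = v *~ c.
Proof. by rewrite (@pact_wide 1) ?size_polyC_leq1 // big_ord1 coefC. Qed.

Lemma pact_alpha p v : pact p (alpha v) = alpha (pact p v).
Proof.
rewrite /pact raddf_sum; apply: eq_bigr => i _.
by rewrite raddfMz /= -iterS iterSr.
Qed.

Lemma pactMX p v : pact (p * 'X) v = alpha (pact p v).
Proof.
rewrite (@pact_wide (size p).+1); last first.
  by apply: leq_trans (size_polyMleq _ _) _; rewrite size_polyX addn2.
rewrite big_ord_recl coefMX mulr0z add0r -pact_alpha; apply: eq_bigr => i _.
by rewrite coefMX /= -iterS iterSr.
Qed.

Lemma pactMC p c v : pact (c%:P * p) v = pact p v *~ c.
Proof.
rewrite (@pact_wide (size p)); last first.
  by rewrite mul_polyC size_scale_leq.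
by rewrite mulrz_suml; apply: eq_bigr => i _; rewrite coefCM mulrC mulrzA.
Qed.

Lemma pactM p q v : pact (p * q) v = pact p (pact q v).
Proof.
elim/poly_ind: p => [|p c IH]; first by rewrite mul0r /pact size_poly0 !big_ord0.
by rewrite mulrDl mulrAC !pactDl !pactMX IH pactMC pactC.
Qed.

Lemma pact_iter p j v : pact p (iter j alpha v) = iter j alpha (pact p v).
Proof. by elim: j => //= j IH; rewrite pact_alpha IH. Qed.

Lemma pact_eigen (R : comNzRingType) (tau : {additive V -> R}) lam p v :
  (forall v, tau (alpha v) = lam * tau v) ->
  tau (pact p v) = (map_poly intr p).[lam] * tau v.
Proof.
move=> ta; elim/poly_ind: p => [|p c IH].
  by rewrite rmorph0 horner0 mul0r /pact size_poly0 big_ord0 raddf0.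
rewrite pactDl pactMX pactC raddfD /= ta IH raddfMz /= rmorphD rmorphM /=.
by rewrite map_polyX map_polyC !hornerE /= mulrDl -[tau v *~ c]mulrzr; ring.
Qed.

Lemma pact_mem (L : set V) p v : subgroup L -> (forall w, L w -> L (alpha w)) ->
  L v -> L (pact p v).
Proof.
move=> sL aL Lv; apply: subgroup_sum => // i; apply: subgroupMz => //.
by elim: (nat_of_ord i) => //= j; apply: aL.
Qed.

Lemma pact_char_poly n (b : 'I_n -> V) (A : 'M[int]_n) x :
  (forall x, alpha (comb b x) = comb b (A *m x)) -> pact (char_poly A) (comb b x) = 0.
Proof.
case: n b A x => [|n] b A x AE.
  by have -> : comb b x = 0; [rewrite /comb big_ord0 | exact: pact0].
suff h p : pact p (comb b x) = comb b (horner_mx A p *m x).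
  by rewrite h Cayley_Hamilton mul0mx raddf0.
elim/poly_ind: p => [|p c IH].
  by rewrite rmorph0 mul0mx raddf0 /pact size_poly0 big_ord0.
rewrite pactDl pactMX pactC IH AE rmorphD rmorphM /= horner_mx_X horner_mx_C.
rewrite mulmxDl raddfD /=; congr (_ + _).
  have : horner_mx A ('X * p) = horner_mx A (p * 'X) by rewrite mulrC.
  by rewrite !rmorphM /= horner_mx_X mulmxA => <-.
by rewrite mul_scalar_mx -[c in c *: _]intz scaler_int raddfMz.
Qed.

End PolynomialAction.

(* f is the part of P prime to q, so f still vanishes at lam; pi2 and pi1 are the
   multiples of f and q in a Bezout identity, with denominators cleared. *)
Lemma integral_bezout (R : realType) (P q : {poly int}) (lam : R) : P != 0 ->
  root (map_poly intr P) lam -> ~~ root (map_poly intr q) lam ->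
  exists (M e : int) (pi1 pi2 w : {poly int}),
    [/\ M != 0 /\ e != 0, pi1 + pi2 = M%:P, root (map_poly intr pi2) lam & e%:P * pi1 = w * q].
Proof.
move=> P0 rP rq.
pose i2q := map_poly (intr : int -> rat); pose q2r := map_poly (ratr : rat -> R).
have i2r p : q2r (i2q p) = map_poly intr p.
  by rewrite /q2r /i2q -map_poly_comp; apply: eq_map_poly => c /=; rewrite ratr_int.
have i2q_inj : injective i2q by apply: map_inj_poly => //; exact: intr_inj.
have QP0 : i2q P != 0 by rewrite -(rmorph0 i2q) (inj_eq i2q_inj).
pose f := gdcop (i2q q) (i2q P).
have rf : root (q2r f) lam.
  rewrite /q2r gdcop_map -/q2r !i2r root_gdco ?rP ?rq // -i2r.
  by rewrite map_poly_eq0.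
have /Bezout_eq1_coprimepP[[a b] /= ab] := coprimep_gdco (i2q q) QP0.
have [pi2 [M M0 pi2E]] := rat_poly_scale (a * f).
have [w [e e0 wE]] := rat_poly_scale b.
have Mq0 : (M%:~R : rat) != 0 by rewrite intr_eq0.
have eq0 : (e%:~R : rat) != 0 by rewrite intr_eq0.
have pi2E' : i2q pi2 = M%:~R *: (a * f) by rewrite pi2E scalerA mulfV // scale1r.
have wE' : i2q w = e%:~R *: b by rewrite wE scalerA mulfV // scale1r.
(* With a f + b q = 1, M clears the denominators of a f and e those of b; so pi2 = M a f, and e (M -
   pi2) = M e b q is an integral multiple of q. *)
exists M, e, (M%:P - pi2), pi2, (M%:P * w); split=> //; first by rewrite subrK.
  by rewrite -i2r pi2E' /q2r linearZ rmorphM /= /root hornerZ hornerM (rootP rf) !mulr0.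
apply: i2q_inj; rewrite /i2q !rmorphM rmorphB /= !map_polyC /= -/i2q pi2E' wE'.
rewrite -!mul_polyC !mulrA; apply: (@etrans _ _ (e%:~R%:P * M%:~R%:P * (1 - a * f))); first by ring.
by rewrite -ab addrC addKr; ring.
Qed.

(** * Splitting G up to finite multiples *)

Section Splitting.
Variables (R : realType) (V : zmodType) (alpha beta : {additive V -> V}).
Hypotheses (alphaK : cancel alpha beta).
Hypothesis tf : torsion_free V.
Variables (L : set V) (n : nat) (b : 'I_n -> V).
Hypotheses (hb : basis L b) (alphaL : forall v, L v -> L (alpha v)).
Hypothesis dil : forall v, exists j, L (iter j alpha v).
Variables (tau : {additive V -> R}) (lam : R).
Hypotheses (lam1 : 1 < lam) (tau_alpha : forall v, tau (alpha v) = lam * tau v).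
Hypotheses (Lcvg : perron_cvg alpha tau lam L) (tau0 : exists v, tau v != 0).

Let sL := basis_subgroup hb.

Let kerL : set V := [set v | L v /\ tau v = 0].

Lemma ker_sublattice_subgroup : subgroup kerL.
Proof.
split; first by split; [case: sL | rewrite raddf0].
by move=> v w [Lv v0] [Lw w0]; split; [case: sL => _; apply | rewrite raddfB /= v0 w0 subrr].
Qed.

Lemma ker_sublattice_alpha v : kerL v -> kerL (alpha v).
Proof. by move=> [Lv v0]; split; [exact: alphaL | rewrite tau_alpha v0 mulr0]. Qed.

(** Some iterate of v lies in the lattice, and [alpha] is injective and commutes with the
    polynomial. *)
Lemma pact_eq0 (D : set V) p : (forall v, D v -> D (alpha v)) ->
  (forall v, L v -> D v -> pact alpha p v = 0) -> forall v, D v -> pact alpha p v = 0.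
Proof.
move=> aD pL v Dv; have [j Lj] := dil v.
apply: (can_inj (iter_cancel j alphaK)); rewrite -pact_iter pL //; last first.
  by elim: (j) => //= i; apply: aD.
by rewrite iter0.
Qed.

(* A left eigenvector for lam of alpha on ker tau would extend to a functional on L
   contradicting the convergence. *)
Lemma ker_char_poly m (c : 'I_m -> V) (B : 'M[int]_m) : basis kerL c ->
  (forall x, alpha (comb c x) = comb c (B *m x)) ->
  ~~ root (map_poly intr (char_poly B)) lam.
Proof.
move=> hc BE; apply/negP; rewrite map_char_poly -eigenvalue_root_char => /eigenvalueP[y yB y0].
have cL i : L (c i) by case: (basis_mem i hc).
have [l [_ lB lE]] := basis_dual hb cL hc.2.
pose f v : R := \sum_s y 0 s * ratr (l s v).
have fB : additive_on L f.
  move=> v w Lv Lw; rewrite -sumrB; apply: eq_bigr => s _.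
  by rewrite lB // rmorphB mulrBr.
have fE x : f (comb c x) = \sum_s y 0 s * (x s 0)%:~R.
  apply: eq_bigr => s _; congr (_ * _).
  rewrite (additive_on_comb sL (lB s)) // (bigD1 s) //= big1 ?addr0 => [|i si].
    by rewrite lE eqxx ratr_int.
  by rewrite lE eq_sym (negPf si) mul0rz.
have iterE N x : f (iter N alpha (comb c x)) = lam ^+ N * f (comb c x).
  elim: N x => [|N IH] x; first by rewrite mul1r.
  rewrite iterSr BE IH exprSr -mulrA; congr (_ * _).
  rewrite !fE mulr_sumr.
  transitivity (\sum_s (y *m map_mx intr B) 0 s * (x s 0)%:~R); last first.
    by apply: eq_bigr => s _; rewrite yB mxE mulrA.
  under eq_bigr do rewrite mxE rmorph_sum mulr_sumr.
  rewrite exchange_big /=; apply: eq_bigr => s _; rewrite mxE mulr_suml.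
  by apply: eq_bigr => i _; rewrite !mxE rmorphM mulrA.
have [c' hc'] := Lcvg fB.
move/eqP: y0; apply; apply/rowP => s; rewrite [RHS]mxE.
have := hc' _ (cL s); have [_ ->] := basis_mem s hc; rewrite mulr0 -(comb_delta c).
have -> : (fun N => f (iter N alpha (comb c (delta_mx s 0))) / lam ^+ N) =
    fun=> f (comb c (delta_mx s 0)).
  have l0 : lam != 0 by rewrite gt_eqF // (lt_trans _ lam1).
  by apply/funext => N; rewrite iterE mulrAC mulfV ?mul1r // expf_neq0.
move=> cv; have : f (comb c (delta_mx s 0)) = 0.
  have h1 : (fun=> f (comb c (delta_mx s 0))) N @[N --> \oo] --> f (comb c (delta_mx s 0)).
    exact: cvg_cst.
  exact: cvg_unique h1 cv.
rewrite fE (bigD1 s) //= big1 ?addr0 => [|i si].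
  have -> : (delta_mx s 0 : 'cV[int]_m) s 0 = 1 by rewrite mxE !eqxx.
  by rewrite mulr1.
by rewrite mxE (negPf si) mulr0.
Qed.

Lemma splitting : exists (M : int) (p1 p2 : {additive V -> V}),
  [/\ M != 0 /\ (forall v, p1 v + p2 v = v *~ M),
      (forall v, p1 (alpha v) = alpha (p1 v)) /\ (forall v, p2 (alpha v) = alpha (p2 v)),
      forall v, tau v = 0 -> p1 v = 0,
      forall v, tau (p2 v) = 0 &
      (forall v, L v -> L (p1 v)) /\ (forall v, L v -> L (p2 v))].
Proof.
have [m [c [_ hc]]] := sublattice_basis_of hb ker_sublattice_subgroup (fun v h => h.1).
have [B BE] := basis_endo_matrix hc ker_sublattice_alpha.
have [A AE] := basis_endo_matrix hb alphaL.
have killA v : pact alpha (char_poly A) v = 0.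
  apply: (@pact_eq0 setT) => // w Lw _; have [x ->] := (hb.1 w).1 Lw.
  exact: pact_char_poly.
have killB v : tau v = 0 -> pact alpha (char_poly B) v = 0.
  apply: (@pact_eq0 [set v | tau v = 0]) => [w /= w0|w Lw w0]; first by rewrite tau_alpha w0 mulr0.
  have [x ->] := (hc.1 w).1 (conj Lw w0); exact: pact_char_poly.
(* tau turns the Cayley-Hamilton identity into evaluation at lam. *)
have rA : root (map_poly intr (char_poly A)) lam.
  have [v tv] := tau0; have := pact_eigen (char_poly A) v tau_alpha.
  by rewrite killA raddf0 => /esym/eqP; rewrite mulf_eq0 (negPf tv) orbF.
have [M [e [pi1 [pi2 [w [[M0 e0] pE r2 eE]]]]]] :=
  integral_bezout (monic_neq0 (char_poly_monic A)) rA (ker_char_poly hc BE).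
exists M, (pact_additive alpha pi1), (pact_additive alpha pi2); split=> /=.
- by split=> // v; rewrite -pactDl pE pactC.
- by split=> v; rewrite pact_alpha.
(* Only e pi1 is known to be an integral multiple of the characteristic polynomial on ker tau;
   torsion-freeness removes e. *)
- move=> v v0; apply: (tf (m := e)) => //.
  by rewrite -pactMC eE pactM killB // pact0.
- by move=> v; rewrite (pact_eigen _ _ tau_alpha) (rootP r2) mul0r.
- by split=> v Lv; apply: pact_mem.
Qed.

End Splitting.

Section Transport.
Variables (V W : zmodType) (f : {additive V -> W}).
Hypothesis fI : injective f.

Lemma image_subgroup (D : set V) : subgroup D -> subgroup (f @` D).
Proof.
move=> [D0 DB]; split; first by exists 0; rewrite ?raddf0.
by move=> _ _ [x Dx <-] [y Dy <-]; exists (x - y); [exact: DB | rewrite raddfB].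
Qed.

Lemma image_order_iso (D P : set V) : order_iso D P (f @` D) (f @` P).
Proof.
exists f => //; split=> // [x y _ _|x y _ _ /fI //]; exact: raddfD.
Qed.

Lemma image_stationary_group (D : set V) : subgroup D -> stationary_group D ->
  stationary_group (f @` D).
Proof.
move=> sD /(stationary_groupP sD)[k [A [phi pr]]].
apply/(stationary_groupP (image_subgroup sD)).
exists k, A, (fun i => f \o phi i); split=> [i x|i x /= e|w] /=.
- by rewrite (pres_shift pr).
- by apply: (pres_ker pr (i := i)); apply: fI; rewrite e raddf0.
- split=> [[v /(pres_im pr)[i [x ->]] <-]|[i [x ->]]]; first by exists i, x.
  by exists (phi i x) => //; apply: (pres_mem pr).
Qed.

End Transport.

Lemma image_has_rank (V : zmodType) (W : lmodType rat) (f : {additive V -> W}) (D L : set V) n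
    (b : 'I_n -> V) : injective f -> basis L b -> L `<=` D ->
  (forall v, D v -> exists2 m : int, m != 0 & L (v *~ m)) ->
  has_rank (f @` D) n.
Proof.
move=> fI hb LD DL; exists (fun i => f (b i)); split.
  move=> c e i; have [d d0 [w hw]] := clear_denoms c.
  have : f (comb b (\col_i w i)) = 0.
    transitivity (d%:~R *: \sum_i c i *: f (b i)); last by rewrite e scaler0.
    rewrite additive_comb scaler_sumr.
    by apply: eq_bigr => j _; rewrite mxE scalerA mulrC hw scaler_int.
  rewrite -[RHS](raddf0 f) => /fI/hb.2/colP/(_ i); rewrite !mxE => wi.
  have /eqP : c i * d%:~R = 0 by rewrite hw wi.
  by rewrite mulf_eq0 intr_eq0 (negPf d0) orbF => /eqP.
apply/seteqP; split=> _ [m [c [x [Dx ->]]]].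
  exists m, c, x; split=> // i; have [j _ <-] := Dx i.
  by exists (b j) => //; apply: LD; apply: basis_mem hb.
have [a ha] : {a : 'I_m -> 'I_n -> rat & forall i, x i = \sum_j a i j *: f (b j)}.
  apply: (@choice _ _ (fun i (a : 'I_n -> rat) => x i = \sum_j a j *: f (b j))) => i.
  have [v Dv <-] := Dx i; have [e e0 Le] := DL v Dv.
  have [y yE] := (hb.1 _).1 Le; exists (fun j => (y j 0)%:~R / e%:~R).
  have e1 : (e%:~R : rat) != 0 by rewrite intr_eq0.
  apply: (scalerI e1); rewrite scaler_int -raddfMz yE additive_comb scaler_sumr.
  by apply: eq_bigr => j _; rewrite scalerA mulrC divfK // scaler_int.
exists n, (fun j => \sum_i c i * a i j), (fun j => f (b j)); split; first by move=> j; exists j.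
under [RHS]eq_bigr do rewrite scaler_suml.
rewrite exchange_big /=; apply: eq_bigr => i _; rewrite ha scaler_sumr.
by apply: eq_bigr => j _; rewrite scalerA.
Qed.

(** The coordinates of v are those of m v divided by m. [kE] shows that they do not depend on m, so
    v, w and v - w can be compared with a common multiplier. *)
Lemma rational_coordinates (V : zmodType) (D L : set V) n (b : 'I_n -> V) :
  torsion_free V -> subgroup D -> basis L b -> L `<=` D ->
  (forall v, D v -> exists2 m : int, m != 0 & L (v *~ m)) ->
  exists kappa : V -> 'rV[rat]_n, additive_on D kappa /\
    forall v, D v -> kappa v = 0 -> v = 0.
Proof.
move=> tf sD hb LD DL; have sL := basis_subgroup hb.
have [c [cB _ cK]] := basis_coord hb.
have [mu hmu] : {mu : V -> int & forall v, D v -> mu v != 0 /\ L (v *~ mu v)}.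
  apply: (@choice _ _ (fun v (m : int) => D v -> m != 0 /\ L (v *~ m))) => v.
  have [Dv|nDv] := pselect (D v); last by exists 0.
  by have [m m0 Lm] := DL v Dv; exists m.
pose kappa v : 'rV[rat]_n := \row_s ((c (v *~ mu v) s 0)%:~R / (mu v)%:~R).
have kE v m s : D v -> m != 0 -> L (v *~ m) -> kappa v 0 s = (c (v *~ m) s 0)%:~R / m%:~R.
  move=> Dv m0 Lm; have [mu0 Lmu] := hmu v Dv; rewrite mxE.
  have mq : (m%:~R : rat) != 0 by rewrite intr_eq0.
  have muq : ((mu v)%:~R : rat) != 0 by rewrite intr_eq0.
  apply/eqP; rewrite eqr_div // -!intrM; apply/eqP; congr (_%:~R).
  have : c (v *~ mu v *~ m) = c (v *~ m *~ mu v) by rewrite mulrzAC.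
  rewrite (additive_onMz sL cB m Lmu) (additive_onMz sL cB (mu v) Lm) => /colP/(_ s).
  by rewrite -!scaler_int !mxE !intz mulrC => ->; rewrite mulrC.
exists kappa; split=> [v w Dv Dw|v Dv e].
  have [[v0 Lv] [w0 Lw]] := (hmu v Dv, hmu w Dw).
  have Dvw : D (v - w) by case: sD => _; apply.
  pose m := mu v * mu w; have m0 : m != 0 by rewrite mulf_neq0.
  have Lvm : L (v *~ m) by rewrite mulrzA; apply: subgroupMz.
  have Lwm : L (w *~ m) by rewrite /m mulrC mulrzA; apply: subgroupMz.
  have Lvwm : L ((v - w) *~ m) by rewrite mulrzBl; case: sL => _; apply.
  apply/rowP => s; rewrite (kE _ m) // [RHS]mxE [(- kappa w) 0 s]mxE !(kE _ m) //.
  by rewrite mulrzBl cB // !mxE rmorphB mulrBl.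
have [mu0 Lmu] := hmu v Dv; apply: (tf _ (mu v)) => //; rewrite -(cK _ Lmu).
suff -> : c (v *~ mu v) = 0 by rewrite raddf0.
apply/colP => s; rewrite [RHS]mxE; move/rowP/(_ s): e; rewrite (kE _ (mu v)) // [RHS]mxE.
by move/eqP; rewrite mulf_eq0 invr_eq0 !intr_eq0 (negPf mu0) orbF => /eqP.
Qed.

(** * Generating data of a stationary simple group *)

Section Forward.
Variables (R : realType) (V : zmodType) (Pos : set V).
Hypotheses (Vord : ordered_group [set: V] Pos) (Vsimple : simple_ordered [set: V] Pos).
Hypotheses (Vnc : ~ cyclic_group [set: V]) (Vst : stationary_ordered_group [set: V] Pos).

Lemma stationary_group_of_data : exists (r : nat) (H K : set (realQ R r)) (z : seq (realQ R r)),
  [/\ generating_data H K z,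
      order_iso [set: V] Pos (group_of_data H K z) (first_coord_cone (group_of_data H K z)) &
      exists rkH rkK : nat,
        [/\ has_rank H rkH, has_rank K rkK & (size z <= minn rkH rkK)%N]].
Proof.
have [sV Psub P0 _ _ dir] := Vord.
have [k [A [phi [A0 pr PosE]]]] := (stationary_orderedP sV Psub).1 Vst.
have dir' v : exists y z, [/\ pres_cone phi y, pres_cone phi z & v = y - z].
  by rewrite -PosE; exact: dir.
have Vsimple' : simple_ordered [set: V] (pres_cone phi) by rewrite -PosE.
have [tau [tau0 coneE]] := simple_state R pr A0 Vsimple' dir'.
have [alpha [beta [lam [[alphaK betaK] alphaE lam1 tau_alpha Lcvg]]]] :=
  perron_data pr A0 coneE tau0 Vnc.
have tf := torsion_free_pres pr.
have [n [b [_ hb]]] := range_basis pr.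
pose L := range (phi 0%N).
have aL : forall v, L v -> L (alpha v) := alpha_range alphaE.
have dil := range_dilation pr alphaE.
have sL : subgroup L := basis_subgroup hb.
have [M [p1 [p2 [[M0 pM] [p1a p2a] p1K p2K [p1L p2L]]]]] :=
  splitting alphaK tf hb aL dil lam1 tau_alpha Lcvg tau0.
have MR0 : (M%:~R : R) != 0 by rewrite intr_eq0.
pose H := [set v | p2 v = 0]; pose K := [set v | tau v = 0].
have p2M v : K v -> p2 v = v *~ M by move=> Kv; rewrite -pM p1K // add0r.
have p1M v : H v -> p1 v = v *~ M by move=> Hv; rewrite -pM Hv addr0.
(* [p1] kills the image of [p2], so p2 p2 = M p2 and thus p2 p1 = 0: up to the factor M these are
   complementary projections. *)
have p1H v : H (p1 v).
  have := pM (p2 v); rewrite (p1K _ (p2K v)) add0r => p22.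
  have : p2 (p1 v + p2 v) = p2 v *~ M by rewrite pM raddfMz.
  rewrite raddfD /= p22 => e; apply: (addIr (p2 v *~ M)).
  by rewrite e add0r.
have ker1 v : p1 v = 0 -> K v.
  move=> v0; have := p2K v; rewrite -[p2 v]add0r -v0 pM raddfMz -[tau v *~ M]mulrzr => /eqP.
  by rewrite mulf_eq0 (negPf MR0) orbF => /eqP.
have HK0 v : H v -> K v -> v = 0.
  by move=> Hv Kv; apply: (tf _ M) => //; rewrite -p2M.
have sH : subgroup H.
  by split=> [|v w /= v0 w0]; rewrite /H /= ?raddf0 ?raddfB //= v0 w0 subrr.
have sK : subgroup K.
  by split=> [|v w /= v0 w0]; rewrite /K /= ?raddf0 ?raddfB //= v0 w0 subrr.
have aH v : H v -> H (alpha v) by rewrite /H /= p2a => ->; rewrite raddf0.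
have aK v : K v -> K (alpha v) by rewrite /K /= tau_alpha => ->; rewrite mulr0.
have bH v : H v -> H (beta v).
  by move=> Hv; apply: (can_inj alphaK); rewrite -p2a betaK Hv raddf0.
have lam0 : lam != 0 by rewrite gt_eqF // (lt_trans _ lam1).
have bK v : K v -> K (beta v).
  by move=> Kv; apply: (mulfI lam0); rewrite -tau_alpha betaK Kv mulr0.
have dilation_of (D : set V) : (forall v, D v -> D (alpha v)) -> (forall v, D v -> D (beta v)) ->
    forall v, D v <-> exists j, (D `&` L) (iter j alpha v).
  move=> aD bD v; split=> [Dv|[j [Dj _]]].
    have [j Lj] := dil v; exists j; split=> //.
    by elim: (j) => //= i; apply: aD.
  rewrite -(iter_cancel j alphaK v); move: (iter j alpha v) Dj => w Dw.
  by elim: j => //= j; apply: bD.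
have sub_of (D : set V) : subgroup D -> subgroup (D `&` L).
  move=> [D0 DB]; split; first by split; last by case: sL.
  by move=> v w [Dv Lv] [Dw Lw]; split; [exact: DB | case: sL => _; apply].
have [d [bh [_ hbh]]] := sublattice_basis_of hb (sub_of H sH) (fun v h => h.2).
have [r [bk [_ hbk]]] := sublattice_basis_of hb (sub_of K sK) (fun v h => h.2).
have aHL v : (H `&` L) v -> (H `&` L) (alpha v) by move=> [Hv Lv]; split; [exact: aH | exact: aL].
have aKL v : (K `&` L) v -> (K `&` L) (alpha v) by move=> [Hv Lv]; split; [exact: aK | exact: aL].
have [Ah AhE] := basis_endo_matrix hbh aHL; have [Ak AkE] := basis_endo_matrix hbk aKL.
have torH := dilation_torsion alphaK hbh (dilation_of H aH bH) AhE.
have torK := dilation_torsion alphaK hbk (dilation_of K aK bK) AkE.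
have [kappa [kB k0]] := rational_coordinates tf sK hbk (fun v h => h.1) torK.
(* [kappa] is additive only on [K], so [p2] comes first. It is 0 on [H] and multiplication by M on
   [K], which places the images of [H] and [K] on the two axes. *)
pose psi v : realQ R r := (tau v, kappa (p2 v)).
have psiB v w : psi (v - w) = psi v - psi w.
  by rewrite /psi !raddfB kB //; exact: p2K.
pose Psi : {additive V -> realQ R r} := mkadd psiB.
have PsiI : injective Psi.
  apply: raddf_inj => v e; have Kv : K v by exact: (congr1 fst e).
  apply: (tf _ M) => //; rewrite -p2M //; apply: k0; first exact: p2K.
  exact: (congr1 snd e).
have coneH : [set v | H v /\ 0 < tau v] `|` [set 0] `<=` H.
  by move=> v [[]|->] //; case: sH.
have coneImage (D : set V) : first_coord_cone (Psi @` D) =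
    Psi @` ([set v | D v /\ 0 < tau v] `|` [set 0]) :> set (realQ R r).
  apply/seteqP; split=> [w [[[v Dv <-] v0]|->]|_ [v [[Dv v0]|->] <-]].
  - by exists v => //; left.
  - by exists 0; [right | rewrite raddf0].
  - by left; split => //; exists v.
  - by right; exact: (raddf0 Psi).
have [v1 Hv1 tv1] : exists2 v, (H `&` L) v & tau v != 0.
  have [v tv] := tau0; have [j Lj] := dil v.
  exists (p1 (iter j alpha v)); first by split; [exact: p1H | exact: p1L].
  have /(congr1 tau) := pM (iter j alpha v).
  rewrite raddfD /= p2K addr0 => ->; rewrite raddfMz -[tau _ *~ M]mulrzr.
  by rewrite (tau_iter tau_alpha) !mulf_neq0 // expf_neq0.
have cvgH : perron_cvg alpha tau lam (H `&` L).
  (* A functional on the smaller lattice extends to [L] through [p1], which is multiplication by M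
     on [H]. *)
  move=> l lB; have l1B : additive_on L (fun v => l (p1 v)).
    by move=> v w Lv Lw; rewrite raddfB lB //; split; [exact: p1H|exact: p1L|exact: p1H|exact: p1L].
  have [c hc] := Lcvg _ l1B; exists (c / M%:~R) => v HLv.
  have -> : c / M%:~R * tau v = (M%:~R)^-1 * (c * tau v) by ring.
  have -> : (fun N => l (iter N alpha v) / lam ^+ N) =
      (fun N => (M%:~R)^-1 * (l (p1 (iter N alpha v)) / lam ^+ N)).
    apply/funext => N.
    have HN : (H `&` L) (iter N alpha v) by elim: N => //= N; apply: aHL.
    rewrite p1M; last exact: HN.1.
    rewrite (additive_onMz (sub_of H sH) lB M HN) -[l _ *~ M]mulrzr mulrA.
    by rewrite [_^-1 * _]mulrC mulfK.
  by apply: cvgMl_tmp; apply: hc; case: HLv.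
have stH : stationary_ordered_group H ([set v | H v /\ 0 < tau v] `|` [set 0]).
  apply: (dilation_stationary_ordered alphaK betaK hbh aHL (dilation_of H aH bH) lam1 tau_alpha cvgH).
  by exists v1.
have stK : stationary_group K.
  exact: (dilation_stationary alphaK betaK hbk aKL (dilation_of K aK bK)).
(* An automorphism of an infinite cyclic group is multiplication by 1 or -1, whereas [alpha]
   multiplies tau by lam > 1. *)
have ncH : ~ cyclic_group H.
  move=> [h hE]; have mem v : H v -> exists m : int, v = h *~ m by rewrite {1}hE.
  have Hh : H h by rewrite hE; exists 1; rewrite mulr1z.
  have [a ea] := mem _ (aH h Hh); have [c ec] := mem _ (bH h Hh).
  have th : tau h != 0.
    apply/eqP => th; have [m vm] := mem _ Hv1.1.
    by move/eqP: tv1; apply; rewrite vm raddfMz /= th mul0rz.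
  have ac : a * c = 1.
    apply/eqP; rewrite -subr_eq0; apply/negPn/negP => ac.
    have : h *~ (a * c - 1) = 0.
      rewrite mulrzBr mulr1z mulrzA -ea.
      by have /(congr1 alpha) := ec; rewrite betaK raddfMz => <-; rewrite subrr.
    by move/tf => /(_ ac) h0; move: th; rewrite h0 raddf0 eqxx.
  have : lam = a%:~R.
    by apply: (mulIf th); rewrite -tau_alpha ea raddfMz mulrzl.
  have a1 : a <= 1.
    have : (a %| 1)%Z by apply/dvdzP; exists c; rewrite mulrC.
    by rewrite dvdz1; lia.
  by move=> le; move: lam1; rewrite le ltr1z ltNge a1.
(* Lift a basis of p(L) to [L]; an element of [L] minus a combination of the lifts is then killed by
   p. For [p1] the remainder lies in [K] and at most d lifts occur, for [p2] it lies in [H] and at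
   most r occur; the smaller choice gives the bound on s. *)
have zgen : exists m (y : 'I_m -> V), (m <= minn d r)%N /\
    forall v, L v -> exists x h l, [/\ H h, K l & v = comb y x + (h + l)].
  have pick (p : {additive V -> V}) (D : set V) m (c : 'I_m -> V) : basis (D `&` L) c ->
      (forall v, L v -> (D `&` L) (p v)) -> exists m' (y : 'I_m' -> V), (m' <= m)%N /\
      forall v, L v -> exists x, p (v - comb y x) = 0.
    move=> hc pL; have sp : subgroup (p @` L) by apply: image_subgroup.
    have [|m' [b' [mm hb']]] := sublattice_basis_of hc sp; first by move=> _ [v Lv <-]; apply: pL.
    have [y hy] : {y : 'I_m' -> V & forall i, L (y i) /\ p (y i) = b' i}.
      apply: (@choice _ _ (fun i v => L v /\ p v = b' i)) => i.
      by have [v Lv e] := basis_mem i hb'; exists v.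
    exists m', y; split=> // v Lv.
    have [x e] := (hb'.1 (p v)).1 (ex_intro2 _ _ v Lv erefl).
    exists x; apply/eqP; rewrite raddfB subr_eq0; apply/eqP; rewrite /= e additive_comb.
    by apply: eq_bigr => i _; rewrite (hy i).2.
  have [dr|rd] := leqP d r.
    have [|m [y [md hy]]] := pick p1 H d bh hbh.
      by move=> v Lv; split; [exact: p1H | exact: p1L].
    exists m, y; split=> // v Lv.
    have [x e] := hy v Lv; exists x, 0, (v - comb y x); split; first by case: sH.
      exact: ker1.
    by rewrite add0r addrC subrK.
  have [|m [y [md hy]]] := pick p2 K r bk hbk.
    by move=> v Lv; split; [exact: p2K | exact: p2L].
  exists m, y; split=> // v Lv.
  have [x e] := hy v Lv; exists x, (v - comb y x), 0; split=> //; first by case: sK.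
  by rewrite addr0 addrC subrK.
have [m [y [my hy]]] := zgen.
pose z := [seq Psi (y i) | i <- enum 'I_m].
have data : generating_data (Psi @` H) (Psi @` K) z.
  split.
  - exact: image_subgroup.
  - move=> _ [v Hv <-]; rewrite /= /psi /= Hv.
    by have [K0 _] := sK; rewrite (additive_on0 sK kB).
  - move=> [g gE]; apply: ncH; have [h Hh hg] : (Psi @` H) g.
      by rewrite gE; exists 1; rewrite mulr1z.
    exists h; apply/seteqP; split=> [v Hv|_ [j ->]]; last exact: subgroupMz.
    have : (Psi @` H) (Psi v) by exists v.
    by rewrite gE => -[j e]; exists j; apply: PsiI; rewrite raddfMz e -hg.
  - apply: stationary_ordered_iso stH; apply: order_iso_sym => //.
    by rewrite coneImage; apply: image_order_iso.
  - exact: image_subgroup.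
  - by move=> _ [v Kv <-].
  - exact: image_has_rank PsiI hbk (fun v h => h.1) torK.
  - exact: image_stationary_group.
  - move=> _ /mapP[i _ ->].
    have Mq0 : (M%:~R : rat) != 0 by rewrite intr_eq0.
    exists 1%N, (fun=> (M%:~R)^-1), (fun=> Psi (y i *~ M)); split=> [_|].
      exists (Psi (p1 (y i))); first by exists (p1 (y i)).
      exists (Psi (p2 (y i))); last by rewrite -raddfD pM.
      by exists (p2 (y i)) => //; exact: p2K.
    by rewrite big_ord1 raddfMz -scaler_int scalerA mulVf // scale1r.
have sG := generated_subgroup (Psi @` H `|` Psi @` K `|` [set` z]).
have GE : group_of_data (Psi @` H) (Psi @` K) z = Psi @` [set: V].
  apply/seteqP; split.
    apply: generated_min; first exact: image_subgroup.
    by move=> w [[[v _ <-]|[v _ <-]]|/mapP[i _ ->]]; [exists v|exists v|exists (y i)].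
  have GH v : H v -> group_of_data (Psi @` H) (Psi @` K) z (Psi v).
    by move=> Hv; apply: generated_sub; left; left; exists v.
  have GK v : K v -> group_of_data (Psi @` H) (Psi @` K) z (Psi v).
    by move=> Kv; apply: generated_sub; left; right; exists v.
  move=> _ [v _ <-].
  (* A high iterate of v under a power of [alpha] that is 1 modulo M lies in [L], and differs from v
     by M w = p1 w + p2 w, an element of H + K. So generators modulo H + K are needed only for
     [L]. *)
  have [q q0 per] := alpha_period pr alphaE M0.
  have [j Lj] := dil v; have [w wE] := per j v.
  have /hy[x [h [l [Hh Kl vE]]]] : L (iter (q * j) alpha v).
    by apply: (dilation_later aL _ Lj); rewrite leq_pmull.
  have -> : v = comb y x + (h + l) - (p1 w + p2 w) by rewrite -vE pM -wE opprB addrC subrK.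
  have GD u u' : group_of_data (Psi @` H) (Psi @` K) z (Psi u) ->
      group_of_data (Psi @` H) (Psi @` K) z (Psi u') ->
      group_of_data (Psi @` H) (Psi @` K) z (Psi (u + u')).
    by move=> Gu Gu'; rewrite raddfD; exact: (subgroupD sG Gu Gu').
  have GHK u u' : H u -> K u' -> group_of_data (Psi @` H) (Psi @` K) z (Psi (u + u')).
    by move=> Hu Ku'; apply: GD; [exact: GH | exact: GK].
  rewrite raddfB; have [_ GB] := sG; apply: GB; last exact: GHK.
  apply: (GD _ _ _ (GHK _ _ Hh Kl)).
  rewrite additive_comb; apply: (@subgroup_sum _ _ _ _ _ _ sG) => i.
  apply: (subgroupMz _ sG); apply: generated_sub; right.
  by apply/mapP; exists i; rewrite ?mem_enum.
exists r, (Psi @` H), (Psi @` K), z; split=> //.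
  rewrite GE coneImage.
  have -> : [set v | [set: V] v /\ 0 < tau v] `|` [set 0] = Pos.
    rewrite PosE; apply/seteqP; split=> [v [[_ v0]|->]|v /coneE[v0|->]].
    - by apply/coneE; left.
    - by apply/coneE; right.
    - by left.
    - by right.
  exact: image_order_iso.
exists d, r; split.
- exact: image_has_rank PsiI hbh (fun v h => h.1) torH.
- exact: image_has_rank PsiI hbk (fun v h => h.1) torK.
- by rewrite size_map size_enum_ord.
Qed.

End Forward.

Theorem theorem5p6 (R : realType) (G : zmodType) (Gpos : set G)
    (Gord : ordered_group [set: G] Gpos)
    (Gdim : dimension_group [set: G] Gpos)
    (Gsimple : simple_ordered [set: G] Gpos)
    (Gnoncyclic : ~ cyclic_group [set: G]) :
  (stationary_ordered_group [set: G] Gpos <->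
   exists (r : nat) (H K : set (realQ R r)) (z : seq (realQ R r)),
     generating_data H K z /\
     order_iso [set: G] Gpos
       (group_of_data H K z) (first_coord_cone (group_of_data H K z))) /\
  (stationary_ordered_group [set: G] Gpos ->
   exists (r : nat) (H K : set (realQ R r)) (z : seq (realQ R r)),
     [/\ generating_data H K z,
         order_iso [set: G] Gpos
           (group_of_data H K z) (first_coord_cone (group_of_data H K z)) &
         exists rkH rkK : nat,
           [/\ has_rank H rkH, has_rank K rkK & (size z <= minn rkH rkK)%N]]).
Proof.
have fwd := @stationary_group_of_data R G Gpos Gord Gsimple Gnoncyclic.
split=> //; split=> [/fwd[r [H [K [z [data iso _]]]]]|[r [H [K [z [data iso]]]]]].
  by exists r, H, K, z.
exact: stationary_ordered_iso iso (group_of_data_stationary data).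
Qed.
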